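(* Let $p'=p/(p-1)$. Assume that for every $k\in\mathbb{N}$, $D_kG\in W^{1,p'}(X,\mu)\cup BUC(X;\mathbb{R})$. Then $$\{r\in\mathbb{R}:\ q_1(r)>0\}=(\operatorname{ess\,inf}G,\ \operatorname{ess\,sup}G),$$ where the essential infimum and supremum are with respect to $\mu$.
   Context: Let $X$ be a separable real Banach space with a nondegenerate centered Gaussian measure $\mu$ (a Borel probability), covariance $Q:X^*\to X$, and Cameron--Martin space $H$ with inner product $\langle\cdot,\cdot\rangle_H$ and norm $|\cdot|_H$. Fix an orthonormal basis $\{v_k:k\in\mathbb{N}\}$ of $H$ contained in $Q(X^* )$. Sobolev spaces: smooth cylindrical functions are $f(x)=\varphi(l_1(x),\dots,l_n(x))$ with $n\in\mathbb{N}$, $\varphi\in C_b^\infty(\mathbb{R}^n)$, $l_i\in X^*$; $D_Hf(x)\in H$ denotes the gradient along $H$: $f(x+h)-f(x)=\langle D_Hf(x),h\rangle_H+o(|h|_H)$, $h\in H$. For $1\le t<\infty$, $W^{1,t}(X,\mu)\subset L^t(X,\mu)$ is the completion of the smooth cylindrical functions in the norm $\|f\|_{W^{1,t}}=\|f\|_{L^t(X,\mu)}+(\int_X|D_Hf|_H^t\,d\mu)^{1/t}$, and $D_H$ also denotes the (closed) extension to $W^{1,t}(X,\mu)$; $D_kf=\langle D_Hf,v_k\rangle_H$. $W^{1,t}(X,\mu;H)$ is defined in the same way starting from the linear span of the $H$-valued functions $x\mapsto\varphi(x)h$ ($\varphi$ smooth cylindrical, $h\in H$), using the Hilbert--Schmidt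 norm for the derivative. For an open set $A\subset X$, $C_t(A)=\inf\{\|g\|_{W^{1,t}(X,\mu)}: g\in W^{1,t}(X,\mu),\ g\ge 1\ \mu\text{-a.e. on }A\}$. A function $f:X\to\mathbb{R}$ is $C_t$-quasicontinuous if for every $\varepsilon>0$ there is an open set $A_\varepsilon$ with $C_t(A_\varepsilon)<\varepsilon$ such that the restriction of $f$ to $X\setminus A_\varepsilon$ is continuous. Standing assumption: $1<p<\infty$, and $G:X\to\mathbb{R}$ is a fixed Borel, $C_p$-quasicontinuous version of an element of $W^{1,p}(X,\mu)$ such that $D_HG\neq0$ $\mu$-a.e. and $\frac{D_HG}{|D_HG|_H^2}\in W^{1,p}(X,\mu;H)$. $BUC(X;\mathbb{R})$ is the space of bounded uniformly continuous functions $X\to\mathbb{R}$. The function $F_1(r)=\mu(\{G<r\})$ is continuously differentiable on $\mathbb{R}$, and $q_1:=F_1'$, i.e. $q_1$ is the continuous density of the image measure $\mu\circ G^{-1}$ with respect to Lebesgue measure. *)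

(* Defs.v *)
From HB Require Import structures.
From mathcomp Require Import all_boot all_order all_algebra.
From mathcomp Require Import all_classical all_reals all_analysis.

Set Implicit Arguments.
Unset Strict Implicit.
Unset Printing Implicit Defensive.

Import Order.TTheory GRing.Theory Num.Theory.
Import numFieldNormedType.Exports.

Local Open Scope classical_set_scope.
Local Open Scope ring_scope.

Notation borelT X := (g_sigma_algebraType (@open X)).

Definition separable_space (T : topologicalType) : Prop :=
  exists2 D : set T, countable D & dense D.

(* Iterated partial derivative: [partial [:: i1; ..; ik] f] is
   d_i1 ( ... (d_ik f)). *)
Fixpoint partial (R : realType) (n : nat) (s : seq 'I_n) (f : 'rV[R]_n -> R) :
    'rV[R]_n -> R :=
  if s is i :: s' then
    fun x => derive (partial s' f : 'rV[R]_n -> R^o) x (delta_mx 0 i)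
  else f.

Definition Cb_infty (R : realType) (n : nat) (f : 'rV[R]_n -> R) : Prop :=
  forall s : seq 'I_n,
    [/\ continuous (partial s f),
        exists M : R, forall x, `|partial s f x| <= M
      & forall (i : 'I_n) x,
          derivable (partial s f : 'rV[R]_n -> R^o) x (delta_mx 0 i)].

Section gaussian_banach.
Context {R : realType} {X : completeNormedModType R}.

Definition cont_dual : set (X -> R) :=
  [set l : X -> R | scalar l /\ continuous l].

Definition BUC : set (X -> R) :=
  [set f : X -> R | (exists M : R, forall x, `|f x| <= M) /\ unif_continuous f].

Definition smooth_cylindrical (f : X -> R) : Prop :=
  exists (n : nat) (phi : 'rV[R]_n -> R) (l : 'I_n -> X -> R),
    [/\ Cb_infty phi, forall i, cont_dual (l i)
      & forall x, f x = phi (\row_i l i x)].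

Variable mu : probability (borelT X) R.

(* Every continuous functional has a centered Gaussian law with standard
   deviation s; [normal_prob 0 0] is not a Dirac mass, hence the case split. *)
Definition centered_gaussian : Prop :=
  forall l, cont_dual l -> exists2 s : R, 0 <= s &
    forall A : set (measurableTypeR R), measurable A ->
      mu (l @^-1` A) = if s == 0 then \d_(0 : R) A else normal_prob 0 s A.

Definition nondegenerate_measure : Prop :=
  forall l, cont_dual l -> (exists x, l x != 0) ->
    (0 < \int[mu]_x ((l x) ^+ 2)%:E)%E.

(* The covariance Q : X^* -> X, where the Bochner integral
   Q l = \int l(x) x mu(dx) is characterized by duality. *)
Definition covariance_op (l : X -> R) : X :=
  get [set x : X | forall m, cont_dual m ->
    m x = \int[mu]_y (l y * m y)].

(* g is in the closure of X^* in L^2(mu). *)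
Definition dual_L2_closure (g : X -> R) : Prop :=
  measurable_fun [set: borelT X] g /\
  forall e : R, 0 < e -> exists2 l, cont_dual l &
    (Lnorm mu 2%:E (fun x => (g x - l x)%:E) < e%:E)%E.

(* h = Q g for the extension of Q to the L^2-closure of X^*. *)
Definition is_repr (h : X) (g : X -> R) : Prop :=
  dual_L2_closure g /\ forall l, cont_dual l -> l h = \int[mu]_x (g x * l x).

Definition cameron_martin : set X := [set h | exists g, is_repr h g].

(* The mu-a.e. unique representative of h in the L^2-closure of X^*. *)
Definition CMhat (h : X) : X -> R := get [set g : X -> R | is_repr h g].

Definition innerH (h k : X) : R := \int[mu]_x (CMhat h x * CMhat k x).

Definition normH (h : X) : R := Num.sqrt (innerH h h).

Definition orthonormal_basisH (v : nat -> X) : Prop :=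
  [/\ forall k, cameron_martin (v k),
      forall i j, innerH (v i) (v j) = (i == j)%:R
    & forall h, cameron_martin h ->
        normH (h - \sum_(k < n) innerH h (v k) *: v k) @[n --> \oo] --> (0 : R)].

(* As H is separable, weak measurability is Borel measurability into H. *)
Definition measurableH (F : X -> X) : Prop :=
  (forall x, cameron_martin (F x)) /\
  forall h, cameron_martin h ->
    measurable_fun [set: borelT X] (fun x => innerH (F x) h).

Definition is_gradH (f : X -> R) (x u : X) : Prop :=
  cameron_martin u /\
  forall e : R, 0 < e -> exists2 d : R, 0 < d &
    forall h, cameron_martin h -> normH h < d ->
      `|f (x + h) - f x - innerH u h| <= e * normH h.

Definition gradH (f : X -> R) (x : X) : X := get [set u | is_gradH f x u].

(* f belongs to W^{1,t}(X, mu) and Df is a version of D_H f: the completion is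
   realized as the closure of the graph of D_H on smooth cylindrical functions. *)
Definition sobolev_grad (t : R) (f : X -> R) (Df : X -> X) : Prop :=
  [/\ measurable_fun [set: borelT X] f, measurableH Df
    & exists fn : nat -> X -> R,
      [/\ forall n, smooth_cylindrical (fn n),
          Lnorm mu t%:E (fun x => (fn n x - f x)%:E) @[n --> \oo] --> 0%E
        & Lnorm mu t%:E (fun x => (normH (gradH (fn n) x - Df x))%:E)
            @[n --> \oo] --> 0%E]].

Definition sobolev (t : R) (f : X -> R) : Prop :=
  exists Df, sobolev_grad t f Df.

Definition sobolev_norm (t : R) (f : X -> R) (Df : X -> X) : \bar R :=
  (Lnorm mu t%:E (fun x => (f x)%:E) +
   Lnorm mu t%:E (fun x => (normH (Df x))%:E))%E.

(* Operators on H are functions X -> X whose values off H are irrelevant. *)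
Definition bounded_opH (T : X -> X) : Prop :=
  [/\ forall h, cameron_martin h -> cameron_martin (T h),
      forall (a : R) h k, cameron_martin h -> cameron_martin k ->
        T (a *: h + k) = a *: T h + T k
    & exists C : R, forall h, cameron_martin h -> normH (T h) <= C * normH h].

Definition is_derivH (F : X -> X) (x : X) (T : X -> X) : Prop :=
  bounded_opH T /\
  forall e : R, 0 < e -> exists2 d : R, 0 < d &
    forall h, cameron_martin h -> normH h < d ->
      normH (F (x + h) - F x - T h) <= e * normH h.

Definition derivH (F : X -> X) (x : X) : X -> X :=
  get [set T : X -> X | is_derivH F x T].

(* Hilbert--Schmidt norm, computed in the orthonormal basis v of H. *)
Definition hs_norm (v : nat -> X) (T : X -> X) : \bar R :=
  ((\sum_(0 <= k <oo) ((normH (T (v k))) ^+ 2)%:E) `^ 2^-1)%E.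

Definition smooth_cylindricalH (F : X -> X) : Prop :=
  exists (n : nat) (phi : 'I_n -> X -> R) (h : 'I_n -> X),
    [/\ forall i, smooth_cylindrical (phi i),
        forall i, cameron_martin (h i)
      & forall x, F x = \sum_(i < n) phi i x *: h i].

(* F belongs to W^{1,t}(X, mu; H) and DF is a version of D_H F. *)
Definition sobolevH_deriv (v : nat -> X) (t : R) (F : X -> X)
    (DF : X -> X -> X) : Prop :=
  [/\ measurableH F,
      forall x, bounded_opH (DF x) /\ (hs_norm v (DF x) < +oo)%E,
      forall i j, measurable_fun [set: borelT X]
        (fun x => innerH (DF x (v i)) (v j))
    & exists Fn : nat -> X -> X,
      [/\ forall n, smooth_cylindricalH (Fn n),
          Lnorm mu t%:E (fun x => (normH (Fn n x - F x))%:E)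
            @[n --> \oo] --> 0%E
        & Lnorm mu t%:E (fun x => hs_norm v (fun h => derivH (Fn n) x h - DF x h))
            @[n --> \oo] --> 0%E]].

Definition sobolevH (v : nat -> X) (t : R) (F : X -> X) : Prop :=
  exists DF, sobolevH_deriv v t F DF.

Definition capacity (t : R) (A : set X) : \bar R :=
  ereal_inf [set c | exists g Dg,
    [/\ sobolev_grad t g Dg, {ae mu, forall x, A x -> 1 <= g x}
      & c = sobolev_norm t g Dg]].

Definition quasicontinuous (t : R) (f : X -> R) : Prop :=
  forall e : R, 0 < e -> exists A : set X,
    [/\ open A, (capacity t A < e%:E)%E & {within ~` A, continuous f}].

Definition sublevel_mass (G : X -> R) (r : R) : R :=
  fine (mu [set x | G x < r]).

End gaussian_banach.

(* Main.v *)
Require Import Defs.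
From HB Require Import structures.
From mathcomp Require Import all_boot all_order all_algebra.
From mathcomp Require Import all_classical all_reals all_analysis.
From mathcomp Require Import ess_sup_inf measurable_realfun.
From mathcomp Require Import ring lra.

(** That the density vanishes off the essential range holds because the
    distribution function is constant there ([density_gt0_inside]). The content
    is the converse. Suppose that the density vanishes at a level [r] strictly
    between the essential bounds. Then [E = {G < r}] has a mass different from
    [0] and [1]. It is shown that along almost every line in each direction
    [v k] of the basis the set [E] is null or conull; by ergodicity [E] would be
    trivial, a contradiction.

    Lines. Let [v = Q l] be a unit vector of [H] with [l] in the dual. Under [mu]
    the functional [l] is standard normal and independent of [x - l x *: v], so
    that [mu] is the average over [y] of the standard normal laws on the lines
    [y + R v] ([image_line]). The proof compares characteristic functionals,
    which determine finite Borel measures on a separable space ([char_unique]);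
    that [Q l] exists in [X] is [covariance_exists].

    No crossing. Since the derivative of the distribution function vanishes at
    [r], the mass of the band [r - 1 / n <= G < r] is negligible with respect to
    [1 / n], and along a subsequence of [n] the same holds for the normal measure
    of the band on almost every line ([band_on_lines]). On almost every line, off
    a null set, increments of [G] are bounded by integrals of the derivative
    [D_k G] ([sobolev_on_lines]). This derivative is bounded on bounded pieces of
    the line: either it is bounded on [X], or it is itself a Sobolev function and
    its increments are bounded by integrals over the line
    ([slope_bounded_on_lines]). So [G] is locally Lipschitz on the line, and a
    Lipschitz function with values on both sides of [r] spends in the band a
    length at least proportional to its width [1 / n] ([crossing]). Hence [G]
    does not cross [r] ([sublevel_constant_on_lines]).

    Ergodicity. If [E] is null or conull on almost every line in each direction
    [v k], then averaging [\1_E * cos (m + th)] over the lines in the directions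
    [v 0], [v 1] and so on removes the coordinates of [m] one after the other,
    and in the limit [\1_E] is independent of every functional [m]. Then [E] is
    independent of itself ([zero_one_law]). *)

Set Implicit Arguments.
Unset Strict Implicit.
Unset Printing Implicit Defensive.

Import Order.TTheory GRing.Theory Num.Theory.
Import numFieldNormedType.Exports.

Local Open Scope classical_set_scope.
Local Open Scope ring_scope.

(** * Integrals against image measures *)

Section image_measure.
Context d d' (T1 : measurableType d) (T2 : measurableType d') (R : realType).
Variables (mu : {measure set T1 -> \bar R}) (nu : {measure set T2 -> \bar R}).
Variable phi : T1 -> T2.
Hypothesis mphi : measurable_fun setT phi.
Hypothesis image : forall A, measurable A -> mu (phi @^-1` A) = nu A.

Lemma ge0_integral_image (f : T2 -> \bar R) : measurable_fun setT f ->
  (forall y, 0 <= f y)%E -> (\int[mu]_x f (phi x) = \int[nu]_y f y)%E.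
Proof.
move=> mf f0; rewrite -[LHS](@ge0_integral_pushforward _ _ _ _ _ phi mphi mu setT f)//.
by apply: eq_measure_integral => A mA _; exact: image.
Qed.

Lemma integral_image (f : T2 -> \bar R) : measurable_fun setT f ->
  (\int[mu]_x f (phi x) = \int[nu]_y f y)%E.
Proof.
move=> mf; rewrite [LHS]integralE [RHS]integralE; congr (_ - _)%E.
- rewrite -(ge0_integral_image (measurable_funepos mf))//.
  by apply: eq_integral => x _; rewrite !funeposE.
- rewrite -(ge0_integral_image (measurable_funeneg mf))//.
  by apply: eq_integral => x _; rewrite !funenegE.
Qed.

Lemma integrable_image (f : T2 -> \bar R) : measurable_fun setT f ->
  nu.-integrable setT f -> mu.-integrable setT (f \o phi).
Proof.
move=> mf /integrableP[_ fi]; apply/integrableP; split.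
  exact: measurableT_comp.
rewrite (@ge0_integral_image (fun y => `|f y|%E))//.
exact: measurableT_comp.
Qed.

End image_measure.

(** * The centred normal law *)

Section centered_normal.
Context {R : realType}.
Variable s : R.

(** [normal_prob] lives on the copy of [R] that carries Lebesgue measure; the
    product measures below need the structure that [R] carries itself. *)
Definition gauss : set R -> \bar R := normal_prob 0 s.

Let gauss0 : gauss set0 = 0%E. Proof. exact: measure0. Qed.

Let gauss_ge0 A : (0 <= gauss A)%E. Proof. exact: measure_ge0. Qed.

Let gauss_sigma_additive : semi_sigma_additive gauss.
Proof. exact: (@measure_semi_sigma_additive _ _ _ (normal_prob 0 s)). Qed.

HB.instance Definition _ := isMeasure.Build _ R R
  gauss gauss0 gauss_ge0 gauss_sigma_additive.

Let gauss_setT : gauss [set: R] = 1%E.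
Proof. exact: (@probability_setT _ _ _ (normal_prob 0 s)). Qed.

HB.instance Definition _ :=
  @Measure_isProbability.Build _ R R gauss gauss_setT.

End centered_normal.

Section gaussian_line.
Context {R : realType}.
Implicit Types (s a th x : R).
Local Notation leb := (@lebesgue_measure R).

(** The density is a Radon--Nikodym derivative, which turns integrals against
    one law into integrals against the other. *)
Lemma ge0_integral_normal s (f : R -> \bar R) :
  measurable_fun setT f -> (forall x, 0 <= f x)%E ->
  (\int[gauss s]_x f x = \int[leb]_x (f x * (normal_pdf 0 s x)%:E))%E.
Proof.
move=> mf f0; have mp : measurable_fun setT (fun x => (normal_pdf 0 s x)%:E).
  by apply/measurable_EFinP; exact: measurable_normal_pdf.
have dom := normal_prob_dominates 0 s.
have mid : measurable_fun setT (id : measurableTypeR R -> R) by exact: measurable_id.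
have image A : measurable A -> normal_prob 0 s (id @^-1` A) = gauss s A by [].
rewrite -(ge0_integral_image mid image mf f0).
rewrite -(Radon_Nikodym_SigmaFinite.change_of_variables dom f0 measurableT mf).
have mg : measurable_fun setT (Radon_Nikodym_SigmaFinite.f (normal_prob 0 s) leb).
  exact: measurable_int (Radon_Nikodym_SigmaFinite.f_integrable dom).
have ae_pdf : ae_eq leb setT (Radon_Nikodym_SigmaFinite.f (normal_prob 0 s) leb)
    (fun x => (normal_pdf 0 s x)%:E).
  apply: integral_ae_eq => //.
    exact: Radon_Nikodym_SigmaFinite.f_integrable.
  by move=> A _ mA; rewrite -Radon_Nikodym_SigmaFinite.f_integral.
apply: ae_eq_integral => //; try exact: emeasurable_funM.
by move: ae_pdf; apply: (@filterS _ _ (ae_filter_ringOfSetsType leb)) => x ex xT; rewrite ex.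
Qed.

Lemma integral_normal s (f : R -> R) : measurable_fun setT f ->
  (\int[gauss s]_x (f x)%:E = \int[leb]_x (f x * normal_pdf 0 s x)%:E)%E.
Proof.
move=> mf; have mEf : measurable_fun setT (EFin \o f) by exact/measurable_EFinP.
rewrite [LHS]integralE ge0_integral_normal//; last exact: measurable_funepos.
rewrite ge0_integral_normal//; last exact: measurable_funeneg.
rewrite [RHS]integralE; congr (_ - _)%E; apply: eq_integral => x _.
- by rewrite !funeposE /= -!EFin_max -EFinM maxr_pMl ?normal_pdf_ge0// mul0r.
- rewrite !funenegE /= -!EFin_max -EFinM maxr_pMl ?normal_pdf_ge0//.
  by rewrite mul0r mulNr.
Qed.

(** A wider normal density dominates the density times a quadratic: the source of
    all integrability and decay statements below. *)
Lemma gauss_tail s : s != 0 ->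
  exists2 K, 0 <= K & forall x,
    (1 + x ^+ 2) * normal_pdf 0 s x <= K * normal_pdf 0 (2 * s) x.
Proof.
move=> s0; have s20 : 2 * s != 0 by rewrite mulf_neq0// pnatr_eq0.
have ss : 0 < s ^+ 2 by rewrite exprn_even_gt0.
have p1 := normal_peak_gt0 s0; have p2 := normal_peak_gt0 s20.
exists ((1 + 4 * s ^+ 2) * (normal_peak s / normal_peak (2 * s))).
  by rewrite mulr_ge0 ?divr_ge0 ?addr_ge0// ?ltW// mulr_gt0.
move=> x; rewrite !normal_pdfE//.
rewrite mulrCA.
have -> : (1 + 4 * s ^+ 2) * (normal_peak s / normal_peak (2 * s)) *
    (normal_peak (2 * s) * normal_fun 0 (2 * s) x) =
    normal_peak s * ((1 + 4 * s ^+ 2) * normal_fun 0 (2 * s) x).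
  by field; rewrite gt_eqF.
rewrite ler_pM2l//.
rewrite /normal_fun !subr0.
set u := x ^+ 2 / (4 * s ^+ 2).
have u0 : 0 <= u by rewrite divr_ge0 ?sqr_ge0// mulr_ge0// ltW.
have xu : x ^+ 2 = 4 * s ^+ 2 * u.
  by rewrite /u mulrC divfK// mulf_neq0 ?pnatr_eq0// gt_eqF.
have -> : - x ^+ 2 / (s ^+ 2 *+ 2) = - u + - u.
  by rewrite /u; field.
have -> : - x ^+ 2 / ((2 * s) ^+ 2 *+ 2) = - u / 2.
  by rewrite /u; field.
rewrite expRD mulrA ler_pM ?expR_ge0// ?mulr_ge0 ?addr_ge0 ?sqr_ge0 ?expR_ge0//.
  rewrite expRN ler_pdivrMr ?expR_gt0//.
  have h1 : 1 <= expR u by rewrite -expR0 ler_expR.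
  have h2 : u <= expR u by apply: le_trans (expR_ge1Dx u); rewrite lerDr.
  have h3 : 4 * s ^+ 2 * u <= 4 * s ^+ 2 * expR u.
    by rewrite ler_wpM2l// mulr_ge0// ltW.
  rewrite xu; lra.
by rewrite ler_expR; lra.
Qed.

End gaussian_line.

Section stein.
Context {R : realType}.
Implicit Types (s a th x : R).
Local Notation leb := (@lebesgue_measure R).

Lemma is_derive_normal_pdf s x : s != 0 ->
  is_derive x 1 (normal_pdf 0 s : R -> R^o) (- x / s ^+ 2 * normal_pdf 0 s x).
Proof.
move=> s0; rewrite normal_pdfE// /normal_fun.
apply: is_derive_eq.
rewrite /GRing.scale/= !subr0; field.
exact: s0.
Qed.

Lemma integrable_normal_quadratic s (k : R -> R) C : s != 0 ->
  measurable_fun [set: R] k -> (forall x, `|k x| <= C * (1 + x ^+ 2)) ->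
  leb.-integrable setT (fun x => (k x * normal_pdf 0 s x)%:E).
Proof.
move=> s0 mk kC; have [K K0 tail] := gauss_tail s0.
have C0 : 0 <= C.
  have := kC 0; rewrite expr0n/= addr0 mulr1; exact: le_trans.
apply: (@le_integrable _ _ _ leb setT measurableT _
    (fun x => (C * K)%:E * (normal_pdf 0 (2 * s) x)%:E)%E).
- apply/measurable_EFinP; apply: measurable_funM => //.
  exact: measurable_normal_pdf.
- move=> x _; rewrite -EFinM !abse_EFin lee_fin !normrM.
  rewrite !(ger0_norm (normal_pdf_ge0 _ _ _)) !(ger0_norm K0, ger0_norm C0).
  apply: le_trans (ler_wpM2r (normal_pdf_ge0 _ _ _) (kC x)) _.
  by rewrite -!mulrA ler_wpM2l.
- apply: integrableZl => //; exact: integrable_normal_pdf.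
Qed.

Lemma Rintegral_cvg_itv (k : R -> R) :
  leb.-integrable setT (EFin \o k) ->
  (\int[leb]_(x in `[- n.+1%:R, n.+1%:R]) k x) @[n --> \oo] --> \int[leb]_x k x.
Proof.
move=> ik; have mk := measurable_int _ ik.
apply: fine_cvg; rewrite fineK; last exact: integrable_fin_num.
under eq_fun do rewrite integral_mkcond.
apply: (@dominated_cvg _ _ _ leb setT measurableT _ _ (abse \o (EFin \o k))) => //.
- by move=> n; apply/(measurable_restrict _ _ _) => //; exact: measurable_funTS.
- move=> x _; apply: cvg_near_cst; near=> n.
  rewrite patchE mem_set//= in_itv/= -ler_norml.
  have : `|x| <= n%:R by near: n; exact: nbhs_infty_ger.
  by move=> /le_trans; apply; rewrite ler_nat.
- exact: integrable_abse.
- move=> n x _; rewrite patchE; case: ifPn => // _.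
  by rewrite /= normr0 lee_fin.
Unshelve. all: by end_near.
Qed.

(** Stein's identity. It is an integration by parts: the derivative of
    [- s ^+ 2 * h] times the density has zero integral, because this primitive
    vanishes at infinity. *)
Lemma gauss_stein s (h h' : R -> R) C : s != 0 ->
  (forall x, is_derive x 1 (h : R -> R^o) (h' x)) -> continuous h' ->
  (forall x, `|h x| <= C * (1 + `|x|)) -> (forall x, `|h' x| <= C) ->
  \int[leb]_x (x * h x * normal_pdf 0 s x) =
  s ^+ 2 * \int[leb]_x (h' x * normal_pdf 0 s x).
Proof.
move=> s0 dh ch' hC h'C.
have C0 : 0 <= C by apply: le_trans (h'C 0).
have ch : continuous h.
  move=> x; apply: differentiable_continuous; apply/derivable1_diffP.
  by have [] := dh x.
have mh : measurable_fun [set: R] h by exact: continuous_measurable_fun.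
have mh' : measurable_fun [set: R] h' by exact: continuous_measurable_fun.
have sq x : (1 + `|x|) ^+ 2 <= 2 * (1 + x ^+ 2).
  have -> : x ^+ 2 = `|x| ^+ 2 by rewrite real_normK ?num_real.
  by rewrite -subr_ge0; apply: le_trans (sqr_ge0 (1 - `|x|)) _; lra.
have i1 : leb.-integrable setT (fun x => (x * h x * normal_pdf 0 s x)%:E).
  apply: (@integrable_normal_quadratic s (fun x => x * h x) (2 * C)) => //.
    exact: measurable_funM.
  move=> x; rewrite normrM; apply: le_trans (ler_wpM2l (normr_ge0 _) (hC x)) _.
  have := sq x; have := normr_ge0 x => x0 sqx.
  have := ler_wpM2l C0 sqx; have : 0 <= C * (1 + `|x|) by rewrite mulr_ge0// addr_ge0.
  by nra.
have i2 : leb.-integrable setT (fun x => (h' x * normal_pdf 0 s x)%:E).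
  apply: (@integrable_normal_quadratic s h' C) => // x.
  by apply: le_trans (h'C x) _; rewrite ler_peMr// lerDl sqr_ge0.
pose k x := x * h x * normal_pdf 0 s x - s ^+ 2 * (h' x * normal_pdf 0 s x).
have ik : leb.-integrable setT (EFin \o k).
  exact: (integrableB measurableT i1 (integrableZl measurableT (s ^+ 2) i2)).
suff k0 : \int[leb]_x k x = 0.
  apply/eqP; rewrite -subr_eq0 -RintegralZl// -RintegralB ?k0//.
  exact: (integrableZl measurableT (s ^+ 2) i2).
pose F (x : R) : R := - s ^+ 2 * (normal_pdf 0 s x * h x).
have dF x : is_derive x 1 (F : R -> R^o) (k x).
  have d1 := is_derive_normal_pdf x s0; have d2 := dh x.
  apply: is_derive_eq; rewrite /k /GRing.scale/=; field.
  exact: s0.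
have cpdf := @continuous_normal_pdf R 0 s s0.
have ck : continuous k.
  move=> x; apply: cvgB; first by apply: cvgM; [apply: cvgM|]; [exact: cvg_id|exact: ch|exact: cpdf].
  by apply: cvgM; [exact: cvg_cst|apply: cvgM; [exact: ch'|exact: cpdf]].
have [K K0 tail] := gauss_tail s0.
have s20 : 2 * s != 0 by rewrite mulf_neq0// pnatr_eq0.
(* the primitive decays like the inverse of [1 + `|x|] *)
have FK x : `|F x| <= s ^+ 2 * (C * (2 * (K * normal_peak (2 * s)))) / (1 + `|x|).
  rewrite ler_pdivlMr ?ltr_wpDr// /F mulNr normrN.
  rewrite normrM (ger0_norm (sqr_ge0 s)) normrM -[leLHS]mulrA ler_wpM2l ?sqr_ge0//.
  rewrite (ger0_norm (normal_pdf_ge0 _ _ _)).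
  have t := tail x; have u := normal_pdf_ub 0 x s20.
  have v := ler_wpM2l K0 u; have w := sq x.
  have p0 := normal_pdf_ge0 0 s x.
  have := ler_wpM2l p0 (hC x).
  have := ler_wpM2r p0 (ler_wpM2l C0 w).
  have := ler_wpM2l C0 (le_trans t v).
  have : 0 <= 1 + `|x| by rewrite addr_ge0.
  set N := normal_pdf 0 s x; set M := normal_peak _; set H := `|h x|.
  move=> a1 a2 a3 a4.
  have a5 := ler_wpM2r a1 a4.
  apply: le_trans a5 _; lra.
have FTC n : \int[leb]_(x in `[- n.+1%:R, n.+1%:R]) k x = F n.+1%:R - F (- n.+1%:R).
  rewrite /Rintegral (@continuous_FTC2 _ k F)//=.
  - by rewrite gtrN.
  - exact: continuous_subspaceT.
  - have cF : continuous F.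
      move=> x; apply: differentiable_continuous; apply/derivable1_diffP.
      by have [] := dF x.
    split.
    + by move=> x _; have [] := dF x.
    + by apply: cvg_at_right_filter; exact: cF.
    + by apply: cvg_at_left_filter; exact: cF.
  - by move=> x _; rewrite derive1E; have [_ ->] := dF x.
have c1 : (\int[leb]_(x in `[- n.+1%:R, n.+1%:R]) k x) @[n --> \oo] --> (0 : R).
  under eq_fun do rewrite FTC.
  have cF (y : nat -> R) : (forall n, `|y n| = n.+1%:R) ->
      F (y n) @[n --> \oo] --> (0 : R).
    move=> yn; set A := s ^+ 2 * (C * (2 * (K * normal_peak (2 * s)))) in FK.
    have A0 : 0 <= A.
      apply: mulr_ge0; first exact: sqr_ge0.
      by do 3 apply: mulr_ge0 => //; exact: normal_peak_ge0.
    apply: norm_cvg0.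
    apply: (@squeeze_cvgr _ _ _ _ (cst 0) (fun n => A * harmonic n)).
    - apply: nearW => n /=; rewrite normr_ge0/=.
      apply: le_trans (FK _) _; rewrite ler_wpM2l// yn /=.
      by rewrite lef_pV2 ?posrE ?ltr_wpDr// lerDr.
    - exact: cvg_cst.
    - rewrite -[X in _ --> X](mulr0 A); apply: cvgM; first exact: cvg_cst.
      exact: cvg_harmonic.
  have F1 : F n.+1%:R @[n --> \oo] --> (0 : R) by apply: cF => n; rewrite normr_nat.
  have F2 : F (- n.+1%:R) @[n --> \oo] --> (0 : R).
    by apply: cF => n; rewrite normrN normr_nat.
  by have := cvgB F1 F2; rewrite subrr; apply.
have c2 : (\int[leb]_(x in `[- n.+1%:R, n.+1%:R]) k x) @[n --> \oo] -->
    \int[leb]_x k x.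
  exact: Rintegral_cvg_itv.
exact: (cvg_unique _ c2 c1).
Qed.

End stein.

Section gauss_facts.
Context {R : realType}.
Implicit Types (s a th x : R).
Local Notation leb := (@lebesgue_measure R).

Lemma integrable_gauss s (f : R -> R) : measurable_fun [set: R] f ->
  leb.-integrable setT (fun x => (f x * normal_pdf 0 s x)%:E) ->
  (gauss s).-integrable setT (EFin \o f).
Proof.
move=> mf /integrableP[_ fi]; apply/integrableP; split; first exact/measurable_EFinP.
apply: le_lt_trans fi; rewrite (ge0_integral_normal s) //.
- apply: ge0_le_integral => //.
  + by move=> x _; rewrite mule_ge0// lee_fin normal_pdf_ge0.
  + apply: emeasurable_funM.
      by apply: measurableT_comp => //; exact/measurable_EFinP.
    by apply/measurable_EFinP; exact: measurable_normal_pdf.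
  + apply: measurableT_comp => //; apply/measurable_EFinP.
    by apply: measurable_funM => //; exact: measurable_normal_pdf.
  + move=> x _ /=; rewrite lee_fin normrM (ger0_norm (normal_pdf_ge0 _ _ _)).
    exact: lexx.
- by apply: measurableT_comp => //; exact/measurable_EFinP.
Qed.

Lemma gauss_second_moment s : s != 0 ->
  (gauss s).-integrable setT (fun x => (x ^+ 2)%:E) /\
  (\int[gauss s]_x (x ^+ 2)%:E = (s ^+ 2)%:E)%E.
Proof.
move=> s0.
have mX : measurable_fun [set: R] (fun x : R => x ^+ 2) by exact: measurable_funX.
have lX : leb.-integrable setT (fun x => (x ^+ 2 * normal_pdf 0 s x)%:E).
  apply: (@integrable_normal_quadratic _ s (fun x => x ^+ 2) 1) => // x.
  by rewrite mul1r ger0_norm ?sqr_ge0// lerDr.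
split; first exact: integrable_gauss.
rewrite integral_normal//.
rewrite -[LHS]fineK; last exact: integrable_fin_num.
congr EFin.
transitivity (\int[leb]_x (x * x * normal_pdf 0 s x)); first by [].
rewrite (@gauss_stein R s (fun x => x) (fun=> 1) 1 s0).
- rewrite /Rintegral; under eq_integral do rewrite mul1r.
  by rewrite integral_normal_pdf mulr1.
- by move=> x; exact: cvg_cst.
- by move=> x; rewrite mul1r lerDr.
- by move=> x; rewrite normr1.
Qed.

(** As a function [c] of the frequency the integral satisfies, by Stein's identity,
    the linear equation [c' = - s ^+ 2 * a * c], so that its product with
    [expR (s ^+ 2 * a ^+ 2 / 2)] is constant. *)
Lemma gauss_cos s a0 th : s != 0 ->
  \int[gauss s]_x cos (a0 * x + th) = expR (- (s ^+ 2 * a0 ^+ 2) / 2) * cos th.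
Proof.
move=> s0.
have dcos a x : is_derive x 1 (fun x : R => sin (a * x + th) : R^o) (a * cos (a * x + th)).
  by apply: is_derive_eq; rewrite /GRing.scale/= !mulr1 addr0 mulrC.
have mlin a : measurable_fun [set: R] (fun x : R => a * x + th).
  by apply: measurable_funD => //; apply: measurable_funM.
have mc a : measurable_fun [set: R] (fun x : R => cos (a * x + th)).
  by apply: measurableT_comp (mlin a); apply: continuous_measurable_fun; exact: continuous_cos.
have ms a : measurable_fun [set: R] (fun x : R => sin (a * x + th)).
  by apply: measurableT_comp (mlin a); apply: continuous_measurable_fun; exact: continuous_sin.
have clin a : continuous (fun x : R => a * x + th).
  by move=> x; apply: cvgD; [apply: cvgM; [exact: cvg_cst|exact: cvg_id]|exact: cvg_cst].
have cs1 y : `|cos y| <= 1 :> R by rewrite ler_norml cos_geN1 cos_le1.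
have sn1 y : `|sin y| <= 1 :> R by rewrite ler_norml sin_geN1 sin_le1.
pose f a x := cos (a * x + th) * normal_pdf 0 s x.
pose c a := \int[leb]_x f a x.
have stein a : \int[leb]_x (x * sin (a * x + th) * normal_pdf 0 s x) =
    s ^+ 2 * (a * c a).
  rewrite (@gauss_stein R s (fun x => sin (a * x + th)) (fun x => a * cos (a * x + th)) (1 + `|a|) s0).
  - congr (_ * _); rewrite /c -RintegralZl//; last first.
      apply: (@integrable_normal_quadratic _ s (fun x => cos (a * x + th)) 1) => // x.
      by apply: le_trans (cs1 _) _; rewrite mul1r lerDl sqr_ge0.
    by apply: eq_Rintegral => x _; rewrite /f mulrA.
  - move=> x; apply: cvgM; first exact: cvg_cst.
    by apply: continuous_comp; [exact: clin|exact: continuous_cos].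
  - move=> x; apply: le_trans (sn1 _) _.
    have := normr_ge0 x; have := normr_ge0 a; nra.
  - move=> x; rewrite normrM; apply: le_trans (ler_wpM2l _ (cs1 _)) _ => //.
    by rewrite mulr1 lerDr.
have df a x : is_derive a 1 (fun a => f a x : R^o) (- (x * sin (a * x + th) * normal_pdf 0 s x)).
  rewrite /f; apply: is_derive_eq; rewrite /GRing.scale/=; ring.
have dc a : is_derive a 1 (c : R -> R^o) (- s ^+ 2 * a * c a).
  have Ia : `]a - 1, a + 1[%classic a by rewrite /= in_itv/= ltrBlDr !ltrDl ltr01.
  have intf x : `]a - 1, a + 1[%classic x -> leb.-integrable setT (EFin \o f x).
    move=> _; apply: (@integrable_normal_quadratic _ s (fun y => cos (x * y + th)) 1) => // y.
    by apply: le_trans (cs1 _) _; rewrite mul1r lerDl sqr_ge0.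
  have derf1 x y : `]a - 1, a + 1[%classic x -> setT y -> derivable (f ^~ y) x 1.
    by move=> _ _; have [] := df x y.
  have p1E x y : partial1of2 f x y = - (y * sin (x * y + th) * normal_pdf 0 s y).
    by rewrite partial1of2E; have [_ ->] := df x y.
  pose G y := `|y| * normal_pdf 0 s y.
  have G0 y : 0 <= G y by rewrite mulr_ge0// normal_pdf_ge0.
  have intG : leb.-integrable setT (EFin \o G).
    apply: (@integrable_normal_quadratic _ s (fun y : R => `|y|) 1) => // y.
    rewrite mul1r normr_id.
    have := sqr_ge0 (1 - `|y|); rewrite -[in _ <= 1 + _](real_normK (num_real y)).
    by have := sqr_ge0 `|y|; nra.
  have Gub x y : `]a - 1, a + 1[%classic x -> setT y -> `|partial1of2 f x y| <= G y.
    move=> _ _; rewrite p1E normrN !normrM (ger0_norm (normal_pdf_ge0 _ _ _)).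
    by rewrite ler_wpM2r ?normal_pdf_ge0// ler_piMr.
  have d1 := derivable_under_integral measurableT Ia intf derf1 G0 intG Gub.
  have d2 := differentiation_under_integral measurableT Ia intf derf1 G0 intG Gub.
  apply: DeriveDef; first exact: d1.
  rewrite -derive1E d2; under eq_Rintegral do rewrite p1E -mulN1r.
  rewrite RintegralZl// ?stein; last first.
    apply: (@integrable_normal_quadratic _ s (fun y => y * sin (a * y + th)) 1).
    - exact: s0.
    - exact: measurable_funM.
    - move=> y; rewrite mul1r normrM.
      have := sqr_ge0 (1 - `|y|); rewrite -[in _ <= 1 + _](real_normK (num_real y)).
      by have := sqr_ge0 `|y|; have := sn1 (a * y + th); have := normr_ge0 y; nra.
  ring.
have dg a : is_derive a 1 (fun a => c a * expR (s ^+ 2 * a ^+ 2 / 2) : R^o) 0.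
  have d := dc a; apply: is_derive_eq; rewrite /GRing.scale/=. by field.
have := is_derive_0_is_cst a0 0 dg.
rewrite expr0n/= mulr0 mul0r expR0 !mulr1.
have -> : c 0 = cos th.
  rewrite /c /f; under eq_Rintegral do rewrite mul0r add0r.
  rewrite RintegralZl//; last exact: integrable_normal_pdf.
  by rewrite /Rintegral integral_normal_pdf mulr1.
move=> <-; rewrite mulrCA -expRD mulNr addNr expR0 mulr1.
by rewrite /c /Rintegral integral_normal; [|exact: mc].
Qed.

(** On [[- N, N]] the normal density is bounded below by its value at [N]. *)
Lemma leb_le_gauss s (N : R) : s != 0 -> exists2 C : R, 0 < C &
  forall f : R -> \bar R, measurable_fun setT f -> (forall x, 0 <= f x)%E ->
  (\int[leb]_(x in `[(- N)%R, N]) f x <= C%:E * \int[gauss s]_x f x)%E.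
Proof.
move=> s0; have p0 : 0 < normal_pdf 0 s N.
  by rewrite normal_pdfE// mulr_gt0 ?normal_peak_gt0 ?expR_gt0.
exists (normal_pdf 0 s N)^-1; first by rewrite invr_gt0.
move=> f mf f0; rewrite (ge0_integral_normal s)// -ge0_integralZl//; last 3 first.
- apply: emeasurable_funM => //.
  by apply/measurable_EFinP; exact: measurable_normal_pdf.
- by move=> x _; rewrite mule_ge0// lee_fin normal_pdf_ge0.
- by rewrite lee_fin invr_ge0 ltW.
apply: (@le_trans _ _ (\int[leb]_(x in `[(- N)%R, N])
  ((normal_pdf 0 s N)^-1%:E * (f x * (normal_pdf 0 s x)%:E)))%E).
  apply: ge0_le_integral => //.
  - exact: measurable_funTS.
  - apply: measurable_funTS; apply: emeasurable_funM => //; apply: emeasurable_funM => //.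
    by apply/measurable_EFinP; exact: measurable_normal_pdf.
  - move=> x; rewrite /= in_itv/= -ler_norml => xN.
    rewrite muleCA -EFinM lee_pemulr//= lee_fin ler_pdivlMl// mulr1.
    rewrite normal_pdfE// ler_pM2l ?normal_peak_gt0// ler_expR !subr0.
    rewrite ler_pM2r ?invr_gt0 ?pmulrn_lgt0 ?exprn_even_gt0//.
    by rewrite lerN2 -(real_normK (num_real x)) lerXn2r ?nnegrE// (le_trans _ xN).
apply: ge0_subset_integral => //.
  apply: emeasurable_funM => //; apply: emeasurable_funM => //.
  by apply/measurable_EFinP; exact: measurable_normal_pdf.
by move=> x _; rewrite !mule_ge0// lee_fin ?invr_ge0 ?normal_pdf_ge0// ltW.
Qed.

(** The density is at most [1 / s], since [2 * pi >= 1]. *)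
Lemma gauss_itv_le s (r : R) : 0 < s -> 0 <= r ->
  (gauss s `[(- r)%R, r]%classic <= (2 * r / s)%R%:E)%E.
Proof.
move=> s0 r0; have sn0 : s != 0 by rewrite gt_eqF.
rewrite /gauss /normal_prob.
apply: (@le_trans _ _ (\int[leb]_(x in `[(- r)%R, r]) (s^-1)%:E)%E).
  apply: ge0_le_integral => //.
  - by move=> x _; rewrite lee_fin normal_pdf_ge0.
  - by apply/measurable_EFinP; apply: measurable_funTS; exact: measurable_normal_pdf.
  - move=> x _; rewrite lee_fin; apply: le_trans (normal_pdf_ub _ _ sn0) _.
    rewrite /normal_peak lef_pV2 ?posrE//; last first.
      by rewrite sqrtr_gt0 pmulrn_lgt0// mulr_gt0 ?pi_gt0// exprn_gt0.
    rewrite -[leLHS](ger0_norm (ltW s0)) -sqrtr_sqr ler_wsqrtr//.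
    have := pi_gt0 R; have := pi_ge2 R; have := sqr_ge0 s; nra.
rewrite integral_cst//= lebesgue_measure_itv/= lte_fin.
case: ifPn => _; last by rewrite mule0 lee_fin divr_ge0 ?mulr_ge0// ltW.
rewrite -EFinB -EFinM lee_fin; have : 0 < s^-1 by rewrite invr_gt0.
by rewrite opprK mulrC; nra.
Qed.

End gauss_facts.

(** * Hahn--Banach and norming functionals *)

Lemma eq_le_refl {R : realType} (x y : R) : x = y -> x <= y.
Proof. by move=> ->. Qed.

Section hahn_banach.
Context {R : realType} {X : lmodType R}.
Implicit Types (p q : X -> R) (x y : X) (t : R).

Definition sublinear q : Prop :=
  (forall x y, q (x + y) <= q x + q y) /\
  (forall t x, 0 <= t -> q (t *: x) = t * q x).

Lemma sublinear0 q : sublinear q -> q 0 = 0.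
Proof. by move=> [_ qZ]; rewrite -(scale0r 0) qZ// mul0r. Qed.

Lemma sublinear_oppl q x : sublinear q -> - q (- x) <= q x.
Proof.
move=> sq; rewrite lerNl -subr_ge0 opprK -(sublinear0 sq) -(subrr x) addrC.
exact: sq.1.
Qed.

(** The greatest sublinear minorant [p] of [q] with [p (x + y) = p x + q y] for
    all [x]. *)
Definition flatten_at q y x : R :=
  inf [set q (x + t *: y) - t * q y | t in [set t | 0 <= t]].

Lemma flatten_lb q y x : sublinear q ->
  lbound [set q (x + t *: y) - t * q y | t in [set t | 0 <= t]] (- q (- x)).
Proof.
move=> [qD qZ] _ [t /= t0 <-]; rewrite -qZ//.
by have := qD (x + t *: y) (- x); rewrite addrAC subrr add0r; lra.
Qed.

Lemma flatten_le q y x t : sublinear q -> 0 <= t ->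
  flatten_at q y x <= q (x + t *: y) - t * q y.
Proof.
move=> sq t0; apply: ge_inf; last by exists t.
by exists (- q (- x)); exact: flatten_lb.
Qed.

Lemma flatten_ge q y x c : (forall t, 0 <= t -> c <= q (x + t *: y) - t * q y) ->
  c <= flatten_at q y x.
Proof.
move=> H; apply: lb_le_inf; first by exists (q (x + 0 *: y) - 0 * q y); exists 0 => /=.
by move=> _ [t /= t0 <-]; exact: H.
Qed.

Lemma sublinear_flatten q y : sublinear q -> sublinear (flatten_at q y).
Proof.
move=> sq; have [qD qZ] := sq; split.
- move=> x x'; rewrite -lerBlDr; apply: flatten_ge => t t0.
  rewrite lerBlDl -lerBlDr; apply: flatten_ge => t' t'0.
  rewrite lerBlDr; apply: le_trans (flatten_le y (x + x') sq (addr_ge0 t0 t'0)) _.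
  rewrite scalerDl addrACA mulrDl.
  have := qD (x + t *: y) (x' + t' *: y); lra.
- move=> t x; rewrite le_eqVlt => /predU1P[<-|t0].
    rewrite scale0r mul0r; apply/eqP; rewrite eq_le; apply/andP; split.
      apply: le_trans (flatten_le y 0 sq (lexx 0)) _.
      by rewrite scale0r addr0 (sublinear0 sq) mul0r subr0.
    by apply: flatten_ge => u u0; rewrite add0r qZ// subrr.
  have tn0 : t != 0 by rewrite gt_eqF.
  apply/eqP; rewrite eq_le; apply/andP; split.
    rewrite mulrC -ler_pdivrMr//; apply: flatten_ge => u u0; rewrite ler_pdivrMr//.
    apply: le_trans (flatten_le y (t *: x) sq (mulr_ge0 (ltW t0) u0)) _.
    rewrite -scalerA -scalerDr qZ; last exact: ltW.
    by apply: eq_le_refl; ring.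
  apply: flatten_ge => u u0; rewrite mulrC -ler_pdivlMr//.
  apply: le_trans (flatten_le y x sq (divr_ge0 u0 (ltW t0))) _.
  have -> : t *: x + u *: y = t *: (x + (u / t) *: y).
    by rewrite scalerDr scalerA mulrC divfK.
  rewrite qZ; last exact: ltW.
  by rewrite ler_pdivlMr//; apply: eq_le_refl; field.
Qed.

Lemma flatten_le_id q y x : sublinear q -> flatten_at q y x <= q x.
Proof.
move=> sq; apply: le_trans (flatten_le y x sq (lexx 0)) _.
by rewrite scale0r addr0 mul0r subr0.
Qed.

(** A minimal sublinear functional coincides with all its flattenings, hence is
    additive; minimal ones exist by Zorn's lemma. *)
Theorem hahn_banach p : sublinear p ->
  exists l : X -> R, scalar l /\ forall x, l x <= p x.
Proof.
move=> sp; pose T := {q : X -> R | sublinear q /\ forall x, q x <= p x}.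
pose rel (q q' : T) : bool := `[< forall x, sval q' x <= sval q x >].
have rxx (r1 : T) : rel r1 r1 by apply/asboolP.
have rtr (q1 q2 q3 : T) : rel q1 q2 -> rel q2 q3 -> rel q1 q3.
  by move=> /asboolP h1 /asboolP h2; apply/asboolP => x; exact: le_trans (h2 x) (h1 x).
have ran (q1 q2 : T) : rel q1 q2 -> rel q2 q1 -> q1 = q2.
  move=> /asboolP h1 /asboolP h2.
  have E : sval q1 = sval q2 by apply/funext => x; apply/eqP; rewrite eq_le h1 h2.
  case: q1 q2 E {h1 h2} => [q1 P1] [q2 P2] /= E.
  by rewrite E in P1 *; congr exist; exact: Prop_irrelevance.
have chain (A : set T) : total_on A rel -> exists m : T, forall s, A s -> rel s m.
  move=> tA; have [A0|/set0P[s0 As0]] := eqVneq A set0.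
    have Pp : sublinear p /\ forall x, p x <= p x by [].
    by exists (exist _ p Pp) => s; rewrite A0.
  pose V x := [set sval s x | s in A].
  have Vlb x : lbound (V x) (- p (- x)).
    move=> _ [s As <-]; have [ss sle] := svalP s.
    by apply: le_trans (sublinear_oppl x ss); rewrite lerN2.
  pose q x := inf (V x).
  have qle s x : A s -> q x <= sval s x.
    by move=> As; apply: ge_inf; [exists (- p (- x))|exists s].
  have qge x c : (forall s, A s -> c <= sval s x) -> c <= q x.
    move=> H; apply: lb_le_inf; first by exists (sval s0 x); exists s0.
    by move=> _ [s As <-]; exact: H.
  have sq : sublinear q.
    split.
    - move=> x y; rewrite -lerBlDr; apply: (qge) => s As.
      rewrite lerBlDl -lerBlDr; apply: (qge) => s' As'; rewrite lerBlDr.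
      have [ss _] := svalP s; have [ss' _] := svalP s'.
      have [/asboolP h|/asboolP h] := tA _ _ As As'.
        apply: le_trans (qle _ _ As') (le_trans (ss'.1 x y) _).
        by rewrite addrC lerD2l.
      apply: le_trans (qle _ _ As) (le_trans (ss.1 x y) _).
      by rewrite addrC lerD2r.
    - move=> t x t0; apply/eqP; rewrite eq_le; apply/andP; split.
        have /orP[/eqP <-|{}t0] : (0 == t) || (0 < t) by rewrite -le_eqVlt.
          by apply: le_trans (qle _ _ As0) _; have [ss _] := svalP s0; rewrite ss.2// !mul0r.
        rewrite mulrC -ler_pdivrMr//; apply: (qge) => s As; rewrite ler_pdivrMr//.
        apply: le_trans (qle _ _ As) _; have [ss _] := svalP s.
        by rewrite ss.2; [rewrite mulrC|exact: ltW].
      apply: (qge) => s As; have [ss _] := svalP s; rewrite ss.2//.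
      by rewrite ler_wpM2l// qle.
  have Pq : sublinear q /\ forall x, q x <= p x.
    split=> // x; apply: le_trans (qle _ _ As0) _.
    by have [_] := svalP s0.
  by exists (exist _ q Pq) => s As; apply/asboolP => x /=; exact: qle.
(* minimality: flattening along any [y] leaves [l] unchanged *)
have [[l [sl lp]] lmin] := Zorn rxx rtr ran chain.
have lfl y : flatten_at l y = l.
  have Pf : sublinear (flatten_at l y) /\ forall x, flatten_at l y x <= p x.
    split; first exact: sublinear_flatten.
    by move=> x; exact: le_trans (flatten_le_id y x sl) (lp x).
  have /lmin : rel (exist _ l (conj sl lp)) (exist _ _ Pf).
    by apply/asboolP => x /=; exact: flatten_le_id.
  by move=> /(congr1 sval).
have lD x y : l (x + y) = l x + l y.
  apply/eqP; rewrite eq_le sl.1/= -lerBrDr -[in leLHS](lfl y).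
  by have := flatten_le y x sl ler01; rewrite scale1r mul1r.
have lN x : l (- x) = - l x.
  by apply/eqP; rewrite -addr_eq0 -lD addNr (sublinear0 sl).
exists l; split=> // a x y /=; rewrite lD; congr (_ + _).
have [a0|a0] := leP 0 a; first exact: sl.2.
by rewrite -[a]opprK scaleNr lN sl.2; [ring|rewrite oppr_ge0 ltW].
Qed.

End hahn_banach.

Section norming.
Context {R : realType} {X : completeNormedModType R}.
Implicit Types (l m : X -> R) (x y : X).

Lemma cont_dualD l m : cont_dual l -> cont_dual m -> cont_dual (fun x => l x + m x).
Proof.
move=> [ll lc] [ml mc]; split; last by move=> x; apply: cvgD; [exact: lc|exact: mc].
by move=> a x y /=; rewrite ll ml /=; ring.
Qed.

Lemma cont_dualZ a l : cont_dual l -> cont_dual (fun x => a * l x).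
Proof.
move=> [ll lc]; split; last by move=> x; apply: cvgM; [exact: cvg_cst|exact: lc].
by move=> b x y /=; rewrite ll /=; ring.
Qed.

Lemma cont_dual0 : cont_dual (fun _ : X => 0 : R).
Proof. by split; [move=> a x y /=; rewrite mulr0 addr0|move=> x; exact: cvg_cst]. Qed.

Lemma cont_dualB l m : cont_dual l -> cont_dual m -> cont_dual (fun x => l x - m x).
Proof.
move=> dl dm; have := cont_dualD dl (cont_dualZ (-1) dm).
by under eq_fun do rewrite mulN1r.
Qed.

Lemma dualD l x y : cont_dual l -> l (x + y) = l x + l y.
Proof. by move=> [ll _]; have := ll 1 x y; rewrite /= scale1r mul1r. Qed.

Lemma dual0 l : cont_dual l -> l 0 = 0.
Proof.
by move=> dl; have := dualD 0 0 dl; rewrite addr0 => /eqP; rewrite -subr_eq subrr eq_sym => /eqP.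
Qed.

Lemma dualZ l a x : cont_dual l -> l (a *: x) = a * l x.
Proof.
by move=> dl; have := dl.1 a x 0; rewrite /= !addr0 (dual0 dl) addr0.
Qed.

Lemma dualN l x : cont_dual l -> l (- x) = - l x.
Proof. by move=> dl; rewrite -scaleN1r dualZ// mulN1r. Qed.

Lemma dualB l x y : cont_dual l -> l (x - y) = l x - l y.
Proof. by move=> dl; rewrite dualD// dualN. Qed.

(** A minorant of the norm flattened along [x0] is still below the norm and
    takes at [- x0] a value at most [- `|x0|]. *)
Lemma norming_functional (x0 : X) : exists l : X -> R,
  [/\ cont_dual l, forall x, `|l x| <= `|x| & l x0 = `|x0|].
Proof.
have sn : sublinear (fun x : X => `|x|).
  by split; [exact: ler_normD|move=> t x t0; rewrite normrZ ger0_norm].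
have [l [ll lp]] := hahn_banach (sublinear_flatten x0 sn).
have lx x : l x <= `|x| by apply: le_trans (lp x) (flatten_le_id x0 x sn).
have lZ a x : l (a *: x) = a * l x.
  have l0 : l 0 = 0.
    by have := ll 1 0 0; rewrite /= scale1r mul1r addr0 => /eqP; rewrite -subr_eq subrr eq_sym => /eqP.
  by have := ll a x 0; rewrite /= !addr0 l0 addr0.
have lN x : l (- x) = - l x by rewrite -scaleN1r lZ mulN1r.
have la x : `|l x| <= `|x|.
  by rewrite ler_norml lx andbT lerNl -lN -normrN lx.
exists l; split => //.
- split=> // x; apply/cvgrPdist_lt => e e0; near=> y.
  apply: (@le_lt_trans _ _ `|x - y|).
    by have := ll 1 x (- y); rewrite /= scale1r mul1r lN => <-.
  by near: y; exact: cvgr_dist_lt.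
- apply/eqP; rewrite eq_le lx/= -lerN2 -lN; apply: le_trans (lp _) _.
  apply: le_trans (flatten_le x0 (- x0) sn ler01) _.
  by rewrite scale1r mul1r addNr normr0 add0r.
Unshelve. all: by end_near. Qed.

Lemma norm_le_dual (x : X) c :
  (forall l, cont_dual l -> (forall y, `|l y| <= `|y|) -> l x <= c) -> `|x| <= c.
Proof. by move=> H; have [l [dl ll <-]] := norming_functional x; exact: H. Qed.

Lemma dual_bounded l : cont_dual l ->
  exists2 M, 0 < M & forall x, `|l x| <= M * `|x|.
Proof.
move=> dl; have /cvgrPdist_lt /(_ 1 ltr01) := dl.2 0.
rewrite (dual0 dl) => /nbhs_ballP[e /= e0 He].
exists (2 / e); first by rewrite divr_gt0.
move=> x; have [->|x0] := eqVneq x 0; first by rewrite (dual0 dl) !normr0 mulr0.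
have nx : 0 < `|x| by rewrite normr_gt0.
pose c := e / 2 / `|x|.
have c0 : 0 < c by rewrite !divr_gt0.
have : `|0 - l (c *: x)| < 1.
  apply: He; rewrite -ball_normE/= sub0r normrN normrZ gtr0_norm//.
  by rewrite /c divfK ?gt_eqF// ltr_pdivrMr// ltr_pMr// ltr1n.
rewrite sub0r normrN dualZ// normrM gtr0_norm// -ltr_pdivlMl// mulr1 => /ltW/le_trans; apply.
by apply: eq_le_refl; rewrite /c; field; rewrite !gt_eqF.
Qed.

End norming.

(** * Borel sets and trigonometric polynomials *)

Section borel.
Context {R : realType} {X : completeNormedModType R}.
Implicit Types (l m : X -> R) (x y : X).

Lemma borel_open (U : set X) : open U -> measurable (U : set (borelT X)).
Proof. by move=> oU; exact: sub_sigma_algebra. Qed.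

Lemma borel_continuous (f : X -> R) : continuous f ->
  measurable_fun [set: borelT X] f.
Proof.
move=> cf; apply: (measurability _ (RGenOInfty.measurableE R)).
move=> _ [_ [a ->] <-]; rewrite setTI; apply: borel_open.
by apply: open_comp => //; exact: open_itv_oy.
Qed.

Lemma borel_dual l : cont_dual l -> measurable_fun [set: borelT X] l.
Proof. by move=> [_ lc]; exact: borel_continuous. Qed.

Lemma dense_seq : separable_space X ->
  exists d : nat -> X, forall x e, 0 < e -> exists n, `|x - d n| < e.
Proof.
move=> [D /countable_injP[f finj] dD].
exists (fun n => xget 0 [set x | D x /\ f x = n]) => x e e0.
have oB : open (ball x e) by exact: ball_open.
have [|y [xy Dy]] := dD (ball x e) _ oB; first by exists x; exact: ballxx.
exists (f y).
have [Dz fz] := @xgetPex _ 0 [set x | D x /\ f x = f y] (ex_intro _ y (conj Dy erefl)).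
rewrite (finj _ _ (mem_set Dz) (mem_set Dy) fz).
by move: xy; rewrite -ball_normE.
Qed.

(** The norming functionals of a dense sequence suffice. *)
Lemma norming_seq : separable_space X -> exists l : nat -> X -> R,
  (forall n, cont_dual (l n)) /\
  (forall x c, (forall n, l n x <= c) <-> `|x| <= c).
Proof.
move=> /dense_seq[d dP].
have /choice[l lP] n := norming_functional (d n).
exists l; split=> [n|x c]; first by have [] := lP n.
split=> [lc|xc n]; last first.
  have [_ h _] := lP n; apply: le_trans xc.
  by apply: le_trans (h x); exact: ler_norm.
apply/ler_addgt0Pr => e e0.
have e20 : 0 < e / 2 by rewrite divr_gt0.
have [n xd] := dP x (e / 2) e20.
have [dl ll ld] := lP n.
have h1 := lc n; have := ll (x - d n); rewrite dualB// ld ler_norml => /andP[h2 _].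
have := ler_distD (d n) x 0; rewrite !subr0; lra.
Qed.

(** In a separable space every open set is a countable union of closed balls,
    and closed balls are countable intersections of half-spaces. *)
Lemma borel_sub_halfspaces (G : set (set X)) : separable_space X ->
  (forall l c, cont_dual l -> <<s G >> [set x | c < l x]) ->
  forall A : set X, measurable (A : set (borelT X)) -> <<s G >> A.
Proof.
move=> Xsep hG A; apply: smallest_sub; first exact: smallest_sigma_algebra.
move=> U oU; have [d dP] := dense_seq Xsep; have [l [dl ln]] := norming_seq Xsep.
pose GT : measurableType G.-sigma := g_sigma_algebraType G.
have mball a r : @measurable _ GT [set x | `|x - a| <= r].
  have -> : [set x | `|x - a| <= r] = \bigcap_n [set x | l n x <= l n a + r].
    apply/seteqP; split => x /= H.
      move=> n _ /=; move/ln : H => /(_ n); rewrite dualB//; lra.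
    apply/ln => n; have := H n I; rewrite /= dualB//; lra.
  apply: bigcapT_measurable => n.
  have -> : [set x | l n x <= l n a + r] = ~` [set x | l n a + r < l n x].
    by apply/seteqP; split => x /=; rewrite leNgt => /negP.
  by apply: measurableC; exact: hG.
have -> : U = \bigcup_n \bigcup_k (if `[< [set x | `|x - d n| <= k.+1%:R^-1] `<=` U >]
    then [set x | `|x - d n| <= k.+1%:R^-1] else set0).
  apply/seteqP; split=> [x Ux|x [n _ [k _]]]; last by case: asboolP => // + ?; apply.
  have /nbhs_ballP[e /= e0 He] : nbhs x U by exact: open_nbhs_nbhs.
  have e20 : 0 < e / 2 by rewrite divr_gt0.
  have [k] : exists k, k.+1%:R^-1 < e / 2 :> R.
    by have /cvgrPdist_lt /(_ _ e20)[k _ /(_ k (leqnn k))] := @cvg_harmonic R;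
      rewrite /= sub0r normrN gtr0_norm// => ?; exists k.
  move=> ke; have [n xn] := dP x k.+1%:R^-1 (harmonic_gt0 k).
  exists n => //; exists k => //; case: asboolP => [_|nU]; first exact: ltW.
  exfalso; apply: nU => y /= yn; apply: He; rewrite -ball_normE /=.
  apply: le_lt_trans (ler_distD (d n) x y) _; rewrite (distrC (d n) y).
  rewrite [ltRHS]splitr; apply: ltrD; first exact: lt_trans xn ke.
  exact: le_lt_trans yn ke.
apply: (@bigcupT_measurable _ GT) => n; apply: (@bigcupT_measurable _ GT) => k.
by case: asboolP => _; [exact: mball|exact: measurable0].
Qed.

End borel.

Section trigonometric_polynomials.
Context {R : realType} {X : completeNormedModType R}.
Implicit Types (l m : X -> R) (x y : X).

(** Products of cosines are sums of cosines, so that these finite combinations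
    form a ring; only integrals of single cosines are known explicitly. *)
Inductive trig : (X -> R) -> Prop :=
| trig0 : trig (fun=> 0)
| trigS c th l f : cont_dual l -> trig f ->
    trig (fun x => c * cos (l x + th) + f x).

Lemma trig_ext f g : trig f -> f =1 g -> trig g.
Proof. by move=> tf /funext <-. Qed.

Lemma trigD f g : trig f -> trig g -> trig (fun x => f x + g x).
Proof.
move=> tf tg; elim: tf => [|c th l f' dl _ ih].
  by apply: trig_ext tg _ => x; rewrite add0r.
by apply: trig_ext (trigS c th dl ih) _ => x; rewrite addrA.
Qed.

Lemma trig_cos c th l : cont_dual l -> trig (fun x => c * cos (l x + th)).
Proof. by move=> dl; apply: trig_ext (trigS c th dl trig0) _ => x; rewrite addr0. Qed.

Lemma trig_cst c : trig (fun=> c).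
Proof.
apply: trig_ext (trig_cos c 0 cont_dual0) _ => x.
by rewrite addr0 cos0 mulr1.
Qed.

Lemma trigM_cos c th l f : cont_dual l -> trig f ->
  trig (fun x => c * cos (l x + th) * f x).
Proof.
move=> dl; elim=> [|c' th' l' f' dl' _ ih].
  by apply: trig_ext trig0 _ => x; rewrite mulr0.
apply: trig_ext (trigD (trigD (trig_cos (c * c' / 2) (th + th') (cont_dualD dl dl'))
  (trig_cos (c * c' / 2) (th - th') (cont_dualB dl dl'))) ih) _ => x.
rewrite mulrDr; congr (_ + _).
have -> : l x + l' x + (th + th') = (l x + th) + (l' x + th') by ring.
have -> : l x - l' x + (th - th') = (l x + th) - (l' x + th') by ring.
by rewrite cosD cosB; field.
Qed.

Lemma trigM f g : trig f -> trig g -> trig (fun x => f x * g x).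
Proof.
move=> tf tg; elim: tf => [|c th l f' dl _ ih].
  by apply: trig_ext trig0 _ => x; rewrite mul0r.
by apply: trig_ext (trigD (trigM_cos c th dl tg) ih) _ => x; rewrite mulrDl.
Qed.

Lemma trigX f n : trig f -> trig (fun x => f x ^+ n).
Proof.
move=> tf; elim: n => [|n ih].
  by apply: trig_ext (trig_cst 1) _ => x; rewrite expr0.
by apply: trig_ext (trigM tf ih) _ => x; rewrite exprS.
Qed.

Lemma trig_continuous f : trig f -> continuous f.
Proof.
elim=> [|c th l f' [_ lc] _ ih] x; first exact: cvg_cst.
apply: cvgD; last exact: ih.
apply: cvgM; first exact: cvg_cst.
apply: (@continuous_comp _ _ _ (fun x => l x + th) cos); last exact: continuous_cos.
by apply: cvgD; [exact: lc|exact: cvg_cst].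
Qed.

Lemma measurable_cos_dual m th : cont_dual m ->
  measurable_fun [set: borelT X] (fun x => cos (m x + th)).
Proof.
move=> dm; apply: borel_continuous => x.
apply: (@continuous_comp _ _ _ (fun x => m x + th) cos).
  by apply: cvgD; [exact: dm.2|exact: cvg_cst].
exact: continuous_cos.
Qed.

Lemma trig_bounded f : trig f -> exists M, forall x, `|f x| <= M.
Proof.
elim=> [|c th l f' dl _ [M HM]]; first by exists 0 => x; rewrite normr0.
exists (`|c| + M) => x; apply: le_trans (ler_normD _ _) _; apply: lerD => //.
by rewrite normrM ler_piMr// ler_norml cos_geN1 cos_le1.
Qed.

Lemma bounded_integrable (mu : {measure set (borelT X) -> \bar R}) (f : X -> R) M :
  (mu setT < +oo)%E -> measurable_fun [set: borelT X] f ->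
  (forall x, `|f x| <= M) -> mu.-integrable setT (EFin \o f).
Proof.
move=> mufin mf fM; apply: measurable_bounded_integrable => //.
exists M; split; first exact: num_real.
by move=> N MN x _; apply: le_trans (fM x) (ltW MN).
Qed.

Lemma trig_integrable (mu : {measure set (borelT X) -> \bar R}) (f : X -> R) :
  (mu setT < +oo)%E -> trig f -> mu.-integrable setT (EFin \o f).
Proof.
move=> mufin tf; have [M fM] := trig_bounded tf.
by apply: bounded_integrable fM => //; apply: borel_continuous; exact: trig_continuous.
Qed.

End trigonometric_polynomials.

Section step_polynomials.
Context {R : realType}.
Implicit Types x : R.

(** Polynomials that approximate on the unit interval the indicator of
    [x < 1 / 2], and tend to [0] at [1 / 2] too. *)
Definition step_poly n (x : R) : R := (1 - x ^+ n) ^+ (n * 2 ^ n).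

Lemma bernoulli_ineq (y : R) n : 0 <= y <= 1 -> 1 - y *+ n <= (1 - y) ^+ n.
Proof.
move=> /andP[y0 y1]; elim: n => [|n ih]; first by rewrite mulr0n subr0 expr0 lexx.
have h : 0 <= 1 - y by lra.
rewrite exprS; apply: le_trans (ler_wpM2l h ih); rewrite mulrS.
have : 0 <= y * (y *+ n) by rewrite mulr_ge0// mulrn_wge0.
set Y := y *+ n; lra.
Qed.

Lemma step_poly_bound n x : 0 <= x <= 1 -> 0 <= step_poly n x <= 1.
Proof.
move=> /andP[x0 x1]; have xn : 0 <= x ^+ n <= 1 by rewrite exprn_ge0// exprn_ile1.
rewrite exprn_ge0 ?exprn_ile1//; lra.
Qed.

Lemma bernoulli_ineq_pos (h : R) n : 0 <= h -> 1 + n%:R * h <= (1 + h) ^+ n.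
Proof.
move=> h0; elim: n => [|n ih]; first by rewrite mul0r addr0 expr0 lexx.
rewrite exprS; have := ler_wpM2l (addr_ge0 ler01 h0) ih; apply: le_trans.
have : 0 <= n%:R * h ^+ 2 :> R by rewrite mulr_ge0// sqr_ge0.
rewrite -natr1; nra.
Qed.

Lemma cvg_mulrn_geometric (z : R) : 0 <= z < 1 ->
  (n%:R * z ^+ n) @[n --> \oo] --> (0 : R).
Proof.
move=> /andP[z0 z1]; pose w := Num.sqrt z.
have w0 : 0 <= w by exact: sqrtr_ge0.
have w1 : w < 1 by rewrite -sqrtr1 ltr_sqrt.
have zw : z = w ^+ 2 by rewrite sqr_sqrtr.
have bnd n : n%:R * w ^+ n <= (1 - w)^-1.
  have h0 : 0 < 1 - w by rewrite subr_gt0.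
  have : n%:R * w ^+ n <= \sum_(i < n) w ^+ i.
    rewrite mulr_natl -[leLHS]/(w ^+ n *+ n) -[n in _ *+ n]card_ord -sumr_const.
    by apply: ler_sum => i _; apply: ler_wiXn2l => //; [exact: ltW|exact: ltnW].
  move=> /le_trans; apply; rewrite -[leRHS]mul1r ler_pdivlMr// mulrC.
  rewrite -opprB mulNr -subrX1 opprB lerBlDr lerDl exprn_ge0//.
apply: (@squeeze_cvgr _ _ _ _ (cst 0) (fun n => geometric (1 - w)^-1 w n)).
- apply: nearW => n; rewrite mulr_ge0 ?exprn_ge0//= zw -exprM mulnC exprM expr2.
  by rewrite mulrA ler_wpM2r// exprn_ge0.
- exact: cvg_cst.
- by apply: cvg_geometric; rewrite ger0_norm.
Qed.

(** Bernoulli's inequality bounds the defect by [n * (2 * x) ^+ n]. *)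
Lemma step_poly_lo x : 0 <= x < 2^-1 -> step_poly n x @[n --> \oo] --> (1 : R).
Proof.
move=> /andP[x0 x1].
apply: (@squeeze_cvgr _ _ _ _ (fun n => 1 - n%:R * (2 * x) ^+ n) (cst 1)).
- apply: nearW => n.
  have x01 : 0 <= x <= 1 by lra.
  have /andP[_ ->] := step_poly_bound n x01; rewrite andbT.
  have xn : 0 <= x ^+ n <= 1 by rewrite exprn_ge0// exprn_ile1//; lra.
  apply: le_trans (bernoulli_ineq _ xn); rewrite exprMn.
  by rewrite -(mulr_natr (x ^+ n)) natrM natrX; apply: eq_le_refl; ring.
- rewrite -[X in _ --> X](subr0 1); apply: cvgB; first exact: cvg_cst.
  by apply: cvg_mulrn_geometric; lra.
- exact: cvg_cst.
Qed.

(** Here [n * 2 ^ n] times [x ^+ n] is at least [n], and [(1 - y) ^+ N] is at most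
    the inverse of [1 + N * y]. *)
Lemma step_poly_hi x : 2^-1 <= x <= 1 -> step_poly n x @[n --> \oo] --> (0 : R).
Proof.
move=> /andP[x0 x1].
apply: (@squeeze_cvgr _ _ _ _ (cst 0) harmonic).
- apply: nearW => n; have x01 : 0 <= x <= 1 by lra.
  have /andP[-> _] := step_poly_bound n x01.
  rewrite /step_poly; set y := x ^+ n; set N := (n * 2 ^ n)%N.
  have y0 : 0 <= y by rewrite exprn_ge0; lra.
  have y1 : y <= 1 by rewrite exprn_ile1; lra.
  have Ny : n%:R <= N%:R * y.
    rewrite /N /y natrM natrX -mulrA -exprMn; apply: ler_peMr => //.
    by apply: exprn_ege1; lra.
  have B := bernoulli_ineq_pos N y0.
  rewrite /= -[leRHS]div1r ler_pdivlMr//.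
  have p0 : 0 <= (1 - y) ^+ N by rewrite exprn_ge0 ?subr_ge0.
  apply: le_trans (ler_wpM2l p0 (le_trans _ B)) _.
    by rewrite -natr1 addrC lerD2l.
  rewrite -exprMn exprn_ile1//; nra.
- exact: cvg_cst.
- exact: cvg_harmonic.
Qed.

End step_polynomials.

(** * Uniqueness of the characteristic functional *)

Section uniqueness.
Context {R : realType} {X : completeNormedModType R}.
Implicit Types (l m : X -> R) (x y : X).

(** Sets whose indicator is a bounded limit of a ring of functions form a
    pi-system. *)
Definition trig_set (B : set X) : Prop :=
  measurable (B : set (borelT X)) /\
  exists f : nat -> X -> R, [/\ forall n, trig (f n), forall n x, `|f n x| <= 1
    & forall x, f n x @[n --> \oo] --> (\1_B x : R)].

Lemma trig_setI : setI_closed (@trig_set).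
Proof.
move=> A B [mA [f [tf f1 fA]]] [mB [g [tg g1 gB]]]; split; first exact: measurableI.
exists (fun n x => f n x * g n x); split.
- by move=> n; exact: trigM.
- by move=> n x; rewrite normrM mulr_ile1.
- by move=> x; rewrite indicI /=; apply: cvgM.
Qed.

Lemma trig_setT : trig_set setT.
Proof.
split; first exact: measurableT.
exists (fun _ _ => 1); split; [by move=> _; exact: trig_cst| |].
- by move=> _ x; rewrite normr1.
- by move=> x; rewrite indicT; exact: cvg_cst.
Qed.

(** [(1 - sin) / 2] is below [1 / 2] exactly where the sine is positive, and a
    polynomial in a trigonometric polynomial is one again. *)
Lemma trig_set_sin l th : cont_dual l -> trig_set [set x | 0 < sin (l x + th)].
Proof.
move=> dl; have cs : continuous (fun x => sin (l x + th)).
  move=> x; apply: (@continuous_comp _ _ _ (fun x => l x + th) sin).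
    by apply: cvgD; [exact: dl.2|exact: cvg_cst].
  exact: continuous_sin.
split.
  apply: borel_open; rewrite -[X in open X]/((fun x => sin (l x + th)) @^-1` [set y | 0 < y]).
  by apply: open_comp => //; exact: open_gt.
pose u x : R := (1 - sin (l x + th)) / 2.
have u01 x : 0 <= u x <= 1.
  by have := sin_le1 (l x + th); have := sin_geN1 (l x + th); rewrite /u; lra.
have tu : trig u.
  apply: trig_ext (trigD (trig_cos (- 2^-1) (th - pi / 2) dl) (trig_cst 2^-1)) _ => x.
  by rewrite addrA cosBpihalf /u; ring.
exists (fun n x => step_poly n (u x)); split.
- move=> n; apply: trigX; apply: trig_ext (trigD (trig_cst 1)
    (trigM (trig_cst (-1)) (trigX n tu))) _ => x.
  by rewrite mulN1r.
- move=> n x; have /andP[a b] := step_poly_bound n (u01 x).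
  by rewrite ger0_norm.
- move=> x; rewrite indicE; case: (boolP (x \in _)) => [|/negP]; rewrite inE/= => xs.
    by apply: step_poly_lo; rewrite /u; have := sin_le1 (l x + th); lra.
  apply: step_poly_hi; have /andP[_ ->] := u01 x; rewrite andbT /u.
  by move/negP: xs; rewrite -leNgt; lra.
Qed.

(** For large [k] the sine of [(l x - c) / k] has the sign of [l x - c]. *)
Lemma trig_set_generates l c : cont_dual l -> <<s @trig_set >> [set x | c < l x].
Proof.
move=> dl; pose GT : measurableType _ := g_sigma_algebraType (@trig_set).
pose S k := [set x | 0 < sin (k.+1%:R^-1 * l x + (- (k.+1%:R^-1 * c)))].
have mS k : @measurable _ GT (S k).
  by apply: sub_sigma_algebra; apply: trig_set_sin; exact: cont_dualZ.
have -> : [set x | c < l x] = \bigcup_n \bigcap_k (S (n + k)%N); last first.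
  apply: (@bigcupT_measurable _ GT) => n.
  by apply: (@bigcapT_measurable _ GT) => k; exact: mS.
have bnd x : exists n, forall k, (n <= k)%N -> k.+1%:R^-1 * `|l x - c| < pi.
  have [n nx] : exists n, `|l x - c| < n.+1%:R.
    exists (Num.truncn `|l x - c|); exact: Num.Theory.truncnS_gt.
  exists n => k nk; rewrite -ltr_pdivlMl ?invr_gt0// invrK.
  apply: (lt_le_trans nx); have : n.+1%:R <= k.+1%:R :> R by rewrite ler_nat.
  by have := pi_ge2 R; have : 0 <= k.+1%:R :> R by []; nra.
have SE k x : S k x = (0 < sin (k.+1%:R^-1 * (l x - c))) :> Prop.
  by rewrite /S/= mulrBr.
apply/seteqP; split=> x /=.
- move=> cx; have [n Hn] := bnd x; exists n => // k _; rewrite SE.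
  have lc0 : 0 < l x - c by rewrite subr_gt0.
  apply: sin_gt0_pi; apply/andP; split; first by rewrite mulr_gt0.
  by have := Hn _ (leq_addr k n); rewrite gtr0_norm.
- move=> [n _ H]; rewrite ltNge; apply/negP => xc.
  have [m Hm] := bnd x; have := H m I; rewrite SE.
  have lc0 : l x - c <= 0 by rewrite subr_le0.
  have := Hm (n + m)%N (leq_addl _ _); rewrite ler0_norm// mulrN.
  set a := _ * (l x - c) => api.
  have a0 : a <= 0 by rewrite /a mulr_ge0_le0.
  have : 0 <= sin (- a) by apply: sin_ge0_pi; lra.
  by rewrite sinN; lra.
Qed.

(** Equality of the integrals passes from cosines to trigonometric polynomials,
    from there to the pi-system [trig_set] by dominated convergence, and to all
    Borel sets because half-spaces, hence balls, are generated. *)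
Theorem char_unique (m1 m2 : {measure set (borelT X) -> \bar R}) :
  separable_space X -> (m1 setT < +oo)%E -> (m2 setT < +oo)%E ->
  (forall l th, cont_dual l ->
     \int[m1]_x cos (l x + th) = \int[m2]_x cos (l x + th)) ->
  forall A : set (borelT X), measurable A -> m1 A = m2 A.
Proof.
move=> Xsep f1 f2 H A mA.
have tE f : trig f -> \int[m1]_x f x = \int[m2]_x f x.
  elim=> [|c th l g dl tg ih].
    by rewrite /Rintegral !integral0.
  have tc : trig (fun x => cos (l x + th)).
    by apply: trig_ext (trig_cos 1 th dl) _ => x; rewrite mul1r.
  have tcc := trig_cos c th dl.
  rewrite !RintegralD//; [|exact: trig_integrable..].
  by rewrite !RintegralZl//; [|exact: trig_integrable..]; rewrite H// ih.
have sE B : trig_set B -> m1 B = m2 B.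
  move=> [mB [f [tf fb fB]]].
  have cv (m : {measure set (borelT X) -> \bar R}) : (m setT < +oo)%E ->
      \int[m]_x f n x @[n --> \oo] --> fine (m B).
    move=> mf; have -> : m B = (\int[m]_x (\1_B x)%:E)%E.
      by rewrite integral_indic// setIT.
    apply: fine_cvg; rewrite fineK; last first.
      by rewrite integral_indic// setIT ge0_fin_numE// (le_lt_trans _ mf)// le_measure ?inE.
    apply: (@dominated_cvg _ _ _ m setT measurableT _ _ (cst 1%E)) => //.
    - move=> n; apply/measurable_EFinP; apply: borel_continuous.
      exact: trig_continuous.
    - by move=> x _; apply: cvg_EFin; [exact: nearW|exact: fB].
    - apply: (@bounded_integrable _ _ _ (fun=> 1) 1) => //.
      by move=> x; rewrite normr1.
    - by move=> n x _; rewrite lee_fin.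
  have := cv _ f1; under eq_fun do rewrite tE//; move=> c1.
  have c2 := cv _ f2.
  rewrite -[LHS]fineK ?ge0_fin_numE//; last by rewrite (le_lt_trans _ f1)// le_measure ?inE.
  rewrite -[RHS]fineK ?ge0_fin_numE//; last by rewrite (le_lt_trans _ f2)// le_measure ?inE.
  by congr EFin; exact: (cvg_unique _ c1 c2).
have Gm : (trig_set : set (set (borelT X))) `<=` measurable by move=> B [].
apply: (@g_sigma_algebra_measure_unique _ R (borelT X) trig_set Gm (fun=> setT)) => //.
- by move=> _; exact: trig_setT.
- by rewrite bigcup_const.
- exact: trig_setI.
- by apply: borel_sub_halfspaces mA => // l c; exact: trig_set_generates.
Qed.

End uniqueness.

(** * Almost everywhere statements and square integrable functions *)

Section almost_everywhere.
Context d (T : measurableType d) (R : realType).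
Variable mu : {measure set T -> \bar R}.
Implicit Types P Q : T -> Prop.

Lemma ae_imply P Q : (forall x, P x -> Q x) ->
  {ae mu, forall x, P x} -> {ae mu, forall x, Q x}.
Proof.
exact: (@filterS _ _ (ae_filter_ringOfSetsType mu)).
Qed.

Lemma ae_and P Q : {ae mu, forall x, P x} -> {ae mu, forall x, Q x} ->
  {ae mu, forall x, P x /\ Q x}.
Proof.
exact: (@filterI _ _ (ae_filter_ringOfSetsType mu)).
Qed.

End almost_everywhere.

Section square_integrable.
Context d (T : measurableType d) (R : realType).
Variable mu : {measure set T -> \bar R}.
Implicit Types f g : T -> R.

Definition sqint f : Prop := measurable_fun setT f /\
  mu.-integrable setT (fun x => (f x ^+ 2)%:E).

Lemma sqint_mul f g : sqint f -> sqint g ->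
  mu.-integrable setT (fun x => (f x * g x)%:E).
Proof.
move=> [mf f2] [mg g2].
apply: (le_integrable measurableT _ _ (integrableD measurableT f2 g2)).
  by apply/measurable_EFinP; exact: measurable_funM.
move=> x _ /=; rewrite lee_fin normrM.
rewrite [leRHS]ger0_norm ?addr_ge0 ?sqr_ge0//.
rewrite -(real_normK (num_real (f x))) -(real_normK (num_real (g x))).
by have := sqr_ge0 (`|f x| - `|g x|); have := sqr_ge0 (`|f x|);
  have := sqr_ge0 (`|g x|); nra.
Qed.

Lemma sqintD f g : sqint f -> sqint g -> sqint (fun x => f x + g x).
Proof.
move=> sf sg; have [mf f2] := sf; have [mg g2] := sg; split.
  exact: measurable_funD.
apply: (eq_integrable measurableT
  (fun x => (f x ^+ 2 + 2 * (f x * g x) + g x ^+ 2)%:E)).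
  by move=> x _; congr EFin; ring.
exact: (integrableD measurableT
  (integrableD measurableT f2 (integrableZl measurableT 2 (sqint_mul sf sg))) g2).
Qed.

Lemma sqintZ a f : sqint f -> sqint (fun x => a * f x).
Proof.
move=> [mf f2]; split; first exact: measurable_funM.
apply: (eq_integrable measurableT (fun x => (a ^+ 2 * f x ^+ 2)%:E)).
  by move=> x _; rewrite exprMn.
exact: (integrableZl measurableT (a ^+ 2) f2).
Qed.

Lemma sqint0 : sqint (fun=> 0).
Proof.
split; first exact: measurable_cst.
by under eq_fun do rewrite expr0n/=; exact: integrable0.
Qed.

Lemma sqintB f g : sqint f -> sqint g -> sqint (fun x => f x - g x).
Proof.
move=> sf sg; have := sqintD sf (sqintZ (-1) sg).
by under eq_fun do rewrite mulN1r.
Qed.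

Lemma integral_sqrD f g (a b : R) : sqint f -> sqint g ->
  \int[mu]_x (a * f x + b * g x) ^+ 2 =
  a ^+ 2 * \int[mu]_x f x ^+ 2 + 2 * a * b * \int[mu]_x (f x * g x)
    + b ^+ 2 * \int[mu]_x g x ^+ 2.
Proof.
move=> sf sg; have [mf f2] := sf; have [mg g2] := sg; have fg := sqint_mul sf sg.
have f2a := integrableZl measurableT (a ^+ 2) f2.
have g2b := integrableZl measurableT (b ^+ 2) g2.
have fgab := integrableZl measurableT (2 * a * b) fg.
rewrite -!RintegralZl// -RintegralD// -RintegralD//.
- by apply: eq_Rintegral => x _; ring.
- exact: (integrableD measurableT f2a fgab).
Qed.

Lemma integral_sqr_ge0 f : 0 <= \int[mu]_x f x ^+ 2.
Proof. by apply: Rintegral_ge0 => x _; exact: sqr_ge0. Qed.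

(** The quadratic form [integral_sqrD] is nonnegative; it is evaluated at the
    coefficients that make its discriminant appear. *)
Lemma cauchy_schwarz f g : sqint f -> sqint g ->
  (\int[mu]_x (f x * g x)) ^+ 2 <= \int[mu]_x f x ^+ 2 * \int[mu]_x g x ^+ 2.
Proof.
move=> sf sg; set B := \int[mu]_x (f x * g x); set A := \int[mu]_x f x ^+ 2.
set C := \int[mu]_x g x ^+ 2.
have H a b : 0 <= a ^+ 2 * A + 2 * a * b * B + b ^+ 2 * C.
  by rewrite -integral_sqrD//; exact: integral_sqr_ge0.
have A0 : 0 <= A by exact: integral_sqr_ge0.
have := A0; rewrite le_eqVlt => /orP[/eqP A00|Apos].
  have := H (- (C + 1) * B) (B ^+ 2); have C0 : 0 <= C by exact: integral_sqr_ge0.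
  rewrite -A00 mulr0 add0r mul0r => h.
  have [->|B0] := eqVneq B 0; first by rewrite expr0n.
  have B2 : 0 < B ^+ 2 by rewrite exprn_even_gt0.
  have B4 : 0 < B ^+ 2 * B ^+ 2 by exact: mulr_gt0.
  exfalso; move: h; have -> : 2 * (- (C + 1) * B) * B ^+ 2 * B + (B ^+ 2) ^+ 2 * C =
    - (B ^+ 2 * B ^+ 2) * (C + 2) by ring.
  by nra.
have := H B (- A).
have -> : B ^+ 2 * A + 2 * B * - A * B + (- A) ^+ 2 * C = A * (A * C - B ^+ 2) by ring.
by rewrite pmulr_rge0// subr_ge0.
Qed.

Lemma cauchy_schwarz_sqrt f g : sqint f -> sqint g ->
  `|\int[mu]_x (f x * g x)| <=
  Num.sqrt (\int[mu]_x f x ^+ 2) * Num.sqrt (\int[mu]_x g x ^+ 2).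
Proof.
move=> sf sg; rewrite -sqrtr_sqr -sqrtrM ?integral_sqr_ge0// ler_wsqrtr//.
exact: cauchy_schwarz.
Qed.

Lemma Lnorm2_lt f e : measurable_fun setT f -> 0 < e ->
  (Lnorm mu 2%:E (fun x => (f x)%:E) < e%:E)%E ->
  sqint f /\ \int[mu]_x f x ^+ 2 < e ^+ 2.
Proof.
move=> mf e0 fe.
have E : (\int[mu]_x (f x ^+ 2)%:E = Lnorm mu 2%:E (fun x => (f x)%:E) `^ 2)%E.
  rewrite (@poweR_Lnorm _ _ _ mu (fun x => (f x)%:E) 2)//.
  apply: eq_integral => x _; rewrite abse_EFin poweR_EFin powR_mulrn//.
  by rewrite real_normK ?num_real.
have lt : (\int[mu]_x (f x ^+ 2)%:E < (e ^+ 2)%:E)%E.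
  rewrite E -(powR_mulrn 2 (ltW e0)) -poweR_EFin.
  move: fe; have := Lnorm_ge0 mu 2%:E (fun x => (f x)%:E).
  case: (Lnorm _ _ _) => [r| |]//=; rewrite lee_fin !lte_fin => r0 re.
  by rewrite gt0_ltr_powR// nnegrE ltW.
have m2 : measurable_fun setT (fun x => (f x ^+ 2)%:E).
  by apply/measurable_EFinP; exact: measurable_funX.
have i2 : mu.-integrable setT (fun x => (f x ^+ 2)%:E).
  apply/integrableP; split => //; apply: le_lt_trans (lt_trans lt (ltry _)).
  by apply: ge0_le_integral => //; [exact: measurableT_comp|
    move=> x _; rewrite lee_fin ger0_norm ?sqr_ge0].
split; first by split.
by rewrite -lte_fin /Rintegral fineK//; exact: integrable_fin_num.
Qed.

Lemma Lnorm2_lt_conv f e : sqint f -> 0 < e -> \int[mu]_x f x ^+ 2 < e ^+ 2 ->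
  (Lnorm mu 2%:E (fun x => (f x)%:E) < e%:E)%E.
Proof.
move=> [mf f2] e0 H.
rewrite unlock.
have -> : (\int[mu]_x (`|(f x)%:E| `^ 2) = (\int[mu]_x (f x ^+ 2))%:E)%E.
  rewrite /Rintegral fineK; last exact: integrable_fin_num.
  apply: eq_integral => x _; rewrite abse_EFin poweR_EFin powR_mulrn//.
  by rewrite real_normK ?num_real.
rewrite poweR_EFin lte_fin powR12_sqrt ?integral_sqr_ge0//.
by rewrite -[ltRHS](ger0_norm (ltW e0)) -sqrtr_sqr ltr_sqrt// exprn_gt0.
Qed.

End square_integrable.

(** * One-dimensional laws of a Gaussian measure *)

Section gaussian_functionals.
Context {R : realType} {X : completeNormedModType R}.
Variable mu : probability (borelT X) R.
Hypothesis mu_gauss : centered_gaussian mu.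
Implicit Types (l m : X -> R).

Definition variance l : R := \int[mu]_x l x ^+ 2.

(** The degenerate law is treated apart, because [normal_prob 0 0] is not a
    Dirac mass. *)
Lemma dual_law l : cont_dual l -> exists s : R,
  [/\ 0 <= s, sqint mu l, variance l = s ^+ 2,
    forall th, \int[mu]_x cos (l x + th) = expR (- s ^+ 2 / 2) * cos th
  & 0 < s -> forall A : set R, measurable A -> mu (l @^-1` A) = gauss s A].
Proof.
move=> dl; have ml := borel_dual dl; have [s s0 law] := mu_gauss dl.
exists s; have [s00|sn0] := eqVneq s 0.
  have aeq0 : {ae mu, forall x, l x = 0}.
    exists (l @^-1` (~` [set 0])); split.
    - by rewrite -[X in measurable X]setTI; apply: ml => //; exact: measurableC.
    - rewrite law; last exact: measurableC.
      by rewrite s00 eqxx diracE memNset//= => /(_ erefl).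
    - by move=> x /= lx0.
  have m2 : measurable_fun [set: borelT X] (fun x => (l x ^+ 2)%:E).
    by apply/measurable_EFinP; exact: measurable_funX.
  have E2 : (\int[mu]_x (l x ^+ 2)%:E = 0)%E.
    rewrite (ae_eq_integral (cst 0%E))//; first exact: integral0.
    by apply: ae_imply aeq0 => x -> _; rewrite expr0n.
  split=> //.
  - split => //; apply/integrableP; split=> //.
    under eq_integral do rewrite abse_EFin ger0_norm ?sqr_ge0//.
    by rewrite E2 ltry.
  - by rewrite /variance /Rintegral E2 s00 expr0n.
  - move=> th; rewrite s00 expr0n/= oppr0 mul0r expR0 mul1r.
    transitivity (\int[mu]_(_ in [set: borelT X]) cos th).
      congr fine; apply: ae_eq_integral => //.
      + apply/measurable_EFinP; apply: borel_continuous => x.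
        apply: (@continuous_comp _ _ _ (fun x => l x + th) cos).
          by apply: cvgD; [exact: dl.2|exact: cvg_cst].
        exact: continuous_cos.
      + by apply: ae_imply aeq0 => x -> _; rewrite add0r.
    by rewrite Rintegral_cst//= probability_setT mulr1.
  - by rewrite s00 ltxx.
have {}law A : measurable A -> mu (l @^-1` A) = gauss s A.
  by move=> mA; rewrite law// (negbTE sn0).
have [i2 E2] := gauss_second_moment sn0.
have m2 : measurable_fun [set: R] (fun x : R => (x ^+ 2)%:E).
  by apply/measurable_EFinP; exact: measurable_funX.
split => //.
- by split => //; exact: (integrable_image ml law m2 i2).
- by rewrite /variance /Rintegral (integral_image ml law m2) E2.
- move=> th; have := gauss_cos 1 th sn0; rewrite expr1n mulr1 => <-.
  under [RHS]eq_Rintegral do rewrite mul1r.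
  rewrite /Rintegral.
  rewrite (@integral_image _ _ _ _ _ _ _ _ ml law (fun y => (cos (y + th))%:E))//.
  apply/measurable_EFinP; apply: continuous_measurable_fun => x.
  apply: (@continuous_comp _ _ _ (fun x => x + th) cos); last exact: continuous_cos.
  by apply: cvgD; [exact: cvg_id|exact: cvg_cst].
Qed.

Lemma sqint_dual l : cont_dual l -> sqint mu l.
Proof. by move=> /dual_law[s []]. Qed.

Lemma integral_cos_dual l th : cont_dual l ->
  \int[mu]_x cos (l x + th) = expR (- variance l / 2) * cos th.
Proof. by move=> /dual_law[s [_ _ -> + _]]; exact. Qed.

(** A ball carrying more than three quarters of the mass bounds the standard
    deviation of every functional of norm one, as the density of a normal law is
    at most the inverse of its standard deviation. *)
Lemma variance_bound : exists2 K : R, 0 < K & forall l M, cont_dual l ->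
  0 <= M -> (forall x, `|l x| <= M * `|x|) -> Num.sqrt (variance l) <= K * M.
Proof.
pose B n : set (borelT X) := [set x : X | `|x| <= n%:R].
have mB n : measurable (B n).
  rewrite /B -[X in measurable X]setTI.
  have mn : measurable_fun [set: borelT X] (fun x : X => `|x|).
    by apply: borel_continuous => x; exact: norm_continuous.
  have := mn measurableT _ (@measurable_itv R `]-oo, n%:R]).
  by congr (measurable (_ `&` _)); apply/seteqP; split=> x /=; rewrite in_itv.
have cB : mu \o B @ \oo --> mu (\bigcup_n B n).
  apply: nondecreasing_cvg_mu => //; first exact: bigcup_measurable.
  move=> i j ij; apply/subsetPset => x /= /le_trans; apply.
  by rewrite ler_nat.
have UB : \bigcup_n B n = setT.
  apply/seteqP; split => // x _.
  exists (Num.truncn `|x|).+1 => //=; apply/ltW; exact: Num.Theory.truncnS_gt.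
rewrite UB probability_setT in cB.
have [n Bn] : exists n, ((3 / 4)%:E < mu (B n))%E.
  have cf : fine (mu (B n)) @[n --> \oo] --> (1 : R) by apply: fine_cvg; exact: cB.
  have lt1 : 3 / 4 < 1 :> R by lra.
  have [n _ /(_ n (leqnn n)) /=] := cvgr_gt _ cf _ lt1.
  by rewrite -lte_fin fineK ?fin_num_measure// => ?; exists n.
exists (3 * n.+1%:R); first by rewrite mulr_gt0.
move=> l M dl M0 lM; have [s [s0 _ -> _ law]] := dual_law dl.
rewrite sqrtr_sqr ger0_norm//.
have := s0; rewrite le_eqVlt => /orP[/eqP <-|spos]; first by rewrite !mulr_ge0.
pose r := M * n%:R; have r0 : 0 <= r by rewrite mulr_ge0.
have : ((3 / 4)%:E < (2 * r / s)%:E)%E.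
  apply: lt_le_trans Bn (le_trans _ (gauss_itv_le spos r0)).
  rewrite -law//; apply: le_measure; rewrite ?inE//.
    by rewrite -[X in measurable X]setTI; exact: (borel_dual dl).
  move=> x /= xn; rewrite in_itv/= -ler_norml; apply: le_trans (lM x) _.
  by rewrite ler_wpM2l.
rewrite lte_fin ltr_pdivlMr// => h.
have : r <= M * n.+1%:R by rewrite ler_wpM2l// ler_nat.
lra.
Qed.

End gaussian_functionals.

(** * Existence of the covariance operator *)

Lemma prob_fin d (T : measurableType d) (R : realType) (P : probability T R) :
  (P setT < +oo)%E.
Proof. by rewrite probability_setT ltry. Qed.

Section covariance.
Context {R : realType} {X : completeNormedModType R}.
Variable mu : probability (borelT X) R.
Hypothesis mu_gauss : centered_gaussian mu.
Hypothesis Xsep : separable_space X.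
Implicit Types (l m : X -> R).

Lemma sqint_bounded (f : X -> R) M : measurable_fun [set: borelT X] f ->
  (forall x, `|f x| <= M) -> sqint mu f /\ \int[mu]_x f x ^+ 2 <= M ^+ 2.
Proof.
move=> mf fM; have M0 : 0 <= M by apply: le_trans (fM 0).
have f2 x : `|f x ^+ 2| <= M ^+ 2 by rewrite normrX lerXn2r ?nnegrE.
have fi : mu.-integrable setT (fun x => (f x ^+ 2)%:E).
  apply: (@bounded_integrable _ _ mu (fun x => f x ^+ 2) (M ^+ 2)) => //.
  - exact: prob_fin.
  - exact: measurable_funX.
split; first by split.
apply: (@le_trans _ _ (\int[mu]_(x in [set: borelT X]) M ^+ 2)).
  apply: le_Rintegral => //; first exact: finite_measure_integrable_cst.
  by move=> x _; apply: le_trans (f2 x); exact: ler_norm.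
by rewrite Rintegral_cst//= probability_setT mulr1.
Qed.

Lemma sqint_indicM (A : set (borelT X)) (f : X -> R) : measurable A -> sqint mu f ->
  sqint mu (fun x => \1_A x * f x).
Proof.
move=> mA [mf f2]; split; first exact: measurable_funM.
apply: (le_integrable measurableT _ _ f2).
  by apply/measurable_EFinP; apply: measurable_funX; exact: measurable_funM.
move=> x _; rewrite lee_fin !normrX normrM indicE.
case: (x \in A); first by rewrite normr1 mul1r.
by rewrite normr0 mul0r expr0n/= sqr_ge0.
Qed.

(** The weak integral of [x |-> l x *: x] is approximated by rounding [x] to the
    first [d i] within distance [e], on the union of the first [n] balls. *)
Section approximation.
Variables (l : X -> R) (d : nat -> X) (e K : R).
Hypothesis dl : cont_dual l.
Hypothesis d_dense : forall x, exists n, `|x - d n| < e.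
Hypothesis e0 : 0 < e.
Hypothesis K_bound : forall m M, cont_dual m ->
  0 <= M -> (forall x, `|m x| <= M * `|x|) -> Num.sqrt (variance mu m) <= K * M.

Let B n : set (borelT X) := [set x : X | `|x - d n| < e].
Let A n : set (borelT X) := \bigcup_(i < n) B i.
Let C n : set (borelT X) := B n `\` A n.

Let mB n : measurable (B n).
Proof.
apply: borel_open; rewrite (_ : B n = ball (d n) e); first exact: ball_open.
by apply/seteqP; split => x; rewrite -ball_normE /B /= distrC.
Qed.

Let mA n : measurable (A n). Proof. by apply: bigcup_measurable => i _; exact: mB. Qed.

Let mC n : measurable (C n). Proof. exact: measurableD. Qed.

Let rounding n x : X := \sum_(i < n) (\1_(C i) x : R) *: d i.

Let rounding_close n (x : X) :
  (A n x /\ `|x - rounding n x| < e) \/ (~ A n x /\ rounding n x = 0).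
Proof.
elim: n => [|n ih].
  by right; split; [move=> [i]|rewrite /rounding big_ord0].
have AS : A n.+1 x <-> A n x \/ B n x.
  split=> [[i /= iltn Bi]|[[i /= iltn Bi]|Bn]].
  - move: iltn; rewrite ltnS leq_eqVlt => /orP[/eqP <-|iltn]; first by right.
    by left; exists i.
  - by exists i => //=; exact: ltnW.
  - by exists n => //=.
rewrite /rounding big_ord_recr/= -/(rounding n x) indicE.
case: ih => [[Anx close]|[nAnx ->]].
  left; split; first by apply/AS; left.
  by rewrite memNset ?scale0r ?addr0//; case.
rewrite add0r; have [Bn|nBn] := pselect (B n x).
  left; split; first by apply/AS; right.
  by rewrite mem_set ?scale1r.
right; split; first by move/AS => [].
by rewrite memNset ?scale0r//; case.
Qed.

Let y n : X := \sum_(i < n) (\int[mu]_x (l x * \1_(C i) x)) *: d i.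

Let sqint_rounding m n : cont_dual m -> sqint mu (fun x => m (rounding n x)) /\
  m (y n) = \int[mu]_x (l x * m (rounding n x)).
Proof.
move=> dm; have sl := sqint_dual mu_gauss dl.
have s1 i : sqint mu (\1_(C i)).
  have [] // := @sqint_bounded (\1_(C i)) 1 _ _.
    by move=> x; rewrite indicE; case: (x \in _); rewrite ?normr0 ?normr1.
elim: n => [|n [sn yn]].
  rewrite /y /rounding; under eq_fun do rewrite big_ord0 dual0//.
  split; first exact: sqint0.
  rewrite big_ord0 dual0//; under eq_Rintegral do rewrite big_ord0 dual0// mulr0.
  by rewrite /Rintegral integral0.
have E x : m (rounding n.+1 x) = m (rounding n x) + m (d n) * \1_(C n) x.
  by rewrite /rounding big_ord_recr/= dualD// dualZ// mulrC.
have s2 := sqintZ (m (d n)) (s1 n).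
split; first by under eq_fun do rewrite E; exact: sqintD.
rewrite /y big_ord_recr/= -/(y n) dualD// dualZ// yn mulrC.
rewrite -RintegralZl//; last exact: sqint_mul.
rewrite -RintegralD//; last 2 first.
  - exact: sqint_mul.
  - exact: (integrableZl measurableT (m (d n)) (sqint_mul sl (s1 n))).
by apply: eq_Rintegral => x _; rewrite E; ring.
Qed.

Let tail n : R := \int[mu]_x (\1_(~` A n) x * l x) ^+ 2.

Let tail0 : tail n @[n --> \oo] --> (0 : R).
Proof.
have [ml l2] := sqint_dual mu_gauss dl.
apply: fine_cvg.
rewrite -[X in _ --> X](@integral0 _ _ _ mu setT).
apply: (@dominated_cvg _ _ _ mu setT measurableT _ _ (fun x => (l x ^+ 2)%:E)) => //.
- move=> n; apply/measurable_EFinP; apply: measurable_funX; apply: measurable_funM => //.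
  by apply: measurable_indic; exact: measurableC.
- move=> x _; apply: cvg_near_cst; have [k xk] := d_dense x.
  exists k.+1 => // n /= kn.
  rewrite indicE memNset ?mul0r ?expr0n// => /(_ _)/wrap[]//.
  by exists k.
- move=> n x _; rewrite lee_fin ger0_norm ?sqr_ge0// exprMn indicE.
  by case: (x \in _); rewrite ?expr1n ?mul1r// expr0n mul0r sqr_ge0.
Qed.

(** On the covered part the rounding error is at most [e]; on the rest the
    second moment of [l] is small. *)
Lemma covariance_approx : exists z : X, forall m M, cont_dual m -> 0 <= M ->
  (forall x, `|m x| <= M * `|x|) ->
  `|m z - \int[mu]_x (l x * m x)| <= e * (Num.sqrt (variance mu l) + K) * M.
Proof.
have e2 : 0 < e ^+ 2 by rewrite exprn_gt0.
have [n _ /(_ n (leqnn n)) /= tn] := cvgr_lt _ tail0 _ e2.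
exists (y n) => m M dm M0 mM.
have [sr ->] := sqint_rounding n dm.
have sl := sqint_dual mu_gauss dl; have sm := sqint_dual mu_gauss dm.
have sd := sqintB sr sm.
have mAC : measurable (~` A n) by exact: measurableC.
have sAd := sqint_indicM (mA n) sd; have sAl := sqint_indicM mAC sl.
rewrite -RintegralB//; [|exact: sqint_mul..].
have -> : \int[mu]_x (l x * m (rounding n x) - l x * m x) =
    \int[mu]_x (l x * (\1_(A n) x * (m (rounding n x) - m x))) -
    \int[mu]_x (\1_(~` A n) x * l x * m x).
  rewrite -RintegralB//; [|exact: sqint_mul..].
  apply: eq_Rintegral => x _; rewrite !indicE in_setC.
  case: (rounding_close n x) => [[Ax _]|[Ax ->]].
    by rewrite mem_set//=; ring.
  by rewrite memNset//= (dual0 dm); ring.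
apply: le_trans (ler_normB _ _) _.
have h1 := cauchy_schwarz_sqrt sl sAd; have h2 := cauchy_schwarz_sqrt sAl sm.
have V0 : 0 <= Num.sqrt (variance mu l) by exact: sqrtr_ge0.
have h3 : Num.sqrt (\int[mu]_x (\1_(A n) x * (m (rounding n x) - m x)) ^+ 2) <= e * M.
  have eM0 : 0 <= e * M by rewrite mulr_ge0// ltW.
  rewrite -[leRHS](ger0_norm eM0) -sqrtr_sqr ler_wsqrtr//.
  have [] // := @sqint_bounded (fun x => \1_(A n) x * (m (rounding n x) - m x)) (e * M).
    by have [] := sAd.
  move=> x; rewrite indicE; case: (rounding_close n x) => [[Ax xr]|[Ax _]].
    rewrite mem_set// mul1r -dualB//; apply: le_trans (mM _) _.
    by rewrite mulrC distrC ler_wpM2r// ltW.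
  by rewrite memNset// mul0r normr0 mulr_ge0// ltW.
have h4 : Num.sqrt (tail n) <= e.
  by rewrite -[leRHS](ger0_norm (ltW e0)) -sqrtr_sqr ler_wsqrtr// ltW.
have h5 := K_bound dm M0 mM.
have h6 := ler_wpM2l V0 h3.
have h7 : Num.sqrt (tail n) * Num.sqrt (variance mu m) <= e * (K * M).
  by apply: ler_pM => //; exact: sqrtr_ge0.
apply: le_trans (lerD (le_trans h1 h6) (le_trans h2 h7)) _.
by apply: eq_le_refl; ring.
Qed.

End approximation.

(** The weak integral of [x |-> l x *: x] exists in [X]: its rounded versions are
    Cauchy, uniformly over the dual unit ball. *)
Theorem covariance_exists l : cont_dual l ->
  exists h : X, forall m, cont_dual m -> m h = \int[mu]_x (l x * m x).
Proof.
move=> dl; have [d dP] := dense_seq Xsep; have [K K0 KB] := variance_bound mu_gauss.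
have ek k : 0 < k.+1%:R^-1 :> R by rewrite invr_gt0.
have /choice[z zP] k := covariance_approx dl (fun x => dP x _ (ek k)) (ek k) KB.
set C := Num.sqrt (variance mu l) + K in zP.
have C0 : 0 < C by rewrite ltr_wpDl// sqrtr_ge0.
have zz i j : `|z i - z j| <= (i.+1%:R^-1 + j.+1%:R^-1) * C.
  apply: norm_le_dual => m dm m1; rewrite dualB//.
  have m1' x : `|m x| <= 1 * `|x| by rewrite mul1r.
  have := zP i m 1 dm ler01 m1'; have := zP j m 1 dm ler01 m1'.
  rewrite !mulr1 !ler_norml => /andP[a1 a2] /andP[b1 b2]; rewrite mulrDl.
  have -> : m (z i) - m (z j) = (m (z i) - \int[mu]_x (l x * m x)) -
      (m (z j) - \int[mu]_x (l x * m x)) by ring.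
  by have := lerB b2 a1; rewrite opprK.
have cz : cvgn z.
  apply/cauchy_cvgP; apply: cauchy_exP => e /= e0.
  have e1 : 0 < e / (2 * C) by rewrite divr_gt0// mulr_gt0.
  have [k _ /(_ k (leqnn k)) /=] := cvgr_lt _ (@cvg_harmonic R) _ e1.
  rewrite ltr_pdivlMr ?mulr_gt0// => hk.
  exists (z k); exists k => // n /= kn; rewrite -ball_normE/=.
  apply: le_lt_trans (zz k n) _; apply: le_lt_trans hk.
  rewrite mulrA; apply: ler_wpM2r; first exact: ltW.
  rewrite mulr_natr mulr2n lerD2l.
  by rewrite lef_pV2 ?posrE// ler_nat.
have /cvg_ex[/= h zh] := cz.
exists h => m dm; have [M M0 mM] := dual_bounded dm.
have c1 : m (z k) @[k --> \oo] --> m h by apply: (cvg_comp _ _ zh); exact: dm.2.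
have c2 : m (z k) @[k --> \oo] --> \int[mu]_x (l x * m x).
  apply/cvgrPdist_le => e e0.
  have e1 : 0 < e / (C * M) by rewrite divr_gt0// mulr_gt0.
  have := @cvg_harmonic R; move=> /cvgrPdist_lt /(_ _ e1).
  apply: filterS => k; rewrite sub0r normrN (gtr0_norm (harmonic_gt0 k)).
  rewrite ltr_pdivlMr ?mulr_gt0// => hk.
  rewrite distrC; apply: le_trans (zP k m M dm (ltW M0) mM) _.
  by rewrite -mulrA ltW.
exact: (cvg_unique _ c1 c2).
Qed.

End covariance.

(** * The Cameron--Martin space *)

Lemma quadratic_form_lt {R : realType} (a A B C w : R) : 0 < w ->
  A < w -> `|B| <= w -> C < w ->
  a ^+ 2 * A + 2 * a * B + C < (2 * (1 + `|a|)) ^+ 2 * w.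
Proof.
move=> w0 Aw Bw Cw; have a0 := normr_ge0 a.
have aB : a * B <= `|a| * w.
  by apply: le_trans (ler_norm _) _; rewrite normrM ler_wpM2l.
have aA : a ^+ 2 * A <= `|a| ^+ 2 * w.
  by rewrite real_normK ?num_real// ler_wpM2l ?sqr_ge0// ltW.
move: aA aB a0; move: `|a| => t aA aB t0.
have := mulr_ge0 t0 (ltW w0); have := mulr_ge0 (sqr_ge0 t) (ltW w0).
nra.
Qed.

Section cameron_martin_space.
Context {R : realType} {X : completeNormedModType R}.
Variable mu : probability (borelT X) R.
Hypothesis mu_gauss : centered_gaussian mu.
Hypothesis Xsep : separable_space X.
Implicit Types (l m : X -> R) (g : X -> R) (h k u : X).

Lemma dual_L2_closureP g : dual_L2_closure mu g <->
  measurable_fun [set: borelT X] g /\ forall e : R, 0 < e ->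
    exists l, [/\ cont_dual l, sqint mu (fun x => g x - l x)
      & \int[mu]_x (g x - l x) ^+ 2 < e ^+ 2].
Proof.
split=> -[mg H]; split=> // e e0; have := H e e0.
- move=> [l dl gl]; have [|] := Lnorm2_lt _ e0 gl; last by exists l.
  by apply: measurable_funB => //; exact: borel_dual.
- by move=> [l [dl sgl gl]]; exists l => //; exact: Lnorm2_lt_conv.
Qed.

Lemma is_repr_sqint h g : is_repr mu h g -> sqint mu g.
Proof.
move=> [/dual_L2_closureP[mg /(_ 1 ltr01)[l [dl sgl _]]] _].
have := sqintD sgl (sqint_dual mu_gauss dl).
by under eq_fun do rewrite subrK.
Qed.

Lemma is_repr_dual h l : cont_dual l ->
  (forall m, cont_dual m -> m h = \int[mu]_x (l x * m x)) -> is_repr mu h l.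
Proof.
move=> dl hl; split=> //; apply/dual_L2_closureP; split; first exact: borel_dual.
move=> e e0; exists l; split=> //.
  by under eq_fun do rewrite subrr; exact: sqint0.
under eq_Rintegral do rewrite subrr expr0n/=.
by rewrite Rintegral_cst// mul0r exprn_gt0.
Qed.

Lemma is_repr_lin (a : R) h k g g' : is_repr mu h g -> is_repr mu k g' ->
  is_repr mu (a *: h + k) (fun x => a * g x + g' x).
Proof.
move=> rg rg'; have sg := is_repr_sqint rg; have sg' := is_repr_sqint rg'.
have [/dual_L2_closureP[mg Hg] gE] := rg.
have [/dual_L2_closureP[mg' Hg'] gE'] := rg'.
split; last first.
  move=> l dl; have sl := sqint_dual mu_gauss dl.
  rewrite dualD// dualZ// gE// gE'// -RintegralZl//; last exact: sqint_mul.
  rewrite -RintegralD//; last 2 first.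
  - exact: (integrableZl measurableT a (sqint_mul sg sl)).
  - exact: sqint_mul.
  by apply: eq_Rintegral => x _; ring.
apply/dual_L2_closureP; split.
  by apply: measurable_funD => //; exact: measurable_funM.
move=> e e0; pose e1 := e / (2 * (1 + `|a|)).
have a1 : 0 < 1 + `|a| by rewrite ltr_wpDr.
have e10 : 0 < e1 by rewrite divr_gt0// mulr_gt0.
have [l [dl s1 l1]] := Hg e1 e10; have [l' [dl' s2 l2]] := Hg' e1 e10.
exists (fun x => a * l x + l' x); split.
- by apply: cont_dualD => //; exact: cont_dualZ.
- have := sqintD (sqintZ a s1) s2.
  by congr sqint; apply/funext => x; ring.
have -> : \int[mu]_x (a * g x + g' x - (a * l x + l' x)) ^+ 2 =
    \int[mu]_x (a * (g x - l x) + 1 * (g' x - l' x)) ^+ 2.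
  by apply: eq_Rintegral => x _; congr (_ ^+ 2); ring.
rewrite integral_sqrD// !mulr1 expr1n mul1r.
have cs := cauchy_schwarz s1 s2; move: cs l1 l2.
have := integral_sqr_ge0 mu (fun x => g x - l x).
have := integral_sqr_ge0 mu (fun x => g' x - l' x).
set A := \int[mu]_x (g x - l x) ^+ 2; set C := \int[mu]_x (g' x - l' x) ^+ 2.
set B := \int[mu]_x _ => C0 A0 BAC Ae Ce.
have eE : e = 2 * (1 + `|a|) * e1.
  by rewrite /e1 mulrC divfK// mulf_neq0// gt_eqF.
have Be : `|B| <= e1 ^+ 2.
  rewrite -(ger0_norm (sqr_ge0 e1)) -(@ler_sqr _ `|B|) ?nnegrE//.
  rewrite real_normK ?num_real// real_normK ?num_real//.
  apply: le_trans BAC _; rewrite (expr2 (e1 ^+ 2)); apply: ler_pM => //; exact: ltW.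
rewrite eE exprMn; apply: quadratic_form_lt => //.
by rewrite exprn_gt0.
Qed.

(** Two representatives of the same vector differ by an element of the closed
    span of the dual that is orthogonal to the dual. *)
Lemma is_repr_uniq h g g' f : is_repr mu h g -> is_repr mu h g' -> sqint mu f ->
  \int[mu]_x (g x * f x) = \int[mu]_x (g' x * f x).
Proof.
move=> rg rg' sf; have sg := is_repr_sqint rg; have sg' := is_repr_sqint rg'.
have rd := is_repr_lin (-1) rg' rg.
pose w x := -1 * g' x + g x; have sw : sqint mu w := is_repr_sqint rd.
have w0 l : cont_dual l -> \int[mu]_x (w x * l x) = 0.
  by move=> dl; have [_ <-//] := rd; rewrite scaleN1r addNr dual0.
have [/dual_L2_closureP[_ Hw] _] := rd.
set S := \int[mu]_x w x ^+ 2; have S0 : 0 <= S by exact: integral_sqr_ge0.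
have SE e : 0 < e -> S <= Num.sqrt S * e.
  move=> e0; have [l [dl sl lt]] := Hw e e0.
  have E : S = \int[mu]_x (w x * (w x - l x)).
    rewrite -[LHS]subr0 -(w0 l dl) -RintegralB//.
    - by apply: eq_Rintegral => x _; ring.
    - by have [] := sw.
    - by apply: sqint_mul => //; exact: sqint_dual.
  rewrite [leLHS]E; apply: le_trans (ler_norm _) _.
  apply: le_trans (cauchy_schwarz_sqrt sw sl) _.
  apply: ler_wpM2l; first exact: sqrtr_ge0.
  by rewrite -[leRHS](ger0_norm (ltW e0)) -sqrtr_sqr; apply: ler_wsqrtr; exact: ltW.
have S00 : S = 0.
  apply/eqP; rewrite eq_le S0 andbT; apply/ler_addgt0Pr => e e0; rewrite add0r.
  have q0 : 0 < Num.sqrt S + 1 by rewrite ltr_wpDl// sqrtr_ge0.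
  apply: le_trans (SE (e / (Num.sqrt S + 1)) _) _; first by rewrite divr_gt0.
  by rewrite mulrA ler_pdivrMr// mulrC ler_pM2l// lerDl.
apply/eqP; rewrite -subr_eq0 -RintegralB//; [|exact: sqint_mul..].
rewrite (@eq_Rintegral _ _ _ mu setT (fun x => w x * f x)); last first.
  by move=> x _; rewrite /w; ring.
have := cauchy_schwarz_sqrt sw sf; rewrite -/S S00 sqrtr0 mul0r.
by rewrite normr_le0.
Qed.

Lemma CMhatP h : cameron_martin mu h -> is_repr mu h (CMhat mu h).
Proof. by move=> [g rg]; exact: (xgetPex _ (ex_intro _ g rg)). Qed.

Lemma innerHE h k g g' : is_repr mu h g -> is_repr mu k g' ->
  innerH mu h k = \int[mu]_x (g x * g' x).
Proof.
move=> rg rg'; have rh := CMhatP (ex_intro _ g rg); have rk := CMhatP (ex_intro _ g' rg').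
rewrite /innerH (is_repr_uniq rh rg (is_repr_sqint rk)).
under eq_Rintegral do rewrite mulrC; rewrite (is_repr_uniq rk rg' (is_repr_sqint rg)).
by under eq_Rintegral do rewrite mulrC.
Qed.

Lemma cameron_martin_lin (a : R) h k : cameron_martin mu h -> cameron_martin mu k ->
  cameron_martin mu (a *: h + k).
Proof. by move=> [g rg] [g' rg']; exists (fun x => a * g x + g' x); exact: is_repr_lin. Qed.

Lemma innerH_lin (a : R) h k u : cameron_martin mu h -> cameron_martin mu k ->
  cameron_martin mu u ->
  innerH mu (a *: h + k) u = a * innerH mu h u + innerH mu k u.
Proof.
move=> [g rg] [g' rg'] [f rf].
rewrite (innerHE (is_repr_lin a rg rg') rf) (innerHE rg rf) (innerHE rg' rf).
have sg := is_repr_sqint rg; have sg' := is_repr_sqint rg'; have sf := is_repr_sqint rf.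
rewrite -RintegralZl//; last exact: sqint_mul.
rewrite -RintegralD//; last 2 first.
- exact: (integrableZl measurableT a (sqint_mul sg sf)).
- exact: sqint_mul.
by apply: eq_Rintegral => x _; ring.
Qed.

Lemma cameron_martin0 : cameron_martin mu 0.
Proof.
exists (fun=> 0); apply: is_repr_dual; first exact: cont_dual0.
move=> m dm; rewrite dual0//; under eq_Rintegral do rewrite mul0r.
by rewrite Rintegral_cst// mul0r.
Qed.

Lemma cameron_martinZ (a : R) h : cameron_martin mu h -> cameron_martin mu (a *: h).
Proof. by move=> ch; have := cameron_martin_lin a ch cameron_martin0; rewrite addr0. Qed.

Lemma cameron_martinB h k : cameron_martin mu h -> cameron_martin mu k ->
  cameron_martin mu (h - k).
Proof. by move=> ch ck; have := cameron_martin_lin (-1) ck ch; rewrite scaleN1r addrC. Qed.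

Lemma innerHB h k u : cameron_martin mu h -> cameron_martin mu k ->
  cameron_martin mu u -> innerH mu (h - k) u = innerH mu h u - innerH mu k u.
Proof.
move=> ch ck cu; have := innerH_lin (-1) ck ch cu.
by rewrite scaleN1r mulN1r addrC => ->; rewrite addrC.
Qed.

Lemma innerHC h k : innerH mu h k = innerH mu k h.
Proof. by apply: eq_Rintegral => x _; rewrite mulrC. Qed.

Lemma innerHZr (a : R) h k : cameron_martin mu h -> cameron_martin mu k ->
  innerH mu h (a *: k) = a * innerH mu h k.
Proof.
move=> ch ck; rewrite innerHC; have := innerH_lin a ck cameron_martin0 ch.
rewrite addr0 => ->; rewrite (innerHC k).
have := innerH_lin 1 cameron_martin0 cameron_martin0 ch.
rewrite scale1r addr0 mul1r => /eqP; rewrite -subr_eq0 opprD addrA subrr sub0r oppr_eq0.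
by move/eqP ->; rewrite addr0.
Qed.

Lemma innerH_le h k : cameron_martin mu h -> cameron_martin mu k ->
  `|innerH mu h k| <= normH mu h * normH mu k.
Proof.
move=> ch ck; have sh := is_repr_sqint (CMhatP ch); have sk := is_repr_sqint (CMhatP ck).
have := cauchy_schwarz_sqrt sh sk; rewrite /normH /innerH.
by under [X in _ <= Num.sqrt X * _ -> _]eq_Rintegral do rewrite expr2;
  under [X in _ <= _ * Num.sqrt X -> _]eq_Rintegral do rewrite expr2.
Qed.

Lemma normHZ (a : R) h : cameron_martin mu h -> normH mu (a *: h) = `|a| * normH mu h.
Proof.
move=> ch; rewrite /normH innerHZr//; last exact: cameron_martinZ.
by rewrite innerHC innerHZr// mulrA -expr2 sqrtrM ?sqr_ge0// sqrtr_sqr.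
Qed.

(** By [covariance_exists] the set from which [covariance_op] selects is
    inhabited. *)
Lemma covariance_opP l : cont_dual l -> is_repr mu (covariance_op mu l) l.
Proof.
move=> dl; apply: is_repr_dual => //.
exact: (xgetPex _ (covariance_exists mu_gauss Xsep dl)).
Qed.

Lemma innerH_covariance l h : cont_dual l -> cameron_martin mu h ->
  innerH mu (covariance_op mu l) h = l h.
Proof.
move=> dl [g rg]; rewrite (innerHE (covariance_opP dl) rg).
have [_ ->//] := rg; by apply: eq_Rintegral => x _; rewrite mulrC.
Qed.

Lemma normH_covariance l : cont_dual l ->
  normH mu (covariance_op mu l) = Num.sqrt (variance mu l).
Proof.
move=> dl; rewrite /normH (innerHE (covariance_opP dl) (covariance_opP dl)).
by congr Num.sqrt; apply: eq_Rintegral => x _; rewrite expr2.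
Qed.

Lemma dual_le_normH l h : cont_dual l -> cameron_martin mu h ->
  `|l h| <= Num.sqrt (variance mu l) * normH mu h.
Proof.
move=> dl ch; rewrite -normH_covariance// -innerH_covariance//.
by apply: innerH_le => //; exists l; exact: covariance_opP.
Qed.

End cameron_martin_space.

(** * Gradients of smooth cylindrical functions *)

Section frechet.
Context {R : realType} {n : nat}.
Variable phi : 'rV[R]_n -> R.
Hypothesis phi_smooth : Cb_infty phi.
Implicit Types (x z h : 'rV[R]_n) (i : 'I_n).

Let pd i := partial [:: i] phi.

Lemma partial_continuous i : continuous (pd i).
Proof. by have [] := phi_smooth [:: i]. Qed.

Lemma is_derive_partial z i (t : R) :
  is_derive t 1 (fun s => phi (z + s *: delta_mx 0 i) : R^o)
    (pd i (z + t *: delta_mx 0 i)).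
Proof.
have [_ _ /(_ i (z + t *: delta_mx 0 i)) dphi] := phi_smooth [::].
have E : (fun s : R => s^-1 *: (((fun s => phi (z + s *: delta_mx 0 i)) \o shift t) (s *: 1)
      - phi (z + t *: delta_mx 0 i)) : R^o) =
    (fun s : R => s^-1 *: ((phi \o shift (z + t *: delta_mx 0 i)) (s *: delta_mx 0 i)
      - phi (z + t *: delta_mx 0 i)) : R^o).
  apply/funext => s /=; congr (_ *: (phi _ - _)).
  by rewrite /shift/= scalerDl addrCA [in LHS](_ : s *: 1 = s)// /GRing.scale/= mulr1.
by split; rewrite /derivable/derive E.
Qed.

Lemma mean_value (F dF : R -> R) (s : R) :
  (forall t : R, is_derive t 1 (F : R -> R^o) (dF t)) ->
  exists2 c, `|c| <= `|s| & F s - F 0 = dF c * s.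
Proof.
move=> dFF; have cF : continuous F.
  move=> x; apply: differentiable_continuous; apply/derivable1_diffP.
  by have [] := dFF x.
have [s0|s0|<-] := ltgtP 0 s.
- have [c + ->] := MVT s0 (fun t _ => dFF t) (continuous_subspaceT cF).
  rewrite in_itv/= => /andP[c0 cs]; exists c; last by rewrite subr0.
  by rewrite !gtr0_norm// ltW.
- have [c + E] := MVT s0 (fun t _ => dFF t) (continuous_subspaceT cF).
  rewrite in_itv/= => /andP[sc c0]; exists c.
    by rewrite !ltr0_norm// lerN2 ltW.
  by rewrite -opprB E sub0r mulrN opprK.
- by exists 0; rewrite // subrr mulr0.
Qed.

(** The coordinates are changed one at a time and the mean value theorem is
    applied at each step. *)
Lemma frechet_partial x (e : R) : 0 < e -> exists2 d : R, 0 < d &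
  forall h, (forall i, `|h 0 i| < d) ->
    `|phi (x + h) - phi x - \sum_i pd i x * h 0 i| <= e * \sum_i `|h 0 i|.
Proof.
move=> e0.
have pd_near i : \forall y \near x, `|pd i x - pd i y| < e.
  by have := @partial_continuous i x; move=> /cvgrPdist_lt; apply.
have /nbhs_ballP[d /= d0 Hd] : nbhs x [set y | forall i, `|pd i x - pd i y| < e].
  exact: (filter_forall _ pd_near).
exists d => // h hd.
(* the increment truncated to its first [k] coordinates *)
pose H k : 'rV[R]_n := \row_i (if (i < k)%N then h 0 i else 0).
have Hn : H n = h by apply/rowP => i; rewrite mxE ltn_ord.
have H0 : H 0 = 0 by apply/rowP => i; rewrite !mxE.
have HS (k : 'I_n) : H k.+1 = H k + h 0 k *: delta_mx 0 k.
  apply/rowP => i; rewrite !mxE eqxx/= ltnS leq_eqVlt.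
  have [->|ik] := eqVneq i k; first by rewrite eqxx ltnn add0r mulr1.
  by rewrite -val_eqE/= in ik; rewrite (negbTE ik)/= mulr0 addr0.
suff step k : (k <= n)%N -> `|phi (x + H k) - phi x -
    \sum_(i < n | (i < k)%N) pd i x * h 0 i| <= e * \sum_(i < n | (i < k)%N) `|h 0 i|.
  have S (F : 'I_n -> R) : \sum_(i < n | (i < n)%N) F i = \sum_i F i.
    by apply: eq_bigl => i; rewrite ltn_ord.
  by have := step n (leqnn n); rewrite Hn !S.
elim: k => [_|k ih kn].
  by rewrite !big_pred0// H0 addr0 subrr subr0 normr0 mulr0.
pose k' := Ordinal kn; have := ih (ltnW kn).
have [c cs E] := mean_value (h 0 k') (is_derive_partial (x + H k) k').
rewrite scale0r addr0 in E.
have -> : H k.+1 = H k + h 0 k' *: delta_mx 0 k' := HS k'.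
have big1 (F : 'I_n -> R) : \sum_(i < n | (i < k.+1)%N) F i =
    F k' + \sum_(i < n | (i < k)%N) F i.
  rewrite (bigD1 k')//=; congr (_ + _); apply: eq_bigl => i.
  by rewrite -val_eqE/= ltnS ltn_neqAle andbC.
rewrite !big1 addrA mulrDr => ihk.
have close : `|pd k' (x + H k + c *: delta_mx 0 k') - pd k' x| <= e.
  rewrite distrC; apply/ltW/Hd; split => // i0 j; rewrite [i0]ord1 /ball/=.
  rewrite !mxE eqxx/=; have [->|jk] := eqVneq j k'.
    rewrite mulr1 ltnn addr0 opprD addNKr normrN.
    exact: le_lt_trans cs (hd k').
  rewrite mulr0 addr0; case: ifP => _; last by rewrite addr0 subrr normr0.
  by rewrite opprD addNKr normrN.
have -> : phi (x + H k + h 0 k' *: delta_mx 0 k') - phi x -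
    (pd k' x * h 0 k' + \sum_(i < n | (i < k)%N) pd i x * h 0 i) =
    (pd k' (x + H k + c *: delta_mx 0 k') - pd k' x) * h 0 k' +
    (phi (x + H k) - phi x - \sum_(i < n | (i < k)%N) pd i x * h 0 i).
  by rewrite mulrBl -E; ring.
apply: le_trans (ler_normD _ _) _; apply: lerD => //.
by rewrite normrM ler_wpM2r.
Qed.

End frechet.

Lemma continuous_bigsum {R : realType} (T : topologicalType) (I : Type) (r : seq I)
    (F : I -> T -> R) :
  (forall i, continuous (F i)) -> continuous (fun x => \sum_(i <- r) F i x).
Proof.
move=> cF; elim: r => [|i r ih] x.
  by under eq_fun do rewrite big_nil; exact: cvg_cst.
by under eq_fun do rewrite big_cons; apply: cvgD; [exact: cF|exact: ih].
Qed.

Section cylindrical.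
Context {R : realType} {X : completeNormedModType R}.
Variable mu : probability (borelT X) R.
Hypothesis mu_gauss : centered_gaussian mu.
Hypothesis Xsep : separable_space X.
Implicit Types (f : X -> R) (x y u v : X).

Lemma is_gradH_is_derive f x u v (t : R) : cameron_martin mu v ->
  is_gradH mu f (x + t *: v) u ->
  is_derive t 1 (fun s => f (x + s *: v) : R^o) (innerH mu u v).
Proof.
move=> cv [cu gu].
suff H : (fun h : R => h^-1 *: (((fun s => f (x + s *: v)) \o shift t) (h *: 1) -
    f (x + t *: v)) : R^o) @ 0^' --> (innerH mu u v : R^o).
  by split; [apply/cvg_ex; exists (innerH mu u v)|exact: (cvg_lim _ H)].
apply/cvgrPdist_le => e e0.
(* [normH mu v] itself may vanish *)
have v1 : 0 < normH mu v + 1 by rewrite ltr_wpDl// sqrtr_ge0.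
have [d d0 Hd] := gu (e / (normH mu v + 1)) (divr_gt0 e0 v1).
have dv : 0 < d / (normH mu v + 1) by rewrite divr_gt0.
near=> h.
have h0 : h != 0 by near: h; exact: nbhs_dnbhs_neq.
have hd : `|h| < d / (normH mu v + 1).
  by near: h; apply: dnbhs0_lt.
have ch : cameron_martin mu (h *: v) by exact: cameron_martinZ.
have := Hd (h *: v) ch; rewrite (normHZ mu_gauss)// (innerHZr mu_gauss)//.
rewrite -(addrA x) -scalerDl => H1.
rewrite /= /shift/= [h *: 1](_ : _ = h); last by rewrite /GRing.scale/= mulr1.
rewrite (addrC h t) /GRing.scale/=.
have {}H1 := H1 _.
have hlt : `|h| * normH mu v < d.
  rewrite ltr_pdivlMr// in hd; apply: le_lt_trans hd.
  by rewrite ler_wpM2l// lerDl.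
have {}H1 := H1 hlt.
have -> : innerH mu u v - h^-1 * (f (x + (t + h) *: v) - f (x + t *: v)) =
    - h^-1 * (f (x + (t + h) *: v) - f (x + t *: v) - h * innerH mu u v).
  by field.
rewrite normrM normrN normfV ler_pdivrMl ?normr_gt0//.
apply: le_trans H1 _; rewrite mulrCA ler_wpM2l// mulrAC ler_pdivrMr//.
by apply: ler_wpM2l; [exact: ltW|rewrite lerDl].
Unshelve. all: by end_near. Qed.

(** The gradient is the combination of the covariance images of the functionals
    with the partial derivatives as weights: the functionals are bounded for
    [normH], so that Frechet differentiability of the outer function suffices.
    The function [w] depends continuously on the point although [normH] is not
    continuous on [X]. *)
Lemma smooth_cylindrical_grad f : smooth_cylindrical f ->
  [/\ continuous f, forall x, cameron_martin mu (gradH mu f x)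
  & forall v, cameron_martin mu v -> exists w : X -> R,
    [/\ continuous w, forall x, innerH mu (gradH mu f x) v = w x
    & forall x (t : R), is_derive t 1 (fun s => f (x + s *: v) : R^o) (w (x + t *: v))]].
Proof.
move=> [n [phi [l [sphi dl fE]]]].
pose L x : 'rV[R]_n := \row_i l i x.
have cL : continuous L.
  move=> x; apply/cvg_ballP => e e0.
  have l_near j : \forall y \near x, ball (l j x) e (l j y).
    by have := (dl j).2 x; move=> /cvg_ballP; apply.
  by apply: filterS (filter_forall _ l_near) => y Hy; split=> // i j; rewrite !mxE.
pose u x := \sum_i partial [:: i] phi (L x) *: covariance_op mu (l i).
have cQ i : cameron_martin mu (covariance_op mu (l i)).
  by exists (l i); exact: covariance_opP.
have cu x : cameron_martin mu (u x).
  rewrite /u; elim/big_rec: _ => [|i y _ cy]; first exact: cameron_martin0.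
  exact: cameron_martin_lin.
have uE x v : cameron_martin mu v ->
    innerH mu (u x) v = \sum_i partial [:: i] phi (L x) * l i v.
  move=> cv; rewrite /u.
  have H : forall r : seq 'I_n, cameron_martin mu (\sum_(i <- r) partial [:: i] phi (L x) *: covariance_op mu (l i)) /\
     innerH mu (\sum_(i <- r) partial [:: i] phi (L x) *: covariance_op mu (l i)) v =
     \sum_(i <- r) partial [:: i] phi (L x) * l i v.
    elim=> [|i r [ih1 ih2]].
      rewrite !big_nil; split; first exact: cameron_martin0.
      have := innerHZr mu_gauss 0 cv cv; rewrite scale0r mul0r innerHC => <-//.
    rewrite !big_cons; split; first exact: cameron_martin_lin.
    by rewrite innerH_lin// innerH_covariance// ih2.
  by have [] := H (index_enum 'I_n).
have gu x : is_gradH mu f x (u x).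
  split=> // e e0.
  pose S := \sum_i Num.sqrt (variance mu (l i)) + 1.
  have S1 : 1 <= S by rewrite lerDr sumr_ge0// => i _; exact: sqrtr_ge0.
  have S0 : 0 < S by exact: lt_le_trans S1.
  have [d d0 Hd] := frechet_partial sphi (L x) (divr_gt0 e0 S0).
  exists (d / S); first by rewrite divr_gt0.
  move=> h ch; rewrite ltr_pdivlMr// => hd.
  have nh : 0 <= normH mu h by exact: sqrtr_ge0.
  have lh i : `|l i h| <= Num.sqrt (variance mu (l i)) * normH mu h.
    exact: dual_le_normH.
  have LD : L (x + h) = L x + L h.
    by apply/rowP => i; rewrite !mxE dualD.
  have hi i : `|L h 0 i| < d.
    rewrite mxE; apply: le_lt_trans (lh i) _; apply: le_lt_trans hd.
    rewrite mulrC ler_wpM2l// /S (bigD1 i)//= -addrA lerDl addr_ge0//.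
    by rewrite sumr_ge0// => j _; exact: sqrtr_ge0.
  have := Hd _ hi; rewrite -LD !fE -/(L _) -/(L _) uE//.
  under eq_bigr do rewrite mxE; move=> /le_trans; apply.
  rewrite mulrAC ler_pdivrMr// -mulrA ler_pM2l// (mulrC _ S).
  apply: (@le_trans _ _ (\sum_i Num.sqrt (variance mu (l i)) * normH mu h)).
    by apply: ler_sum => i _; rewrite mxE.
  by rewrite -mulr_suml; apply: ler_wpM2r => //; rewrite lerDl.
have gg x : is_gradH mu f x (gradH mu f x) by exact: (xgetPex _ (ex_intro _ _ (gu x))).
split=> [x|x|v cv].
- have -> : f = phi \o L by apply/funext.
  apply: continuous_comp; first exact: cL.
  by have [c _ _] := sphi [::]; exact: c.
- by have [] := gg x.
exists (fun x => innerH mu (u x) v); split.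
- have -> : (fun x => innerH mu (u x) v) = (fun x => \sum_i partial [:: i] phi (L x) * l i v).
    by apply/funext => x; rewrite uE.
  apply: continuous_bigsum => i x; apply: cvgM; last exact: cvg_cst.
  by apply: continuous_comp; [exact: cL|exact: partial_continuous].
- move=> x; have [_ d1] : is_derive (0 : R) 1 (fun s : R => f (x + s *: v) : R^o) (innerH mu (gradH mu f x) v).
    by apply: is_gradH_is_derive => //; rewrite scale0r addr0.
  have [_ d2] : is_derive (0 : R) 1 (fun s : R => f (x + s *: v) : R^o) (innerH mu (u x) v).
    by apply: is_gradH_is_derive => //; rewrite scale0r addr0.
  by rewrite -d1 d2.
- by move=> x t; exact: is_gradH_is_derive.
Qed.

End cylindrical.

(** * Disintegration along a Cameron--Martin direction *)

Lemma image_measure_exists d d' (T1 : measurableType d) (T2 : measurableType d')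
    (R : realType) (m : {measure set T1 -> \bar R}) (f : T1 -> T2) :
  measurable_fun setT f ->
  exists m1 : {measure set T2 -> \bar R}, forall A, m1 A = m (f @^-1` A).
Proof.
move=> mf; unshelve eexists (pushforward m f : {measure set T2 -> \bar R}) => //.
Qed.

Lemma rat_seq {R : realType} : exists q : nat -> R, forall (s e : R), 0 < e ->
  exists n, `|s - q n| < e.
Proof.
exists (fun n => ratr (odflt 0 (@choice.unpickle rat n))) => s e e0.
have [q] : exists q : rat, ratr q \in `](s - e), (s + e)[%R.
  by apply: rat_in_itvoo; rewrite ltrBlDr -addrA ltrDl addr_gt0.
rewrite in_itv/= => /andP[q1 q2]; exists (choice.pickle q).
rewrite choice.pickleK/= ltr_norml; apply/andP; split; lra.
Qed.

Section disintegration.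
Context {R : realType} {X : completeNormedModType R}.
Variable mu : probability (borelT X) R.
Hypothesis mu_gauss : centered_gaussian mu.
Hypothesis Xsep : separable_space X.
Variables (l : X -> R) (v : X).
Hypothesis dl : cont_dual l.
Hypothesis lv : forall m, cont_dual m -> m v = \int[mu]_x (l x * m x).
Hypothesis lv1 : l v = 1.

Local Notation gam := (gauss (1 : R)).

(** The point of the line [y + R v] whose [l]-coordinate is [s]. *)
Definition line (y : X) (s : R) : X := y + (s - l y) *: v.

Let T (z : borelT X * R) : borelT X := line z.1 z.2.

Lemma dual_line m y s : cont_dual m -> m (line y s) = m y - m v * l y + m v * s.
Proof. by move=> dm; rewrite /line dualD// dualZ//; ring. Qed.

(** The map is jointly continuous and both factors are separable, so that the
    preimage of an open set is a countable union of boxes. *)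
Lemma measurable_line : measurable_fun setT T.
Proof.
apply: (@measurability _ _ _ _ setT T (@open X)) => // _ [U oU <-]; rewrite setTI.
have [d dP] := dense_seq Xsep; have [q qP] := @rat_seq R.
pose B n j k : set (borelT X * R) :=
  [set x | `|x - d n| < k.+1%:R^-1] `*` [set s | `|s - q j| < k.+1%:R^-1].
have mB n j k : measurable (B n j k).
  apply: measurableX.
  - apply: borel_open; rewrite (_ : mkset _ = ball (d n) k.+1%:R^-1); first exact: ball_open.
    by apply/seteqP; split => x; rewrite -ball_normE /= distrC.
  - apply: open_measurable; rewrite (_ : mkset _ = ball (q j) k.+1%:R^-1); first exact: ball_open.
    by apply/seteqP; split => x; rewrite -ball_normE /= distrC.
have -> : T @^-1` U = \bigcup_n \bigcup_j \bigcup_k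
    (if `[< B n j k `<=` T @^-1` U >] then B n j k else set0).
  apply/seteqP; split=> [[x s] Ux|z [n _ [j _ [k _]]]]; last by case: asboolP => // + ?; apply.
  have /nbhs_ballP[e /= e0 He] : nbhs (T (x, s)) U by exact: open_nbhs_nbhs.
  have [M M0 lM] := dual_bounded dl.
  (* a Lipschitz constant of the map *)
  pose C := 1 + (1 + M) * `|v|; have C0 : 0 < C.
    by rewrite ltr_pwDl// mulr_ge0// addr_ge0// ltW.
  have eC : 0 < e / C / 2 by rewrite !divr_gt0.
  have [k _ /(_ k (leqnn k)) /= ke] := cvgr_lt _ (@cvg_harmonic R) _ eC.
  have [n xn] := dP x k.+1%:R^-1 (harmonic_gt0 k).
  have [j sj] := qP s k.+1%:R^-1 (harmonic_gt0 k).
  exists n => //; exists j => //; exists k => //; case: asboolP => [_|nU]; first by [].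
  exfalso; apply: nU => -[y t] [/= yn tj]; apply: He; rewrite -ball_normE /=.
  set r := e / C; have xy : `|x - y| < r.
    apply: le_lt_trans (ler_distD (d n) x y) _; rewrite (distrC (d n) y).
    by rewrite [ltRHS]splitr; apply: ltrD; apply: lt_trans ke.
  have st : `|s - t| < r.
    apply: le_lt_trans (ler_distD (q j) s t) _; rewrite (distrC (q j) t).
    by rewrite [ltRHS]splitr; apply: ltrD; apply: lt_trans ke.
  have -> : T (x, s) - T (y, t) = (x - y) + ((s - t) - l (x - y)) *: v.
    rewrite /T /line /= dualB// opprD addrACA -scalerBl; congr (_ + _ *: _); ring.
  apply: le_lt_trans (ler_normD _ _) _; rewrite normrZ.
  have h1 : `|s - t - l (x - y)| <= (1 + M) * r.
    apply: le_trans (ler_normB _ _) _; rewrite mulrDl mul1r; apply: lerD; first exact: ltW.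
    by apply: le_trans (lM _) _; rewrite ler_pM2l// ltW.
  have -> : e = r + (1 + M) * r * `|v|.
    by rewrite /r /C in C0 *; field; rewrite gt_eqF.
  by apply: ltr_leD => //; rewrite ler_wpM2r.
apply: bigcupT_measurable => n; apply: bigcupT_measurable => j.
apply: bigcupT_measurable => k; case: asboolP => _; first exact: mB.
exact: measurable0.
Qed.

Lemma measurable_line_point y :
  measurable_fun [set: R] (fun s => line y s : borelT X).
Proof. exact: (measurableT_comp measurable_line (pair1_measurable (y : borelT X))). Qed.

Lemma variance_proj m : cont_dual m ->
  variance mu (fun x => m x - m v * l x) = variance mu m - m v ^+ 2.
Proof.
move=> dm; have sl := sqint_dual mu_gauss dl; have sm := sqint_dual mu_gauss dm.
have -> : variance mu (fun x => m x - m v * l x) =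
    \int[mu]_x (1 * m x + (- m v) * l x) ^+ 2.
  by apply: eq_Rintegral => x _; congr (_ ^+ 2); ring.
rewrite integral_sqrD//; under [in X in _ + X + _]eq_Rintegral do rewrite mulrC.
rewrite -lv//; have -> : \int[mu]_x l x ^+ 2 = 1.
  by rewrite -lv1 lv//; apply: eq_Rintegral => x _; rewrite expr2.
by rewrite /variance; ring.
Qed.

Lemma gauss_line_cos m th y : cont_dual m ->
  \int[gam]_s cos (m (line y s) + th) =
  expR (- m v ^+ 2 / 2) * cos (m y - m v * l y + th).
Proof.
move=> dm; have := @gauss_cos R 1 (m v) (m y - m v * l y + th) (oner_neq0 _).
rewrite expr1n mul1r => <-; apply: eq_Rintegral => s _.
by rewrite dual_line//; congr cos; ring.
Qed.

(** The functional [l] is standard normal and independent of the projection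
    along [v]; replacing it by an independent copy does not change the law. On
    characteristic functionals this is the identity
    [variance_proj]: the variance of [m] splits as [m v ^+ 2] plus that of the
    projected functional. *)
Lemma image_line (A : set (borelT X)) : measurable A -> (mu \x gam)%E (T @^-1` A) = mu A.
Proof.
have [m1 m1E] := image_measure_exists (mu \x gam)%E measurable_line.
have pT : (mu \x gam)%E [set: borelT X * R] = 1%E.
  rewrite -setXTT; apply: etrans (product_measure1E mu gam measurableT measurableT) _.
  by rewrite /= !probability_setT mule1.
have mT1 : (m1 setT < +oo)%E by apply: le_lt_trans (ltry 1); rewrite m1E preimage_setT /= pT.
have image1 B : measurable B -> (mu \x gam)%E (T @^-1` B) = m1 B by rewrite m1E.
move=> mA; rewrite -m1E; apply: (@char_unique _ _ m1 mu Xsep mT1 (prob_fin _)) => // m th dm.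
have mc := measurable_cos_dual th dm.
have bc : (mu \x gam)%E.-integrable setT (EFin \o (fun z => cos (m (T z) + th))).
  apply: measurable_bounded_integrable => //.
  - by apply: le_lt_trans (ltry 1); rewrite /= pT.
  - by apply: (measurableT_comp mc); exact: measurable_line.
  - exists 1; split; first exact: num_real.
    move=> N N1 x _; apply: le_trans (ltW N1).
    by rewrite ler_norml cos_geN1 cos_le1.
have -> : \int[m1]_x cos (m x + th) = \int[mu]_y \int[gam]_s cos (m (line y s) + th).
  rewrite /Rintegral -(integral_image measurable_line image1 (f := fun x => (cos (m x + th))%:E)); last first.
    exact/measurable_EFinP.
  rewrite -(integral12_prod_meas1 bc); congr fine; apply: eq_integral => y _.
  rewrite /fubini_F /= fineK//.
  apply: integrable_fin_num => //.
  apply: measurable_bounded_integrable => //; first exact: prob_fin.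
  - exact: (measurableT_comp mc (measurable_line_point y)).
  - exists 1; split; first exact: num_real.
    move=> N N1 x _; apply: le_trans (ltW N1).
    by rewrite ler_norml cos_geN1 cos_le1.
under eq_Rintegral do rewrite gauss_line_cos//.
have dm' : cont_dual (fun x => m x - m v * l x) by apply: cont_dualB => //; exact: cont_dualZ.
rewrite RintegralZl//; last first.
  apply: (@bounded_integrable _ _ mu _ 1); [exact: prob_fin|exact: (measurable_cos_dual th dm')|].
  by move=> x; rewrite ler_norml cos_geN1 cos_le1.
rewrite (integral_cos_dual mu_gauss th dm') (integral_cos_dual mu_gauss th dm).
rewrite variance_proj// mulrA -expRD; congr (expR _ * _); field.
Unshelve. all: by [].
Qed.

Lemma ge0_integral_line (F : borelT X -> \bar R) : measurable_fun setT F ->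
  (forall x, 0 <= F x)%E ->
  (\int[mu]_x F x = \int[mu]_y \int[gam]_s F (line y s))%E.
Proof.
move=> mF F0; rewrite -(ge0_integral_image measurable_line image_line mF F0).
rewrite fubini_tonelli1//.
exact: (measurableT_comp mF measurable_line).
Qed.

Lemma integral_line (F : X -> R) M : measurable_fun [set: borelT X] F ->
  (forall x, `|F x| <= M) ->
  \int[mu]_x F x = \int[mu]_y \int[gam]_s F (line y s).
Proof.
move=> mF FM; have M0 : 0 <= M by apply: le_trans (FM (0 : X)).
have mT1 : (mu \x gam)%E [set: borelT X * R] = 1%E.
  by rewrite -[LHS]/((mu \x gam)%E (T @^-1` setT)) image_line// probability_setT.
have bF : [bounded F (T z) | z in [set: borelT X * R]].
  exists M; split; first exact: num_real.
  by move=> N N1 x _; apply: le_trans (FM _) (ltW N1).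
have iF : (mu \x gam)%E.-integrable setT (EFin \o (fun z => F (T z))).
  apply: measurable_bounded_integrable bF => //.
  - by apply: le_lt_trans (ltry 1); rewrite /= mT1.
  - exact: (measurableT_comp mF measurable_line).
rewrite {1}/Rintegral -(integral_image measurable_line image_line (f := EFin \o F)); last first.
  exact/measurable_EFinP.
rewrite -(integral12_prod_meas1 iF); congr fine; apply: eq_integral => y _.
rewrite /fubini_F /= fineK//; apply: integrable_fin_num => //.
apply: measurable_bounded_integrable => //; first exact: prob_fin.
- exact: (measurableT_comp mF (measurable_line_point y)).
- exists M; split; first exact: num_real.
  by move=> N N1 x _; apply: le_trans (FM _) (ltW N1).
Qed.

Lemma integrable_integral_line (F : X -> R) M : measurable_fun [set: borelT X] F ->
  (forall x, `|F x| <= M) ->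
  mu.-integrable setT (fun y => (\int[gam]_s F (line y s))%:E).
Proof.
move=> mF FM.
have mT1 : (mu \x gam)%E [set: borelT X * R] = 1%E.
  by rewrite -[LHS]/((mu \x gam)%E (T @^-1` setT)) image_line// probability_setT.
have iF : (mu \x gam)%E.-integrable setT (EFin \o (fun z => F (T z))).
  apply: measurable_bounded_integrable => //.
  - by apply: le_lt_trans (ltry 1); rewrite /= mT1.
  - exact: (measurableT_comp mF measurable_line).
  - exists M; split; first exact: num_real.
    by move=> N N1 x _; apply: le_trans (FM _) (ltW N1).
apply: eq_integrable (integrable_fubini_F iF) => //= y _.
rewrite /fubini_F /= fineK//; apply: integrable_fin_num => //.
apply: measurable_bounded_integrable => //; first exact: prob_fin.
- exact: (measurableT_comp mF (measurable_line_point y)).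
- exists M; split; first exact: num_real.
  by move=> N N1 x _; apply: le_trans (FM _) (ltW N1).
Qed.

Lemma measurable_integral_line (F : X -> R) M : measurable_fun [set: borelT X] F ->
  (forall x, `|F x| <= M) ->
  measurable_fun [set: borelT X] (fun y => \int[gam]_s F (line y s)).
Proof.
move=> mF FM; apply/measurable_EFinP.
exact: measurable_int (integrable_integral_line mF FM).
Qed.

Lemma measurable_gauss_line (F : X -> \bar R) : measurable_fun [set: borelT X] F ->
  (forall x, 0 <= F x)%E ->
  measurable_fun [set: borelT X] (fun y => \int[gam]_s F (line y s))%E.
Proof.
move=> mF F0; apply: (@measurable_fun_fubini_tonelli_F _ _ _ _ _ gam
  (fun z : borelT X * R => F (line z.1 z.2))) => //.
exact: (measurableT_comp mF measurable_line).
Qed.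

Lemma ae_line (P : X -> Prop) : {ae mu, forall x, P x} ->
  {ae mu, forall y, {ae gam, forall s, P (line y s)}}.
Proof.
move=> [N [mN N0 PN]].
have mi : measurable_fun [set: borelT X] (fun x => (\1_N x : R)%:E).
  by apply/measurable_EFinP; exact: measurable_indic.
have mi2 : measurable_fun [set: borelT X] (fun y => \int[gam]_s (\1_N (line y s) : R)%:E)%E.
  by apply: (measurable_gauss_line mi) => x; rewrite lee_fin.
have : (\int[mu]_y (\int[gam]_s (\1_N (line y s) : R)%:E) = 0)%E.
  rewrite -(ge0_integral_line mi); last by move=> x; rewrite lee_fin.
  by rewrite integral_indic// setIT.
have i0 y : (0 <= \int[gam]_s (\1_N (line y s) : R)%:E)%E.
  by apply: integral_ge0 => s _; rewrite lee_fin.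
move=> E0.
have : (\int[mu]_(y in setT) `|\int[gam]_s (\1_N (line y s) : R)%:E| = 0)%E.
  by under eq_integral do rewrite gee0_abs//.
move/(ae_eq_integral_abs mu measurableT mi2); apply: ae_imply => y /(_ I) /= Ey.
exists (line y @^-1` N); split.
- rewrite -[X in measurable X]setTI; exact: (measurable_line_point y).
- rewrite -Ey (_ : (fun s => _) = (fun s => (\1_(line y @^-1` N) s)%:E))//.
  rewrite integral_indic ?setIT// -[X in measurable X]setTI.
  exact: (measurable_line_point y).
- by move=> s /= nP; exact: PN.
Qed.

End disintegration.

(** * The zero-one law *)

Section integral_tools.
Context d (T : measurableType d) (R : realType).
Variable mu : {measure set T -> \bar R}.

Lemma ae_eq_Rintegral (f g : T -> R) : measurable_fun setT f -> measurable_fun setT g ->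
  {ae mu, forall x, f x = g x} -> \int[mu]_x f x = \int[mu]_x g x.
Proof.
move=> mf mg fg; congr fine; apply: ae_eq_integral => //; try exact/measurable_EFinP.
by apply: ae_imply fg => x /= ->.
Qed.

Lemma Rintegral_mrestr (E : set T) (mE : measurable E) (f : T -> R) : (mu setT < +oo)%E ->
  measurable_fun setT f -> (exists M, forall x, `|f x| <= M) ->
  \int[mrestr mu mE]_x f x = \int[mu]_x (\1_E x * f x).
Proof.
move=> mufin mf [M fM].
have -> : \int[mu]_x (\1_E x * f x) = \int[mu]_(x in E) f x.
  rewrite [RHS]Rintegral_mkcond; apply: eq_Rintegral => x _.
  by rewrite patchE indicE; case: ifP => _; rewrite ?mul1r ?mul0r.
rewrite /Rintegral (negligible_integral (measurableC mE))//; last 2 first.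
- apply: measurable_bounded_integrable => //.
    apply: le_lt_trans mufin; rewrite /= /mrestr setTI; apply: le_measure; rewrite ?inE//.
  by exists M; split; [exact: num_real|move=> N MN x _; exact: le_trans (fM x) (ltW MN)].
- by rewrite /= /mrestr setICl measure0.
rewrite setTD setCK; congr fine; apply: eq_measure_integral => A mA AE.
by rewrite /= /mrestr setIidl.
Qed.

(** Adding the constant [M] reduces to nonnegative functions. *)
Lemma Rintegral_mscale (r : {nonneg R}) (f : T -> R) : (mu setT < +oo)%E ->
  measurable_fun setT f -> (exists M, forall x, `|f x| <= M) ->
  \int[mscale r mu]_x f x = r%:num * \int[mu]_x f x.
Proof.
move=> mufin mf [M fM].
have iM (m : {measure set T -> \bar R}) : (m setT < +oo)%E ->
    m.-integrable setT (EFin \o f) /\ m.-integrable setT (EFin \o cst M).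
  move=> mfin; split; apply: measurable_bounded_integrable => //.
    by exists M; split; [exact: num_real|move=> N MN x _; exact: le_trans (fM x) (ltW MN)].
  by exists `|M|; split; [exact: num_real|move=> N MN x _; exact: ltW MN].
have E (m : {measure set T -> \bar R}) : (m setT < +oo)%E ->
    \int[m]_x f x = \int[m]_x (f x + M) - \int[m]_x M.
  move=> mfin; have [i1 i2] := iM m mfin.
  by rewrite RintegralD// addrK.
have sfin : (mscale r mu setT < +oo)%E.
  by rewrite /mscale lte_mul_pinfty ?lee_fin.
rewrite !E// mulrBr; congr (_ - _).
- have f0 x : (0 <= (f x + M)%:E)%E.
    by rewrite lee_fin; have := fM x; rewrite ler_norml => /andP[]; lra.
  have mfM : measurable_fun setT (fun x => (f x + M)%:E).
    by apply/measurable_EFinP; exact: measurable_funD.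
  rewrite /Rintegral ge0_integral_mscale// fineM//.
  apply: integrable_fin_num => //; have [i1 i2] := iM mu mufin.
  exact: (integrableD measurableT i1 i2).
- rewrite !Rintegral_cst//= /mscale/= fineM//=; first by rewrite mulrCA.
  by rewrite ge0_fin_numE.
Qed.

End integral_tools.

Lemma cos_lipschitz {R : realType} (a th : R) : `|cos (a + th) - cos th| <= `|a|.
Proof.
have dF (t : R) : is_derive t 1 (fun s => cos (s + th) : R^o) (- sin (t + th)).
  by apply: is_derive_eq; rewrite /GRing.scale/=; ring.
have [c _] := mean_value a dF; rewrite add0r => ->.
by rewrite normrM normrN ler_piMl// ler_norml sin_geN1 sin_le1.
Qed.

Section ergodicity.
Context {R : realType} {X : completeNormedModType R}.
Variable mu : probability (borelT X) R.
Hypothesis mu_gauss : centered_gaussian mu.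
Hypothesis Xsep : separable_space X.
Implicit Types (m : X -> R).

Local Notation gam := (gauss (1 : R)).

Lemma indicM_cos_bound (E : set X) m th x : `|\1_E x * cos (m x + th)| <= 1 :> R.
Proof.
rewrite indicE; case: (x \in E); rewrite ?mul1r ?mul0r ?normr0//.
by rewrite ler_norml cos_geN1 cos_le1.
Qed.

(** On almost every line the indicator is a constant, so that the average over
    the line acts on the cosine alone. *)
Lemma invariant_cos (l : X -> R) (v : X) (E : set (borelT X)) m th : cont_dual l ->
  (forall m, cont_dual m -> m v = \int[mu]_x (l x * m x)) -> l v = 1 ->
  measurable E ->
  {ae mu, forall y, {ae gam, forall s, E (line l v y s)} \/
                    {ae gam, forall s, ~ E (line l v y s)}} ->
  cont_dual m ->
  \int[mu]_x (\1_E x * cos (m x + th)) = expR (- m v ^+ 2 / 2) *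
    \int[mu]_x (\1_E x * cos (m x - m v * l x + th)).
Proof.
move=> dl lv lv1 mE inv dm.
have dm' : cont_dual (fun x => m x - m v * l x) by apply: cont_dualB => //; exact: cont_dualZ.
have m1 : measurable_fun [set: borelT X] (fun x => \1_E x * cos (m x + th)).
  by apply: measurable_funM => //; exact: measurable_cos_dual.
have m2 : measurable_fun [set: borelT X] (fun x => \1_E x * cos (m x - m v * l x + th)).
  by apply: measurable_funM => //; exact: (measurable_cos_dual th dm').
rewrite (integral_line mu_gauss Xsep dl lv lv1 m1 (indicM_cos_bound E m th)).
have b2 := indicM_cos_bound E (fun x => m x - m v * l x) th.
rewrite (integral_line mu_gauss Xsep dl lv lv1 m2 b2).
rewrite -RintegralZl//; last first.
  exact: (integrable_integral_line mu_gauss Xsep dl lv lv1 m2 b2).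
apply: ae_eq_Rintegral.
- exact: (measurable_integral_line mu_gauss Xsep dl lv lv1 m1 (indicM_cos_bound E m th)).
- apply: measurable_funM => //.
  exact: (measurable_integral_line mu_gauss Xsep dl lv lv1 m2 b2).
have ml := measurable_line_point Xsep v dl.
apply: ae_imply inv => y [aE|aE].
- transitivity (\int[gam]_s cos (m (line l v y s) + th)).
    apply: ae_eq_Rintegral.
    + exact: (measurableT_comp m1 (ml y)).
    + exact: (measurableT_comp (measurable_cos_dual th dm) (ml y)).
    + by apply: ae_imply aE => s Es; rewrite indicE mem_set// mul1r.
  rewrite gauss_line_cos//; congr (_ * _).
  transitivity (\int[gam]_(s in [set: R]) cos (m y - m v * l y + th)).
    by rewrite Rintegral_cst//= probability_setT mulr1.
  apply: ae_eq_Rintegral => //.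
    exact: (measurableT_comp m2 (ml y)).
  apply: ae_imply aE => s Es; rewrite indicE mem_set// mul1r.
  rewrite (dual_line l v y s dm) (dual_line l v y s dl) lv1; congr cos; ring.
- transitivity (\int[gam]_(s in [set: R]) (0 : R)).
    apply: ae_eq_Rintegral => //; first exact: (measurableT_comp m1 (ml y)).
    by apply: ae_imply aE => s Es; rewrite indicE memNset// mul0r.
  rewrite Rintegral_cst//= mul0r.
  transitivity (expR (- m v ^+ 2 / 2) * \int[gam]_(s in [set: R]) (0 : R)).
    by rewrite Rintegral_cst//= mul0r mulr0.
  congr (_ * _); apply: ae_eq_Rintegral => //; first exact: (measurableT_comp m2 (ml y)).
  by apply: ae_imply aE => s Es; rewrite indicE memNset// mul0r.
Qed.

Variable v : nat -> X.
Hypothesis v_onb : orthonormal_basisH mu v.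
Variable l : nat -> X -> R.
Hypothesis dl : forall k, cont_dual (l k).
Hypothesis lv : forall k, covariance_op mu (l k) = v k.

Lemma basis_repr k m : cont_dual m -> m (v k) = \int[mu]_x (l k x * m x).
Proof. by move=> dm; rewrite -lv; have [_] := covariance_opP mu_gauss Xsep (dl k); exact. Qed.

Lemma basis_dual i j : l i (v j) = (i == j)%:R.
Proof.
by have [cv <- _] := v_onb; rewrite -[v i]lv innerH_covariance.
Qed.

(** The part of [m] that is independent of the first [n] coordinates. *)
Fixpoint residual m n : X -> R :=
  if n is n'.+1 then fun x => - m (v n') * l n' x + residual m n' x else m.

Lemma residual_facts m n : cont_dual m ->
  [/\ cont_dual (residual m n),
    forall k, (n <= k)%N -> residual m n (v k) = m (v k)
  & is_repr mu (covariance_op mu m - \sum_(k < n) m (v k) *: v k) (residual m n)].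
Proof.
move=> dm; elim: n => [|n [ih1 ih2 ih3]] /=.
  by rewrite big_ord0 subr0; split=> //; exact: covariance_opP.
split.
- by apply: cont_dualD => //; exact: cont_dualZ.
- move=> k nk; rewrite basis_dual (ltn_eqF nk) mulr0 add0r ih2//; exact: ltnW.
- rewrite big_ord_recr/= opprD addrA addrC -scaleNr.
  apply: is_repr_lin => //; rewrite -lv; exact: covariance_opP.
Qed.

Lemma residual_cvg m : cont_dual m -> variance mu (residual m n) @[n --> \oo] --> (0 : R).
Proof.
move=> dm; have [cv _ /(_ (covariance_op mu m))] := v_onb.
have cm : cameron_martin mu (covariance_op mu m) by exists m; exact: covariance_opP.
move=> /(_ cm) H.
have E n : normH mu (covariance_op mu m - \sum_(k < n) innerH mu (covariance_op mu m) (v k) *: v k)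
    = Num.sqrt (variance mu (residual m n)).
  under eq_bigr do rewrite innerH_covariance//.
  have [_ _ r] := residual_facts n dm.
  rewrite /normH (innerHE mu_gauss r r) /variance; congr Num.sqrt.
have : (fun n => Num.sqrt (variance mu (residual m n)) ^+ 2) @ \oo --> (0 : R).
  rewrite -[X in _ --> X](mulr0 (0 : R)).
  have H' : (fun n => Num.sqrt (variance mu (residual m n))) @ \oo --> (0 : R).
    by move: H; under eq_fun do rewrite E.
  by under eq_fun do rewrite expr2; exact: cvgM.
by under eq_fun do rewrite sqr_sqrtr ?integral_sqr_ge0//.
Qed.

Lemma residual_variance m n : cont_dual m ->
  variance mu (residual m n) = variance mu m - \sum_(k < n) m (v k) ^+ 2.
Proof.
move=> dm; elim: n => [|n ih]; first by rewrite big_ord0 subr0.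
have [dr rv _] := residual_facts n dm.
have lv1 : l n (v n) = 1 by rewrite basis_dual eqxx.
have := variance_proj mu_gauss (dl n) (basis_repr n) lv1 dr; rewrite rv// => h.
rewrite big_ord_recr/= opprD addrA -ih -h; congr variance; apply/funext => x.
by rewrite mulNr addrC.
Qed.

(** Peeling off one coordinate at a time, [\1_E] integrates against
    [cos (m + th)] as if it were independent of [m]. By [char_unique] the
    restriction of [mu] to [E] is then a multiple of [mu], and evaluating both
    at [E] gives the claim. *)
Theorem zero_one_law (E : set (borelT X)) : measurable E ->
  (forall k, {ae mu, forall y, {ae gam, forall s, E (line (l k) (v k) y s)} \/
                    {ae gam, forall s, ~ E (line (l k) (v k) y s)}}) ->
  fine (mu E) = fine (mu E) ^+ 2.
Proof.
move=> mE inv.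
have intE m th : cont_dual m -> mu.-integrable setT (fun x => (\1_E x * cos (m x + th))%:E).
  move=> dm; apply: (@bounded_integrable _ _ mu _ 1); [exact: prob_fin| |].
  - by apply: measurable_funM => //; exact: measurable_cos_dual.
  - exact: indicM_cos_bound.
(* [n] coordinates removed *)
have step m th n : cont_dual m -> \int[mu]_x (\1_E x * cos (m x + th)) =
    expR (- (\sum_(k < n) m (v k) ^+ 2) / 2) *
    \int[mu]_x (\1_E x * cos (residual m n x + th)).
  move=> dm; elim: n => [|n ih]; first by rewrite big_ord0 oppr0 mul0r expR0 mul1r.
  have [dr rv _] := residual_facts n dm.
  have lv1 : l n (v n) = 1 by rewrite basis_dual eqxx.
  rewrite ih (invariant_cos th (dl n) (basis_repr n) lv1 mE (inv n) dr) rv//.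
  rewrite mulrA -expRD big_ord_recr/=; congr (expR _ * _); first by field.
  by apply: eq_Rintegral => x _; rewrite mulNr (addrC (- _)).
(* all coordinates removed: the residual tends to [0] in mean square *)
have lim m th : cont_dual m -> \int[mu]_x (\1_E x * cos (m x + th)) =
    expR (- variance mu m / 2) * (cos th * fine (mu E)).
  move=> dm; have V0 := residual_cvg dm.
  have c1 : expR (- (\sum_(k < n) m (v k) ^+ 2) / 2) @[n --> \oo] -->
      expR (- variance mu m / 2).
    have -> : (fun n => expR (- (\sum_(k < n) m (v k) ^+ 2) / 2)) =
        (fun n => expR ((variance mu (residual m n) - variance mu m) / 2)).
      by apply/funext => n; rewrite residual_variance// addrAC subrr add0r.
    apply: (cvg_comp _ expR); last exact: continuous_expR.
    apply: cvgM; last exact: cvg_cst.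
    by rewrite -[X in _ --> X]add0r; apply: cvgB => //; exact: cvg_cst.
  have c2 : \int[mu]_x (\1_E x * cos (residual m n x + th)) @[n --> \oo] -->
      cos th * fine (mu E).
    have sV : Num.sqrt (variance mu (residual m n)) @[n --> \oo] --> (0 : R).
      rewrite -(@sqrtr0 R); apply: (cvg_comp _ Num.sqrt); first exact: V0.
      exact: sqrt_continuous.
    have bnd n : `|\int[mu]_x (\1_E x * cos (residual m n x + th)) - cos th * fine (mu E)|
        <= Num.sqrt (variance mu (residual m n)).
      have [dr _ _] := residual_facts n dm.
      have -> : cos th * fine (mu E) = \int[mu]_x (\1_E x * cos th).
        rewrite RintegralZr//; last exact: integrable_indic.
        rewrite mulrC; congr (_ * _); congr fine.
        by rewrite integral_indic// setIT.
      have i1 := intE _ th dr.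
      have i2 : mu.-integrable setT (fun x => (\1_E x * cos th)%:E).
        apply: (@bounded_integrable _ _ mu _ 1); [exact: prob_fin|exact: measurable_funM|].
        move=> x; rewrite indicE; case: (x \in E); rewrite ?mul1r ?mul0r ?normr0//.
        by rewrite ler_norml cos_geN1 cos_le1.
      rewrite -RintegralB//.
      apply: le_trans (le_normr_Rintegral measurableT (integrableB measurableT i1 i2)) _.
      have s1 : sqint mu (cst 1 : X -> R).
        by have [] // := @sqint_bounded _ _ mu (cst 1) 1 _ _; move=> x; rewrite normr1.
      have sr := sqint_dual mu_gauss dr.
      have sa : sqint mu (fun x => `|residual m n x|).
        have [mr r2] := sr; split; first exact: measurableT_comp.
        have -> : (fun x => (`|residual m n x| ^+ 2)%:E) = (fun x => (residual m n x ^+ 2)%:E).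
          by apply/funext => x; rewrite real_normK ?num_real.
        exact: r2.
      have := cauchy_schwarz_sqrt sa s1.
      have -> : \int[mu]_x (cst 1 x : R) ^+ 2 = 1.
        under eq_Rintegral do rewrite expr1n; rewrite Rintegral_cst//= probability_setT mulr1//.
      rewrite sqrtr1 mulr1.
      under [X in _ <= Num.sqrt X -> _]eq_Rintegral do rewrite real_normK ?num_real//.
      apply: le_trans; apply: le_trans (ler_norm _).
      apply: le_Rintegral => //.
      - exact: (integrable_norm (integrableB measurableT i1 i2)).
      - exact: (sqint_mul sa s1).
      - move=> x _; rewrite -mulrBr normrM mulr1.
        apply: le_trans (cos_lipschitz (residual m n x) th).
        by rewrite indicE; case: (x \in E); rewrite ?normr1 ?mul1r ?normr0 ?mul0r.
    apply/cvgrPdist_le => e e0; move/cvgrPdist_le: sV => /(_ e e0).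
    apply: filterS => n; rewrite sub0r normrN ger0_norm ?sqrtr_ge0// => h.
    by rewrite distrC; apply: le_trans (bnd n) h.
  have c3 : (fun n => expR (- (\sum_(k < n) m (v k) ^+ 2) / 2) *
    \int[mu]_x (\1_E x * cos (residual m n x + th))) @ \oo -->
    expR (- variance mu m / 2) * (cos th * fine (mu E)) by exact: cvgM c1 c2.
  have c4 : (fun n => expR (- (\sum_(k < n) m (v k) ^+ 2) / 2) *
    \int[mu]_x (\1_E x * cos (residual m n x + th))) @ \oo -->
    \int[mu]_x (\1_E x * cos (m x + th)).
    by under eq_fun do rewrite -step//; exact: cvg_cst.
  exact: (cvg_unique (@Rhausdorff R) c4 c3).
pose r : {nonneg R} := NngNum (fine_ge0 (measure_ge0 mu E)).
have fr : (mrestr mu mE setT < +oo)%E.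
  by apply: le_lt_trans (prob_fin mu); rewrite /= /mrestr setTI; apply: le_measure; rewrite ?inE.
have fs : (mscale r mu setT < +oo)%E.
  by rewrite /mscale lte_mul_pinfty ?lee_fin//; exact: prob_fin.
have H := @char_unique _ _ (mrestr mu mE) (mscale r mu) Xsep fr fs _ E mE.
have {1}-> : mu E = ((fine (mu E))%:E * mu E)%E.
  have <- : mrestr mu mE E = mu E by rewrite /mrestr setIid.
  rewrite [RHS](_ : _ = mscale r mu E); last by rewrite /mscale /mrestr /= setIid.
  apply: H => m th dm; have mc := measurable_cos_dual th dm.
  have bc : exists M : R, forall x : X, `|cos (m x + th)| <= M.
    by exists 1 => x; rewrite ler_norml cos_geN1 cos_le1.
  rewrite Rintegral_mrestr//; last exact: prob_fin.
  rewrite Rintegral_mscale//; last exact: prob_fin.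
  by rewrite lim// (integral_cos_dual mu_gauss)//=; ring.
by rewrite fineM// ?fin_num_measure// expr2.
Qed.

End ergodicity.

(** * Limits of smooth functions on a line *)

Section ae_convergence.
Context d (T : measurableType d) (R : realType).

(** The norm of an [X]-valued error need not be known to be measurable; for
    nonnegative functions the definition by simple minorants is monotone anyway. *)
Lemma ge0_le_integral_nonmeas (mu : {measure set T -> \bar R}) (f g : T -> \bar R) :
  (forall x, 0 <= f x)%E -> (forall x, f x <= g x)%E ->
  (\int[mu]_x f x <= \int[mu]_x g x)%E.
Proof.
move=> f0 fg; have g0 x : (0 <= g x)%E by exact: le_trans (fg x).
rewrite !ge0_integralTE//; apply: le_ereal_sup => _ [h hf <-].
by exists h => // x; apply: le_trans (hf x) (fg x).
Qed.

(** The sum of the functions has a finite integral, and where it is finite the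
    terms tend to [0]. *)
Lemma ae_cvg0 (mu : {measure set T -> \bar R}) (g : nat -> T -> \bar R) :
  (forall k, measurable_fun setT (g k)) -> (forall k x, 0 <= g k x)%E ->
  (forall k, \int[mu]_x g k x <= (1 / (2 ^ (k + 1))%:R)%:E)%E ->
  {ae mu, forall x, g k x @[k --> \oo] --> 0%E}.
Proof.
move=> mg g0 gle; pose F x := (\sum_(k <oo) g k x)%E.
have F0 x : (0 <= F x)%E by exact: nneseries_ge0.
have mF : measurable_fun setT F by exact: ge0_emeasurable_sum.
have iF : (\int[mu]_x F x < +oo)%E.
  rewrite integral_nneseries//.
  apply: le_lt_trans (ltry (1 / 2 ^+ 0)).
  rewrite -(cvg_lim _ (@cvg_geometric_eseries_half R 1 0))//.
  by apply: lee_nneseries => // k _ _; apply: integral_ge0.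
have : mu.-integrable setT F.
  by apply/integrableP; split => //; under eq_integral do rewrite gee0_abs//.
move=> /(integrable_ae measurableT); apply: ae_imply => x /(_ I) Fx.
have gF n : (\sum_(0 <= k < n) g k x <= F x)%E by exact: nneseries_lim_ge.
have gfin k : g k x \is a fin_num.
  rewrite ge0_fin_numE//; apply: le_lt_trans (_ : F x < +oo)%E; last first.
    by rewrite -ge0_fin_numE.
  apply: le_trans (gF k.+1); rewrite big_nat_recr//= leeDr//.
  by apply: sume_ge0.
have : (fine (g k x)) @[k --> \oo] --> (0 : R).
  apply: (@cvg_series_cvg_0 R R^o); apply: nondecreasing_is_cvgn.
    by apply/nondecreasing_seqP => n; rewrite /series/= big_nat_recr//= lerDl fine_ge0.
  exists (fine (F x)) => _ [n _ <-]; rewrite /series/= -lee_fin fineK//.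
  rewrite -sumEFin; apply: le_trans (gF n); rewrite le_eqVlt; apply/orP; left; apply/eqP.
  by apply: eq_bigr => k _; rewrite fineK.
move=> h; have -> : (fun k => g k x) = (fun k => (fine (g k x))%:E).
  by apply/funext => k; rewrite fineK.
by apply: cvg_EFin => //; exact: nearW.
Qed.

(** Hoelder's inequality against the constant [1]. *)
Lemma L1_le_Lnorm (P : probability T R) (t : R) (f : T -> R) : 1 <= t ->
  measurable_fun setT f ->
  (\int[P]_x `|f x|%:E <= Lnorm P t%:E (fun x => (f x)%:E))%E.
Proof.
move=> t1 mf; have t0 : 0 < t by exact: lt_le_trans t1.
have -> : (\int[P]_x `|f x|%:E = Lnorm P 1 (fun x => (f x)%:E))%E by rewrite Lnorm1.
move: t1; rewrite le_eqVlt => /orP[/eqP <-//|t1].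
have q0 : 0 < t / (t - 1) by rewrite divr_gt0// subr_gt0.
have tq : t^-1 + (t / (t - 1))^-1 = 1.
  by field; rewrite !gt_eqF// subr_gt0.
have h := @hoelder _ _ _ P f (cst 1) t (t / (t - 1)) mf (measurable_cst _) t0 q0 tq.
have c1 : Lnorm P (t / (t - 1))%:E (fun=> 1%E) = 1%E.
  by apply: etrans (Lnorm_cst1 _ _) _; rewrite [X in (X `^ _)%E]probability_setT poweR1r.
apply: (@le_trans _ _ (Lnorm P t%:E (fun x => (f x)%:E) * Lnorm P (t / (t - 1))%:E (fun=> 1%E))%E).
  apply: le_trans h; rewrite le_eqVlt; apply/orP; left; apply/eqP.
  by congr Lnorm; apply/funext => x /=; rewrite mulr1.
by rewrite c1 mule1.
Qed.

Lemma L1_le_Lnorm_dom (P : probability T R) (t : R) (f g : T -> R) : 1 <= t ->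
  measurable_fun setT f -> (forall x, `|f x| <= g x) ->
  (\int[P]_x `|f x|%:E <= Lnorm P t%:E (fun x => (g x)%:E))%E.
Proof.
move=> t1 mf fg; have t0 : 0 < t by exact: lt_le_trans t1.
apply: le_trans (L1_le_Lnorm P t1 mf) _; rewrite unlock /Lnorm.
apply: gt0_ler_poweR; [by rewrite invr_ge0 ltW| | |].
- by rewrite in_itv/= leey andbT integral_ge0.
- by rewrite in_itv/= leey andbT integral_ge0.
apply: ge0_le_integral_nonmeas => x /=; rewrite lee_fin ?powR_ge0//.
apply: ge0_ler_powR; rewrite ?nnegrE//; first exact: ltW.
by apply: le_trans (fg x) (ler_norm _).
Qed.

End ae_convergence.

Lemma nbhs0_lt {R : realType} (e : R) : 0 < e -> nbhs (0 : \bar R)%E [set x | x < e%:E]%E.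
Proof.
move=> e0; apply: open_nbhs_nbhs; split; first exact: open_ereal_lt_ereal.
by rewrite /= lte_fin.
Qed.

Section sobolev_lines.
Context {R : realType}.
Local Notation leb := (@lebesgue_measure R).
Local Notation gam := (gauss (1 : R)).

Lemma variation_le_integral (F W : R -> R) (a b : R) : a <= b -> continuous W ->
  (forall s : R, is_derive s 1 (F : R -> R^o) (W s)) ->
  (`|F b - F a|%:E <= \int[leb]_(u in `[a, b]) `|W u|%:E)%E.
Proof.
move=> ab cW dF; move: ab; rewrite le_eqVlt => /orP[/eqP ->|ab].
  by rewrite subrr normr0; apply: integral_ge0 => x _; rewrite lee_fin.
have cF : continuous F.
  by move=> s; have := dF s => Fs; apply: differentiable_continuous; apply/derivable1_diffP.
have : (\int[leb]_(x in `[a, b]) (W x)%:E = (F b)%:E - (F a)%:E)%E.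
  apply: continuous_FTC2 => //.
  - exact: continuous_subspaceT.
  - split; last 2 first.
    + exact/cvg_at_right_filter/cF.
    + exact/cvg_at_left_filter/cF.
    by move=> x _; have := dF x => Fx.
  - by move=> x _; have := dF x => Fx; rewrite derive1E derive_val.
rewrite -[leLHS]/(`|(F b)%:E - (F a)%:E|%E) => <-; apply: le_abse_integral => //.
by apply/measurable_EFinP; apply: measurable_funTS; exact: continuous_measurable_fun.
Qed.

(** The restriction of [g] to [A] extends to a locally absolutely continuous
    function with slope at most [`|D|]. Keeping the exceptional set explicit avoids
    passing to a representative of [g]. *)
Definition controlled_by (g D : R -> R) (A : set R) :=
  (forall s s', A s -> A s' -> s <= s' ->
    (`|g s' - g s|%:E <= \int[leb]_(u in `[s, s']) `|D u|%:E)%E) /\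
  (forall N : R, (\int[leb]_(u in `[(- N)%R, N]) `|D u|%:E < +oo)%E).

(** Convergence in mean for the normal law gives convergence in mean on bounded
    intervals, hence the fundamental theorem of calculus passes to the limit. *)
Lemma controlled_limit (F W : nat -> R -> R) (g D : R -> R) :
  (forall k, continuous (W k)) ->
  (forall k (s : R), is_derive s 1 (F k : R -> R^o) (W k s)) ->
  measurable_fun setT D ->
  (\int[gam]_s `|W k s - D s|%:E @[k --> \oo] --> 0)%E ->
  controlled_by g D [set s | F k s @[k --> \oo] --> g s].
Proof.
move=> cW dF mD WD.
have mW k : measurable_fun setT (W k) by exact: continuous_measurable_fun.
have mB k : measurable_fun setT (fun u => `|W k u - D u|%:E).
  by apply/measurable_EFinP; apply: measurableT_comp => //; exact: measurable_funB.
have mWa k : measurable_fun setT (fun u => `|W k u|%:E).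
  by apply/measurable_EFinP; exact: measurableT_comp.
have mDa : measurable_fun setT (fun u => `|D u|%:E).
  by apply/measurable_EFinP; exact: measurableT_comp.
have near N e : 0 < e -> \forall k \near \oo,
    (\int[leb]_(u in `[(- N)%R, N]) `|W k u - D u|%:E <= e%:E)%E.
  move=> e0; have [C C0 Cle] := @leb_le_gauss R 1 N (oner_neq0 _).
  have eC : 0 < e / C by rewrite divr_gt0.
  have : \forall k \near \oo, (\int[gam]_s `|W k s - D s|%:E < (e / C)%:E)%E.
    exact: (WD _ (nbhs0_lt eC)).
  apply: filterS => k ke; apply: le_trans (Cle _ (mB k) _) _; first by move=> x; rewrite lee_fin.
  have -> : e%:E = (C%:E * (e / C)%:E)%E by rewrite -EFinM mulrC divfK// gt_eqF.
  by rewrite lee_pmul2l//; exact: ltW.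
split=> [s s' /= As As' ss'|N].
- pose N := Num.max `|s| `|s'|.
  have sN : `[s, s'] `<=` `[- N, N].
    move=> x; rewrite /= !in_itv/= => /andP[h1 h2]; apply/andP; split.
      by apply: le_trans h1; rewrite lerNl; apply: le_trans (ler_norm _) _; rewrite normrN le_max lexx.
    by apply: le_trans h2 _; apply: le_trans (ler_norm _) _; rewrite le_max lexx orbT.
  apply/lee_addgt0Pr => e e0; have e2 : 0 < e / 2 by rewrite divr_gt0.
  have cF : `|F k s' - F k s| @[k --> \oo] --> `|g s' - g s|.
    by apply: cvg_norm; exact: cvgB.
  have /filterI : \forall k \near \oo, `|g s' - g s| - e / 2 < `|F k s' - F k s|.
    by apply: (cvgr_gt _ cF); rewrite ltrBlDr ltrDl.
  move=> /(_ _ (near N _ e2)) /filter_ex[k [/= h1 h2]].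
  have h3 : (`|g s' - g s|%:E <= `|F k s' - F k s|%:E + (e / 2)%:E)%E.
    by rewrite -EFinD lee_fin; lra.
  apply: le_trans h3 _; rewrite [in leRHS](splitr e) EFinD addeA; apply: leeD => //.
  apply: le_trans (variation_le_integral ss' (cW k) (dF k)) _.
  apply: (@le_trans _ _ (\int[leb]_(u in `[s, s']) (`|D u|%:E + `|W k u - D u|%:E))%E).
    apply: ge0_le_integral => //.
    - by apply: measurable_funTS; exact: mWa.
    - by apply: measurable_funTS; apply: emeasurable_funD; [exact: mDa|exact: mB].
    - move=> x _; rewrite -EFinD lee_fin -[in leLHS](subrK (D x) (W k x)) addrC.
      exact: ler_normD.
  rewrite ge0_integralD//; last 2 first.
    - by apply: measurable_funTS; exact: mDa.
    - by apply: measurable_funTS; exact: mB.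
  apply: leeD => //; apply: le_trans h2; apply: ge0_subset_integral => //.
  by apply: measurable_funTS; exact: mB.
- have [k /= kN] := filter_ex (near N 1 ltr01).
  have iW : (\int[leb]_(u in `[(- N)%R, N]) `|W k u|%:E < +oo)%E.
    have : leb.-integrable `[- N, N] (EFin \o W k).
      apply: continuous_compact_integrable; first exact: segment_compact.
      exact: continuous_subspaceT.
    by move=> /integrableP[].
  apply: (@le_lt_trans _ _ (\int[leb]_(u in `[(- N)%R, N]) (`|W k u|%:E + `|W k u - D u|%:E))%E).
    apply: ge0_le_integral => //.
    - by apply: measurable_funTS; exact: mDa.
    - by apply: measurable_funTS; apply: emeasurable_funD; [exact: mWa|exact: mB].
    - move=> x _; rewrite -EFinD lee_fin -[in leLHS](subKr (W k x) (D x)).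
      exact: ler_normB.
  rewrite ge0_integralD//; last 2 first.
    - by apply: measurable_funTS; exact: mWa.
    - by apply: measurable_funTS; exact: mB.
  by apply: lte_add_pinfty => //; apply: le_lt_trans kN (ltry _).
Qed.

End sobolev_lines.

(** * Sobolev functions on almost every line *)

Section sobolev_on_lines.
Context {R : realType} {X : completeNormedModType R}.
Variable mu : probability (borelT X) R.
Hypothesis mu_gauss : centered_gaussian mu.
Hypothesis Xsep : separable_space X.
Variables (l : X -> R) (v : X).
Hypothesis dl : cont_dual l.
Hypothesis lv : forall m, cont_dual m -> m v = \int[mu]_x (l x * m x).
Hypothesis lv1 : l v = 1.
Hypothesis Hv : cameron_martin mu v.
Hypothesis v1 : normH mu v = 1.

Local Notation gam := (gauss (1 : R)).

Lemma continuous_line y : continuous (line l v y).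
Proof.
move=> s; apply: cvgD; first exact: cvg_cst.
by apply: cvgZr_tmp; apply: cvgB; [exact: cvg_id|exact: cvg_cst].
Qed.

(** Cylindrical approximations converging fast enough converge, together with
    their derivatives along [v], on almost every line: [ae_cvg0] is applied to
    the function values on [X], and to the errors of the derivatives averaged
    over each line. *)
Lemma sobolev_on_lines (t : R) (f : X -> R) (Df : X -> X) : 1 <= t ->
  sobolev_grad mu t f Df ->
  {ae mu, forall y, exists A, {ae gam, forall s, A s} /\
    controlled_by (fun s => f (line l v y s))
      (fun s => innerH mu (Df (line l v y s)) v) A}.
Proof.
move=> t1 [mf mDf [fn [sfn fcv gcv]]].
pose Dv x := innerH mu (Df x) v; have mDv : measurable_fun [set: borelT X] Dv by exact: mDf.2.
have wP n : exists w : X -> R, [/\ continuous w,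
    forall x, innerH mu (gradH mu (fn n) x) v = w x
  & forall x (t : R), is_derive t 1 (fun s => fn n (x + s *: v) : R^o) (w (x + t *: v))].
  by have [_ _ /(_ v Hv)] := smooth_cylindrical_grad mu_gauss Xsep (sfn n).
have [w {}wP] := choice wP.
have mfn n : measurable_fun [set: borelT X] (fn n).
  by apply: borel_continuous; have [] := smooth_cylindrical_grad mu_gauss Xsep (sfn n).
have mw n : measurable_fun [set: borelT X] (w n).
  by apply: borel_continuous; have [] := wP n.
have fnle n := L1_le_Lnorm mu t1 (measurable_funB (mfn n) mf).
have wnle n : (\int[mu]_x `|w n x - Dv x|%:E <=
    Lnorm mu t%:E (fun x => (normH mu (gradH mu (fn n) x - Df x))%:E))%E.
  apply: L1_le_Lnorm_dom => //; first exact: measurable_funB.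
  move=> x; have [_ Hg _] := smooth_cylindrical_grad mu_gauss Xsep (sfn n).
  have [_ <- _] := wP n; rewrite /Dv -innerHB//; last exact: mDf.1.
  rewrite -[leRHS]mulr1 -v1; apply: innerH_le => //.
  by apply: cameron_martinB => //; exact: mDf.1.
have pick k : exists n,
    (\int[mu]_x `|fn n x - f x|%:E <= (1 / (2 ^ (k + 1))%:R)%:E)%E /\
    (\int[mu]_x `|w n x - Dv x|%:E <= (1 / (2 ^ (k + 1))%:R)%:E)%E.
  have e0 : 0 < 1 / (2 ^ (k + 1))%:R :> R by rewrite divr_gt0// ltr0n expn_gt0.
  have c1 : \forall n \near \oo, (Lnorm mu t%:E (fun x => (fn n x - f x)%:E) <
      (1 / (2 ^ (k + 1))%:R)%:E)%E by exact: (fcv _ (nbhs0_lt e0)).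
  have c2 : \forall n \near \oo,
      (Lnorm mu t%:E (fun x => (normH mu (gradH mu (fn n) x - Df x))%:E) <
      (1 / (2 ^ (k + 1))%:R)%:E)%E by exact: (gcv _ (nbhs0_lt e0)).
  have [n [/= /ltW h1 /ltW h2]] := filter_ex (filterI c1 c2); exists n; split.
    exact: le_trans (fnle n) h1.
  exact: le_trans (wnle n) h2.
have [s {pick} sP] := choice pick.
have mabs (h : X -> R) : measurable_fun [set: borelT X] h ->
    measurable_fun [set: borelT X] (fun x => `|h x|%:E).
  by move=> mh; apply/measurable_EFinP; exact: measurableT_comp.
have fae : {ae mu, forall x, fn (s k) x @[k --> \oo] --> f x}.
  apply: ae_imply (@ae_cvg0 _ _ R mu (fun k x => `|fn (s k) x - f x|%:E) _ _ _).
  - move=> x /fine_cvg/= h; apply/cvgrPdist_le => e e0.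
    have /cvgrPdist_le/(_ e e0) := h; apply: filterS => k.
    by rewrite sub0r normrN normr_id distrC.
  - by move=> k; apply: mabs; exact: measurable_funB.
  - by move=> k x; rewrite lee_fin.
  - by move=> k; exact: (sP k).1.
have wae : {ae mu, forall y, (\int[gam]_u `|w (s k) (line l v y u) - Dv (line l v y u)|%:E)%E
    @[k --> \oo] --> 0%E}.
  apply: (@ae_cvg0 _ _ R mu
    (fun k y => \int[gam]_u `|w (s k) (line l v y u) - Dv (line l v y u)|%:E)%E).
  - move=> k; apply: (measurable_gauss_line Xsep v dl (F := fun x => `|w (s k) x - Dv x|%:E)) => //.
    by apply: mabs; exact: measurable_funB.
  - by move=> k x; apply: integral_ge0 => u _; rewrite lee_fin.
  - move=> k; rewrite -(ge0_integral_line mu_gauss Xsep dl lv lv1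
      (F := fun x => `|w (s k) x - Dv x|%:E)) => //; first exact: (sP k).2.
    by apply: mabs; exact: measurable_funB.
have {fae} := ae_and (ae_line mu_gauss Xsep dl lv lv1 fae) wae.
apply: ae_imply => y [fy wy]; exists [set u | fn (s k) (line l v y u) @[k --> \oo] --> f (line l v y u)].
split=> //; apply: (controlled_limit (W := fun k u => w (s k) (line l v y u))) => //.
- move=> k u; apply: (@continuous_comp _ _ _ (line l v y) (w (s k))).
    exact: continuous_line.
  by have [cw _ _] := wP (s k); exact: cw.
- move=> k u; have [_ _ /(_ (y - l y *: v) u)] := wP (s k).
  have E z : y - l y *: v + z *: v = line l v y z by rewrite /line scalerBl addrA addrAC.
  by rewrite E; under eq_fun do rewrite E.
- exact: (measurableT_comp mDv (measurable_line_point Xsep v dl y)).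
Qed.

End sobolev_on_lines.

(** * Crossing a level on a line *)

Section crossing.
Context {R : realType}.
Local Notation leb := (@lebesgue_measure R).
Local Notation gam := (gauss (1 : R)).

(** The interval ends at the infimum of the points of [A] where [h <= 0]: left of
    it [h] is positive, and the Lipschitz bound gives its length. *)
Lemma crossing_lt (A : set R) (h : R -> R) (M a b e : R) : 0 < M -> 0 < e -> a < b ->
  A a -> A b -> e <= h a -> h b <= 0 ->
  (forall s s', A s -> A s' -> a <= s <= b -> a <= s' <= b -> `|h s - h s'| <= M * `|s - s'|) ->
  exists c d, [/\ a <= c, d <= b, d - c = e / M &
    forall s, A s -> c < s < d -> 0 < h s <= e].
Proof.
move=> M0 e0 ab Aa Ab ha hb lip.
pose S := [set s | [/\ A s, a <= s <= b & h s <= 0]].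
have Sb : S b by split => //; rewrite lexx ltW.
have lbS : lbound S a by move=> s [_ /andP[]].
have hS : has_inf S by split; [exists b|exists a].
have far s s' : A s -> a <= s <= b -> S s' -> h s <= M * `|s - s'|.
  move=> As sab [As' s'ab hs']; have := lip _ _ As As' sab s'ab.
  by move=> /(le_trans (ler_norm _)); lra.
have eM : 0 < e / M by rewrite divr_gt0.
exists (inf S - e / M), (inf S); split.
- rewrite lerBrDr; apply: lb_le_inf; first by exists b.
  move=> s Ss; have [_ /andP[as_ _] _] := Ss.
  have := far a s Aa _ Ss; rewrite lexx (ltW ab) => /(_ isT).
  rewrite distrC ger0_norm ?subr_ge0// => h1.
  by rewrite -lerBrDl ler_pdivrMr// mulrC; exact: le_trans h1.
- exact: (ge_inf hS.2 Sb).
- by rewrite opprB addrC subrK.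
- move=> s As /andP[cs sd].
  have as_ : a <= s.
    apply: le_trans (ltW cs); rewrite lerBrDr; apply: lb_le_inf; first by exists b.
    move=> s' Ss; have [_ /andP[as' _] _] := Ss.
    have := far a s' Aa _ Ss; rewrite lexx (ltW ab) => /(_ isT).
    rewrite distrC ger0_norm ?subr_ge0// => h1.
    by rewrite -lerBrDl ler_pdivrMr// mulrC; exact: le_trans h1.
  have sb : s <= b by apply: le_trans (ltW sd) _; exact: (ge_inf hS.2 Sb).
  apply/andP; split.
    rewrite ltNge; apply/negP => hs; move: sd; rewrite ltNge => /negP; apply.
    by apply: (ge_inf hS.2); split => //; rewrite as_.
  have : (h s / M + s) <= inf S.
    apply: lb_le_inf; first by exists b.
    move=> s' Ss; have := far s s' As _ Ss; rewrite as_ sb => /(_ isT) h1.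
    have ss' : s <= s' by apply: le_trans (ltW sd) _; exact: (ge_inf hS.2 Ss).
    move: h1; rewrite distrC ger0_norm ?subr_ge0// mulrC -ler_pdivrMr//; lra.
  move=> h1; have : h s / M <= e / M by lra.
  by rewrite ler_pM2r// invr_gt0.
Qed.

(** A Lipschitz function needs room to climb from [0] to [e]. *)
Lemma crossing (A : set R) (h : R -> R) (M N a b e : R) : 0 < M -> 0 < e ->
  A a -> A b -> `|a| <= N -> `|b| <= N -> e <= h a -> h b <= 0 ->
  (forall s s', A s -> A s' -> `|s| <= N -> `|s'| <= N -> `|h s - h s'| <= M * `|s - s'|) ->
  exists c d, [/\ - N <= c, d <= N, d - c = e / M &
    forall s, A s -> c < s < d -> 0 < h s <= e].
Proof.
move=> M0 e0 Aa Ab; rewrite !ler_norml => /andP[aN1 aN2] /andP[bN1 bN2] ha hb lip.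
have [ab|ba|ab] := ltgtP a b; last by move: ha; rewrite ab; lra.
  have [|c [d [ac db dc H]]] := @crossing_lt A h M a b e M0 e0 ab Aa Ab ha hb.
    by move=> s s' As As' /andP[? ?] /andP[? ?]; apply: lip => //; rewrite ler_norml; lra.
  by exists c, d; split => //; lra.
(* the other orientation follows by reflection *)
pose A' := [set s | A (- s)]; pose h' s := h (- s).
have A'a : A' (- a) by rewrite /A' /= opprK.
have A'b : A' (- b) by rewrite /A' /= opprK.
have ab : - a < - b by rewrite ltrN2.
have ha' : e <= h' (- a) by rewrite /h' opprK.
have hb' : h' (- b) <= 0 by rewrite /h' opprK.
have lip' s s' : A' s -> A' s' -> - a <= s <= - b -> - a <= s' <= - b ->
    `|h' s - h' s'| <= M * `|s - s'|.
  move=> As As' /andP[? ?] /andP[? ?].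
  have -> : `|s - s'| = `|- s - - s'| by rewrite distrC; congr `|_|; ring.
  by apply: lip => //; rewrite ler_norml; lra.
have [c [d [ac db dc H]]] := crossing_lt M0 e0 ab A'a A'b ha' hb' lip'.
exists (- d), (- c); split; [lra|lra|lra|].
move=> s As /andP[h1 h2]; have := H (- s); rewrite /A' /h' /= opprK; apply => //.
by apply/andP; split; lra.
Qed.

Lemma ae_gauss_leb (P : R -> Prop) (N : R) : {ae gam, forall s, P s} ->
  {ae leb, forall s, `|s| <= N -> P s}.
Proof.
move=> [Z [mZ Z0 PZ]]; exists (`[- N, N] `&` Z); split.
- by apply: measurableI => //; exact: measurable_itv.
- apply/eqP; rewrite -measure_le0.
  have [C C0 /(_ (EFin \o \1_Z))] := @leb_le_gauss R 1 N (oner_neq0 _).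
  have -> : (\int[gam]_x (EFin \o \1_Z) x = 0)%E by rewrite integral_indic// setIT.
  rewrite integral_indic//.
  rewrite mule0 setIC; apply.
    by apply/measurable_EFinP; exact: measurable_indic.
  by move=> x; rewrite lee_fin.
- move=> s /= /not_implyP[sN nP]; split; last exact: PZ.
  by rewrite /= in_itv/= -ler_norml.
Qed.

Lemma controlled_lipschitz (g D : R -> R) (A : set R) (N M : R) : 0 <= M ->
  measurable_fun setT D -> controlled_by g D A ->
  {ae gam, forall s, `|s| <= N -> `|D s| <= M} ->
  forall s s', A s -> A s' -> `|s| <= N -> `|s'| <= N -> `|g s - g s'| <= M * `|s - s'|.
Proof.
move=> M0 mD [gD _] DM.
have le s s' : A s -> A s' -> `|s| <= N -> `|s'| <= N -> s <= s' ->
    `|g s' - g s| <= M * `|s' - s|.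
  move=> As As' sN s'N ss'; rewrite -lee_fin; apply: le_trans (gD _ _ As As' ss') _.
  apply: (@le_trans _ _ (\int[leb]_(u in `[s, s']) M%:E)%E).
    apply: ae_ge0_le_integral => //.
    - apply: measurable_funTS; apply/measurable_EFinP.
      by apply: measurableT_comp => //; exact: mD.
    - apply: (ae_imply _ (ae_gauss_leb N DM)) => u; rewrite /= in_itv/= => Du /andP[su us].
      have uN : `|u| <= N by move: sN s'N; rewrite !ler_norml; lra.
      by rewrite lee_fin; exact: Du.
  rewrite integral_cst//= lebesgue_measure_itv/= lte_fin.
  case: ifPn => [_|]; last by rewrite mule0 lee_fin mulr_ge0.
  by rewrite -EFinB -EFinM lee_fin ger0_norm// subr_ge0.
move=> s s' As As' sN s'N; have [ss'|/ltW s's] := leP s s'; last exact: le.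
by rewrite distrC (distrC s); exact: le.
Qed.

(** If [g] took values on both sides of [r], then by [crossing] the band of width
    [1 / n] below [r] would have normal measure at least a constant times
    [1 / n]. *)
Lemma constant_side (g D : R -> R) (A : set R) (r : R) (n : nat -> nat) :
  measurable_fun setT g -> measurable_fun setT D ->
  {ae gam, forall s, A s} -> controlled_by g D A ->
  (forall N, exists M, {ae gam, forall s, `|s| <= N -> `|D s| <= M}) ->
  (forall k, (k < n k)%N) ->
  ((n k)%:R%:E * gam [set s | (r - (n k)%:R^-1 <= g s < r)%R] @[k --> \oo] --> 0)%E ->
  {ae gam, forall s, g s < r} \/ {ae gam, forall s, ~ g s < r}.
Proof.
move=> mg mD Aae gD Dbnd nk ncvg; apply: contrapT => /not_orP[n1 n2].
have [b [Ab rb]] : exists b, A b /\ r <= g b.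
  apply: contrapT => /forallNP H; apply: n1; apply: ae_imply Aae => s As.
  by rewrite ltNge; apply/negP => rs; apply: (H s).
have [a [Aa ar]] : exists a, A a /\ g a < r.
  apply: contrapT => /forallNP H; apply: n2; apply: ae_imply Aae => s As gs.
  exact: (H s).
pose N := Num.max `|a| `|b|.
have aN : `|a| <= N by rewrite le_max lexx.
have bN : `|b| <= N by rewrite le_max lexx orbT.
have [M0 DM0] := Dbnd N; pose M := Num.max 1 M0.
have M1 : 0 < M by rewrite lt_max ltr01.
have DM : {ae gam, forall s, `|s| <= N -> `|D s| <= M}.
  by apply: ae_imply DM0 => s H sN; rewrite le_max H ?orbT.
have lip := controlled_lipschitz (ltW M1) mD gD DM.
have [C C0 Cle] := @leb_le_gauss R 1 N (oner_neq0 _).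
have [Z [mZ Z0 AZ]] := Aae.
pose S k := [set s | r - (n k)%:R^-1 <= g s < r].
have mS k : measurable (S k).
  rewrite (_ : S k = setT `&` g @^-1` `[r - (n k)%:R^-1, r[).
    by apply: mg => //; exact: measurable_itv.
  by rewrite setTI; apply/seteqP; split => s; rewrite /S /= in_itv.
have low k : (n k)%:R^-1 <= r - g a -> ((C * M)^-1%:E <= (n k)%:R%:E * gam (S k))%E.
  move=> ek; have nk0 : 0 < (n k)%:R :> R by rewrite ltr0n (leq_ltn_trans _ (nk k)).
  have ek0 : 0 < (n k)%:R^-1 :> R by rewrite invr_gt0.
  have [||c [d [Nc dN dc H]]] := @crossing A (fun s => r - g s) M N a b _ M1 ek0 Aa Ab aN bN ek.
  - by rewrite subr_le0.
  - move=> s s' As As' sN s'N; rewrite (_ : _ - _ = g s' - g s); last by ring.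
    by rewrite distrC; exact: lip.
  have cd : c < d by rewrite -subr_gt0 dc divr_gt0.
  have mI : measurable (`]c, d[ : set R) by exact: measurable_itv.
  have h1 : ((d - c)%:E <= C%:E * gam `]c, d[%classic)%E.
    have sub : `]c, d[%classic `<=` (`[- N, N]%classic : set R).
      by move=> s; rewrite /= !in_itv/= => /andP[s1 s2]; apply/andP; split; lra.
    have El : (\int[leb]_(x in `[(- N)%R, N]) (EFin \o \1_(`]c, d[ : set R)) x = (d - c)%:E)%E.
      rewrite integral_indic// (setIidl sub).
      by apply: etrans (lebesgue_measure_itv _) _; rewrite /= lte_fin cd -EFinB.
    have Eg : (\int[gam]_x (EFin \o \1_(`]c, d[ : set R)) x = gam `]c, d[%classic)%E.
      by rewrite integral_indic// setIT.
    rewrite -El -Eg; apply: (Cle); last by move=> x; rewrite lee_fin.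
    by apply/measurable_EFinP; exact: measurable_indic.
  have h2 : (gam `]c, d[%classic <= gam (S k))%E.
    have -> : gam (S k) = gam (S k `|` Z) by rewrite measureU0.
    apply: le_measure; rewrite ?inE//; first exact: measurableU.
    move=> s; rewrite /= in_itv/= => scd.
    have [As|nA] := pselect (A s); last by right; exact: AZ.
    left; have /andP[h1' h2'] := H s As scd; rewrite /S /=; apply/andP; split; lra.
  have h3 : ((d - c)%:E <= C%:E * gam (S k))%E.
    by apply: le_trans h1 _; apply: lee_wpmul2l => //; rewrite lee_fin ltW.
  have -> : (C * M)^-1 = (n k)%:R / C * (d - c).
    by rewrite dc; field; rewrite !gt_eqF.
  have -> : ((n k)%:R%:E * gam (S k) = ((n k)%:R / C)%:E * (C%:E * gam (S k)))%E.
    by rewrite muleA -EFinM divfK// gt_eqF.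
  by rewrite EFinM; apply: lee_wpmul2l => //; rewrite lee_fin divr_ge0// ltW.
have CM : 0 < (C * M)^-1 by rewrite invr_gt0 mulr_gt0.
have ga : 0 < r - g a by rewrite subr_gt0.
have near1 : \forall k \near \oo, ((n k)%:R%:E * gam (S k) < (C * M)^-1%:E)%E.
  exact: (ncvg _ (nbhs0_lt CM)).
have near2 : \forall k \near \oo, (n k)%:R^-1 <= r - g a.
  have [m _ Hm] := cvgr_lt _ (@cvg_harmonic R) _ ga.
  exists m => // k mk; apply: le_trans (ltW (Hm k mk)).
  by rewrite /harmonic lef_pV2 ?posrE ?ltr0n// ?ler_nat ?nk// (leq_ltn_trans _ (nk k)).
have [k [/= k1 k2]] := filter_ex (filterI near1 near2).
by have := lt_le_trans k1 (low k k2); rewrite ltxx.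
Qed.

End crossing.

(** * The distribution function *)

Section distribution_function.
Context {R : realType} {X : completeNormedModType R}.
Variable mu : probability (borelT X) R.
Variable G : X -> R.
Hypothesis mG : measurable_fun [set: borelT X] G.
Local Notation F := (sublevel_mass mu G).

Lemma derive_sequence (f : R -> R) (r q : R) (t : nat -> R) :
  is_derive r 1 (f : R -> R^o) q -> (forall n, t n != 0) ->
  t n @[n --> \oo] --> 0 -> (f (r + t n) - f r) / t n @[n --> \oo] --> q.
Proof.
move=> [df <-] t0 tcvg.
have c : h^-1 *: (f (h *: (1 : R) + r) - f r : R^o) @[h --> 0^'] --> 'D_1 (f : R -> R^o) r by exact: df.
have /cvgr_dnbhsP/(_ t) := c.
move=> /(_ (conj t0 tcvg)) {}c.
rewrite (_ : (fun n => _ / _) = fun n => (t n)^-1 *: (f (t n *: (1 : R) + r) - f r : R^o)) //.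
apply/funext => n; rewrite -[RHS]/((t n)^-1 * (f (t n * 1 + r) - f r)).
by rewrite mulr1 mulrC [t n + r]addrC.
Qed.

Lemma measurable_sublevel r : measurable ([set x | G x < r] : set (borelT X)).
Proof.
rewrite (_ : [set x | G x < r] = setT `&` G @^-1` `]-oo, r[).
  by apply: mG => //; exact: measurable_itv.
by rewrite setTI; apply/seteqP; split => s; rewrite /= in_itv.
Qed.

Lemma sublevel_massE r : mu [set x | G x < r] = (F r)%:E.
Proof.
by rewrite /sublevel_mass fineK// fin_num_measure//; exact: measurable_sublevel.
Qed.

Lemma sublevel_mass_mono r s : r <= s -> F r <= F s.
Proof.
move=> rs; rewrite -lee_fin -!sublevel_massE; apply: le_measure.
- by rewrite inE; exact: measurable_sublevel.
- by rewrite inE; exact: measurable_sublevel.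
- by move=> x /= xr; exact: lt_le_trans rs.
Qed.

Lemma sublevel_mass_ge0 r : 0 <= F r.
Proof. by rewrite -lee_fin -sublevel_massE measure_ge0. Qed.

Lemma sublevel_mass_le1 r : F r <= 1.
Proof.
by rewrite -lee_fin -sublevel_massE; apply: probability_le1; exact: measurable_sublevel.
Qed.

Lemma mass_band r s : s <= r -> mu [set x | s <= G x < r] = (F r - F s)%:E.
Proof.
move=> sr; have ms := measurable_sublevel s; have mr := measurable_sublevel r.
have -> : [set x | s <= G x < r] = [set x | G x < r] `\` [set x | G x < s].
  apply/seteqP; split => x /=.
    by move=> /andP[sx xr]; split => //; apply/negP; rewrite -leNgt.
  by move=> [xr /negP]; rewrite -leNgt => sx; rewrite sx.
rewrite measureD//; last first.
  by apply: le_lt_trans (ltry 1); exact: probability_le1.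
rewrite (setIidr (B := [set x | G x < s])); last by move=> x /= xs; exact: lt_le_trans sr.
rewrite EFinB -!sublevel_massE.
by [].
Qed.

Lemma ae_ge_mass0 r : {ae mu, forall x, r <= G x} <-> F r = 0.
Proof.
have mr := measurable_sublevel r; split=> [[Z [mZ Z0 HZ]]|F0].
  suff : mu [set x | G x < r] = 0%E by rewrite sublevel_massE => -[].
  apply/eqP; rewrite -measure_le0 -Z0; apply: le_measure; rewrite ?inE//.
  by move=> x /= xr; apply: HZ => /=; apply/negP; rewrite -ltNge.
exists [set x | G x < r]; split => //; first by rewrite sublevel_massE F0.
by move=> x /= /negP; rewrite -ltNge.
Qed.

Lemma ae_lt_mass1 r : {ae mu, forall x, G x < r} <-> F r = 1.
Proof.
have mr := measurable_sublevel r.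
have E : mu (~` [set x | G x < r]) = (1 - F r)%:E.
  by rewrite probability_setC// sublevel_massE EFinB.
split=> [[Z [mZ Z0 HZ]]|F1].
  suff : mu (~` [set x | G x < r]) = 0%E.
    by rewrite E => -[]/eqP; rewrite subr_eq0 => /eqP.
  apply/eqP; rewrite -measure_le0 -Z0; apply: le_measure; rewrite ?inE//.
  exact: measurableC.
exists (~` [set x | G x < r]); split => //; first exact: measurableC.
by rewrite E F1 subrr.
Qed.

Lemma ess_inf_lt r : (ess_inf mu (fun x => (G x)%:E) < r%:E)%E <-> 0 < F r.
Proof.
rewrite ltNge lt_neqAle sublevel_mass_ge0 andbT eq_sym; split.
  apply: contraNneq => F0; apply/ess_infP.
  by apply: ae_imply (iffRL (ae_ge_mass0 r) F0) => x; rewrite lee_fin.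
apply: contra_neqN => /ess_infP H; apply/ae_ge_mass0.
by apply: ae_imply H => x; rewrite lee_fin.
Qed.

Lemma lt_ess_sup r : (r%:E < ess_sup mu (fun x => (G x)%:E))%E ->  F r < 1.
Proof.
rewrite ltNge lt_neqAle sublevel_mass_le1 andbT.
apply: contraNneq => F1; apply/ess_supP.
by apply: ae_imply (iffRL (ae_lt_mass1 r) F1) => x xr; rewrite lee_fin ltW.
Qed.

Lemma ess_sup_le r : (ess_sup mu (fun x => (G x)%:E) <= r%:E)%E ->
  forall s, r < s -> F s = 1.
Proof.
move=> /ess_supP H s rs; apply/ae_lt_mass1; apply: ae_imply H => x.
by rewrite lee_fin => xr; exact: le_lt_trans rs.
Qed.

Let inv_neq0 (n : nat) : n.+1%:R^-1 != 0 :> R.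
Proof. by rewrite invr_neq0. Qed.

Let inv_cvg : n.+1%:R^-1 @[n --> \oo] --> (0 : R).
Proof. exact: cvg_harmonic. Qed.

Lemma density_left (r q : R) : is_derive r 1 (F : R -> R^o) q ->
  n.+1%:R * (F r - F (r - n.+1%:R^-1)) @[n --> \oo] --> q.
Proof.
move=> dF; have := @derive_sequence F r q (fun n => - n.+1%:R^-1) dF.
rewrite (_ : (fun n => _ / _) = (fun n => n.+1%:R * (F r - F (r - n.+1%:R^-1)))).
  apply; first by move=> n; rewrite oppr_eq0.
  by rewrite -oppr0; exact: cvgN.
apply/funext => n; set a := F r; set b := F _.
by field.
Qed.

Variable q1 : R -> R.
Hypothesis q1_deriv : forall r : R, is_derive r 1 (F : R -> R^o) (q1 r).

Lemma density_ge0 r : 0 <= q1 r.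
Proof.
apply: (cvgr_to_ge (density_left (q1_deriv r))); apply: nearW => n.
by rewrite mulr_ge0// subr_ge0 sublevel_mass_mono// gerBl.
Qed.

(** At a level outside the essential range the distribution function is
    constant on one side, so that a one-sided difference quotient vanishes. *)
Lemma density_gt0_inside r : 0 < q1 r ->
  (ess_inf mu (fun x => (G x)%:E) < r%:E)%E /\
  (r%:E < ess_sup mu (fun x => (G x)%:E))%E.
Proof.
move=> q0; split.
  apply/ess_inf_lt; rewrite lt_neqAle sublevel_mass_ge0 andbT eq_sym.
  apply/negP => /eqP F0; have : q1 r = 0.
    apply: (cvg_unique (@Rhausdorff R) (density_left (q1_deriv r))).
    rewrite (_ : (fun n => _) = (fun=> 0)); first exact: cvg_cst.
    apply/funext => n; suff -> : F (r - n.+1%:R^-1) = 0 by rewrite F0 subrr mulr0.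
    apply/eqP; rewrite eq_le sublevel_mass_ge0 andbT -F0.
    by rewrite sublevel_mass_mono// gerBl.
  by move: q0 => /gt_eqF/eqP.
rewrite ltNge; apply/negP => H.
have Fs n : F (r + n.+1%:R^-1) = 1 by apply: (ess_sup_le H); rewrite ltrDl.
have c := derive_sequence (q1_deriv r) inv_neq0 inv_cvg.
have c' : (1 - F r) / n.+1%:R^-1 @[n --> \oo] --> q1 r.
  by apply: cvg_trans c; apply: near_eq_cvg; apply: nearW => n; rewrite Fs.
(* a jump at [r] would make the right difference quotients unbounded *)
have F1 : 1 - F r = 0.
  have c1 : (fun=> 1 - F r) @ \oo --> 1 - F r by exact: cvg_cst.
  have c0 : (fun n : nat => (1 - F r) / n.+1%:R^-1 * n.+1%:R^-1) @ \oo --> q1 r * 0.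
    exact: cvgM c' inv_cvg.
  move: c0; rewrite mulr0 (_ : (fun n => _) = fun=> 1 - F r) => [c0|].
    exact: (cvg_unique (@Rhausdorff R) c1 c0).
  by apply/funext => n; rewrite divfK.
have c0 : (fun n : nat => (1 - F r) / n.+1%:R^-1) @ \oo --> 0.
  by rewrite F1; under eq_fun do rewrite mul0r; exact: cvg_cst.
by move: q0 => /gt_eqF/eqP; apply; exact: (cvg_unique (@Rhausdorff R) c' c0).
Qed.

End distribution_function.

(** * Sublevel sets at a zero of the density *)

Section level_sets.
Context {R : realType} {X : completeNormedModType R}.
Variable mu : probability (borelT X) R.
Hypothesis mu_gauss : centered_gaussian mu.
Hypothesis Xsep : separable_space X.
Variables (l : X -> R) (v : X).
Hypothesis dl : cont_dual l.
Hypothesis lv : forall m, cont_dual m -> m v = \int[mu]_x (l x * m x).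
Hypothesis lv1 : l v = 1.
Hypothesis Hv : cameron_martin mu v.
Hypothesis v1 : normH mu v = 1.
Variable G : X -> R.
Hypothesis mG : measurable_fun [set: borelT X] G.
Local Notation gam := (gauss (1 : R)).

(** A vanishing derivative makes the mass of the band of width [1 / n] below [r]
    negligible with respect to [1 / n]; the rate [1 / 2 ^ (k + 1)] is the one
    that [ae_cvg0] asks for. *)
Lemma mass_band_subsequence (r q : R) : is_derive r 1 (sublevel_mass mu G : R -> R^o) q ->
  q = 0 -> exists n : nat -> nat, (forall k, (k < n k)%N) /\
  forall k, ((n k)%:R%:E * mu [set x | (r - (n k)%:R^-1 <= G x < r)%R] <=
    (1 / (2 ^ (k + 1))%:R)%:E)%E.
Proof.
move=> dF q0; have c := density_left dF; rewrite q0 in c.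
have pick k : exists n, (k < n)%N /\
    n%:R * (sublevel_mass mu G r - sublevel_mass mu G (r - n%:R^-1)) <= 1 / (2 ^ (k + 1))%:R.
  have e0 : 0 < 1 / (2 ^ (k + 1))%:R :> R by rewrite divr_gt0// ltr0n expn_gt0.
  have [m _ Hm] := cvgr_lt _ c _ e0; exists (maxn m k).+1; split.
    by rewrite ltnS leq_maxr.
  exact: ltW (Hm _ (leq_maxl _ _)).
have [n nP] := choice pick; exists n; split=> k; first exact: (nP k).1.
by rewrite mass_band// ?gerBl ?invr_ge0// -EFinM lee_fin; exact: (nP k).2.
Qed.

Lemma band_on_lines (r : R) (n : nat -> nat) :
  (forall k, ((n k)%:R%:E * mu [set x | (r - (n k)%:R^-1 <= G x < r)%R] <=
    (1 / (2 ^ (k + 1))%:R)%:E)%E) ->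
  {ae mu, forall y, ((n k)%:R%:E *
    gam [set s | (r - (n k)%:R^-1 <= G (line l v y s) < r)%R])%E @[k --> \oo] --> 0%E}.
Proof.
move=> nP; pose B k : set (borelT X) := [set x | r - (n k)%:R^-1 <= G x < r].
have mB k : measurable (B k).
  rewrite (_ : B k = setT `&` G @^-1` `[r - (n k)%:R^-1, r[).
    by apply: mG => //; exact: measurable_itv.
  by rewrite setTI; apply/seteqP; split => s; rewrite /B /= in_itv.
have mI k : measurable_fun [set: borelT X] (EFin \o \1_(B k) : borelT X -> \bar R).
  by apply/measurable_EFinP; exact: measurable_indic.
have I0 k x : (0 <= (EFin \o \1_(B k) : X -> \bar R) x)%E by rewrite lee_fin.
have mline k y : measurable ([set s | B k (line l v y s)] : set R).
  by rewrite -[X in measurable X]setTI; exact: (measurable_line_point Xsep v dl y).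
have gE k y : (gam [set s | B k (line l v y s)] = \int[gam]_s (EFin \o \1_(B k)) (line l v y s))%E.
  rewrite (_ : (fun s => _) = EFin \o \1_([set s | B k (line l v y s)] : set R))//.
  by rewrite integral_indic// setIT.
apply: (@ae_cvg0 _ _ R mu (fun k y => (n k)%:R%:E * gam [set s | B k (line l v y s)])%E).
- move=> k; apply: measurable_funeM; under eq_fun do rewrite gE.
  exact: (measurable_gauss_line Xsep v dl (mI k) (I0 k)).
- by move=> k y; rewrite mule_ge0// lee_fin.
- move=> k; under eq_integral do rewrite gE.
  rewrite ge0_integralZl//.
  + rewrite -(ge0_integral_line mu_gauss Xsep dl lv lv1 (mI k) (I0 k)).
    by rewrite integral_indic// setIT; exact: nP.
  + exact: (measurable_gauss_line Xsep v dl (mI k) (I0 k)).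
  + by move=> y _; apply: integral_ge0.
Qed.

(** A Sobolev function is controlled on the line by its slope, which is
    integrable on bounded intervals, hence it differs there from its value at
    one point [s0] by at most the integral of the slope. *)
Lemma slope_bounded_on_lines (t : R) (f : X -> R) : 1 <= t ->
  sobolev mu t f \/ (exists2 g, BUC g & {ae mu, forall x, f x = g x}) ->
  {ae mu, forall y, forall N, exists M,
    {ae gam, forall s, `|s| <= N -> `|f (line l v y s)| <= M}}.
Proof.
move=> t1 [[Df sf]|[g [[M gM] _] fg]]; last first.
  have H : {ae mu, forall x, `|f x| <= M} by apply: ae_imply fg => x ->.
  apply: ae_imply (ae_line mu_gauss Xsep dl lv lv1 H) => y Hy N; exists M.
  by apply: ae_imply Hy.
have := sobolev_on_lines mu_gauss Xsep dl lv lv1 Hv v1 t1 sf.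
apply: ae_imply => y [A [Aae [ctrl fin]]] N.
set h := fun s => f (line l v y s); set D := fun s => innerH mu (Df (line l v y s)) v in ctrl fin.
have [[s0 [As0 s0N]]|noA] := pselect (exists s0, A s0 /\ `|s0| <= N); last first.
  exists 0; apply: ae_imply Aae => s As sN; exfalso; apply: noA; by exists s.
set I := (\int[@lebesgue_measure R]_(u in `[(- N)%R, N]) `|D u|%:E)%E.
have mD : measurable_fun setT D.
  have [_ [_ mDf] _] := sf.
  exact: (measurableT_comp (mDf v Hv) (measurable_line_point Xsep v dl y)).
have If : I \is a fin_num.
  by rewrite ge0_fin_numE; [exact: fin|apply: integral_ge0 => u _; rewrite lee_fin].
have sub s s' : `|s| <= N -> `|s'| <= N ->
    (\int[@lebesgue_measure R]_(u in `[s, s']) `|D u|%:E <= I)%E.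
  rewrite !ler_norml => /andP[? ?] /andP[? ?].
  apply: ge0_subset_integral => //.
    apply: measurable_funTS; apply/measurable_EFinP.
    by apply: measurableT_comp => //; exact: mD.
  by move=> u; rewrite /= !in_itv/= => /andP[? ?]; apply/andP; split; lra.
exists (`|h s0| + fine I); apply: ae_imply Aae => s As sN.
have : `|h s - h s0| <= fine I.
  rewrite -lee_fin fineK//; have [ss0|/ltW s0s] := leP s s0.
    by rewrite distrC; apply: le_trans (ctrl _ _ As As0 ss0) (sub _ _ sN s0N).
  exact: le_trans (ctrl _ _ As0 As s0s) (sub _ _ s0N sN).
rewrite -[`|f _|]/`|h s| => h1; have := ler_normD (h s0) (h s - h s0).
by rewrite addrC subrK; lra.
Qed.

(** On almost every line [G] is locally Lipschitz off a null set, and too little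
    of the line lies in the bands below [r] for [G] to cross this level. *)
Lemma sublevel_constant_on_lines (p t r q : R) (DG : X -> X) : 1 <= p -> 1 <= t ->
  sobolev_grad mu p G DG ->
  sobolev mu t (fun x => innerH mu (DG x) v) \/
    (exists2 g, BUC g & {ae mu, forall x, innerH mu (DG x) v = g x}) ->
  is_derive r 1 (sublevel_mass mu G : R -> R^o) q -> q = 0 ->
  {ae mu, forall y, {ae gam, forall s, [set x | G x < r] (line l v y s)} \/
                    {ae gam, forall s, ~ [set x | G x < r] (line l v y s)}}.
Proof.
move=> p1 t1 sG sDG dF q0.
have [n [nk nP]] := mass_band_subsequence dF q0.
have := ae_and (sobolev_on_lines mu_gauss Xsep dl lv lv1 Hv v1 p1 sG)
  (ae_and (slope_bounded_on_lines t1 sDG) (band_on_lines nP)).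
apply: ae_imply => y [[A [Aae ctrl]] [bnd band]].
have [_ [_ mDG] _] := sG.
apply: (constant_side _ _ Aae ctrl bnd nk band).
- exact: (measurableT_comp mG (measurable_line_point Xsep v dl y)).
- exact: (measurableT_comp (mDG v Hv) (measurable_line_point Xsep v dl y)).
Qed.

End level_sets.

Theorem lemma3p9 (R : realType) (X : completeNormedModType R)
    (Xsep : separable_space X)
    (mu : probability (borelT X) R)
    (mu_gauss : centered_gaussian mu) (mu_nondeg : nondegenerate_measure mu)
    (v : nat -> X) (v_onb : orthonormal_basisH mu v)
    (v_range : forall k, (covariance_op mu @` cont_dual) (v k))
    (p : R) (p_gt1 : 1 < p)
    (G : X -> R) (DG : X -> X)
    (G_sobolev : sobolev_grad mu p G DG)
    (G_qc : quasicontinuous mu p G)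
    (DG_neq0 : {ae mu, forall x, DG x != 0})
    (DG_sobolev :
      sobolevH mu v p (fun x => ((normH mu (DG x)) ^+ 2)^-1 *: DG x))
    (q1 : R -> R)
    (q1_deriv : forall r : R,
      is_derive r 1 (sublevel_mass mu G : R -> R^o) (q1 r))
    (q1_cont : continuous q1)
    (DkG : forall k : nat,
      sobolev mu (p / (p - 1)) (fun x => innerH mu (DG x) (v k)) \/
      (exists2 g, BUC g & {ae mu, forall x, innerH mu (DG x) (v k) = g x})) :
  [set r : R | 0 < q1 r] =
  [set r : R | (ess_inf mu (fun x => (G x)%:E) < r%:E)%E /\
               (r%:E < ess_sup mu (fun x => (G x)%:E))%E].
Proof.
have mG : measurable_fun [set: borelT X] G by have [] := G_sobolev.
apply/seteqP; split=> r /=; first exact: (density_gt0_inside mG q1_deriv).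
move=> [/(ess_inf_lt mu mG) F0 /(lt_ess_sup mG) F1].
rewrite lt_neqAle (density_ge0 mG q1_deriv) andbT; apply/negP => /eqP/esym q0.
have /choice[l lP] : forall k, exists l, cont_dual l /\ covariance_op mu l = v k.
  by move=> k; have [l dl lv] := v_range k; exists l.
have dl k : cont_dual (l k) by exact: (lP k).1.
have lv k : covariance_op mu (l k) = v k by exact: (lP k).2.
have [Hv orth _] := v_onb.
have t1 : 1 <= p / (p - 1).
  by rewrite ler_pdivlMr ?subr_gt0// mul1r gerBl.
have : fine (mu [set x | G x < r]) = fine (mu [set x | G x < r]) ^+ 2.
  apply: (zero_one_law mu_gauss Xsep v_onb dl lv); first exact: measurable_sublevel.
  move=> k; apply: (sublevel_constant_on_lines mu_gauss Xsep (dl k) _ _ (Hv k) _ mG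
    (ltW p_gt1) t1 G_sobolev (DkG k) (q1_deriv r) q0).
  - by move=> m dm; rewrite -(lv k); have [_ ->] := covariance_opP mu_gauss Xsep (dl k).
  - by rewrite (basis_dual mu_gauss Xsep v_onb dl lv) eqxx.
  - by rewrite /normH orth eqxx sqrtr1.
rewrite -/(sublevel_mass mu G r); nra.
Qed.
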